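(* Let $k\ge 2$ be an integer and let $p>p_c:=\frac{2k+4}{k}$. Then for any $\varepsilon>0$ there exists a positive constant $C(\varepsilon)$ (depending also on $k$ and $p$) such that for every $R\ge 1$, every ball $B_R\subset\mathbb{R}^{2k+1}$ of radius $R$, and every $g\in L^2(B^k_1\times B^k_1)$, $$\|\mathcal{E}_{B^k_1\times B^k_1}g\|_{L^{p}(B_R)}\le C(\varepsilon)R^{\varepsilon}\|g\|_{L^2(B^k_1\times B^k_1)}.$$
   Context: $B^k_1$ denotes the unit ball centered at the origin in $\mathbb{R}^k$, and $e(t):=e^{it}$ for $t\in\mathbb{R}$. For $Q\subset B^k_1\times B^k_1$, $\mathcal{E}_Q$ is the Fourier extension operator associated with the hypersurface $\{(\xi,\eta,|\xi|^4-|\eta|^4):(\xi,\eta)\in B^k_1\times B^k_1\}\subset\mathbb{R}^{2k+1}$: $$\mathcal{E}_Q g(x):=\int_Q g(\xi,\eta)\,e\big(x'\cdot\xi+x''\cdot\eta+x_{2k+1}(|\xi|^4-|\eta|^4)\big)\,d\xi\,d\eta,$$ where $x=(x',x'',x_{2k+1})\in\mathbb{R}^k\times\mathbb{R}^k\times\mathbb{R}$. *)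

(* Defs.v *)
From HB Require Import structures.
From mathcomp Require Import all_boot all_order all_algebra.
From mathcomp Require Import complex.
From mathcomp Require Import all_classical all_reals all_analysis.

Set Implicit Arguments.
Unset Strict Implicit.
Unset Printing Implicit Defensive.

Import Order.TTheory GRing.Theory Num.Theory.
Import numFieldNormedType.Exports.

Local Open Scope classical_set_scope.
Local Open Scope complex_scope.
Local Open Scope ring_scope.

(* The library's sigma-algebra on tuples is the product (Borel) one. *)
Notation Rn R n := (n.-tuple (measurableTypeR R)).

Section consRn.
Context (R : realType) (n : nat).

Definition consRn (x : measurableTypeR R * Rn R n) : Rn R n.+1 :=
  [the n.+1.-tuple _ of x.1 :: x.2].

Definition unconsRn (t : Rn R n.+1) : measurableTypeR R * Rn R n :=
  (thead t, [tuple of behead t]).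

Lemma measurable_consRn : measurable_fun [set: _] consRn.
Proof.
by apply: measurable_cons; [exact: measurable_fst|exact: measurable_snd].
Qed.

HB.instance Definition _ := isMeasurableFun.Build _ _ _ _ consRn
  measurable_consRn.

Lemma measurable_unconsRn : measurable_fun [set: _] unconsRn.
Proof.
apply: (@measurable_fun_pair _ _ _ _ _ _ (fun t : Rn R n.+1 => thead t)
  (fun t : Rn R n.+1 => [tuple of behead t])).
- exact: measurable_tnth.
- exact: measurable_behead.
Qed.

Lemma consRnK : cancel consRn unconsRn.
Proof.
by move=> [x t]; rewrite /unconsRn /consRn /=; congr pair; apply: val_inj.
Qed.

End consRn.

Section product_sigma_finite.
Context d1 d2 (T1 : measurableType d1) (T2 : measurableType d2) (R : realType).
Variable m1 : {sigma_finite_measure set T1 -> \bar R}.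
Variable m2 : {sigma_finite_measure set T2 -> \bar R}.

(* m1 \x m2 under a new head symbol: the library's canonical
   sigma-finite structure on product_measure1 only covers subprobabilities. *)
Definition prod_measure : set (T1 * T2) -> \bar R := (m1 \x m2)%E.

HB.instance Definition _ := Measure.on prod_measure.

Let prod_measure_sigma_finite : sigma_finite setT prod_measure.
Proof.
have /sigma_finiteP[F [TF ndF Foo]] := sigma_finiteT m1.
have /sigma_finiteP[G [TG ndG Goo]] := sigma_finiteT m2.
exists (fun n => F n `*` G n).
  rewrite -setXTT TF TG predeqE => -[x y]; split.
    move=> [/= [n _ Fnx] [k _ Gky]]; exists (maxn n k) => //; split.
    - by move: x Fnx; exact/subsetPset/ndF/leq_maxl.
    - by move: y Gky; exact/subsetPset/ndG/leq_maxr.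
  by move=> [n _ []/= ? ?]; split; exists n.
move=> k; have [? ?] := Foo k; have [? ?] := Goo k.
split; first exact: measurableX.
by rewrite /prod_measure product_measure1E// lte_mul_pinfty// ge0_fin_numE.
Qed.

HB.instance Definition _ := Measure_isSigmaFinite.Build _ _ _ prod_measure
  prod_measure_sigma_finite.

End product_sigma_finite.

Section lebesgue_Rn_step.
Context (R : realType) (n : nat).
Variable mu : {sigma_finite_measure set (Rn R n) -> \bar R}.

Definition lebesgue_Rn_step : set (Rn R n.+1) -> \bar R :=
  pushforward (prod_measure (@lebesgue_measure R) mu) (@consRn R n).

Let step0 : lebesgue_Rn_step set0 = 0%E.
Proof. exact: measure0. Qed.

Let step_ge0 A : (0 <= lebesgue_Rn_step A)%E.
Proof. exact: measure_ge0. Qed.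

Let step_sigma_additive : semi_sigma_additive lebesgue_Rn_step.
Proof. exact: measure_semi_sigma_additive. Qed.

HB.instance Definition _ := isMeasure.Build _ _ _ lebesgue_Rn_step
  step0 step_ge0 step_sigma_additive.

Let step_sigma_finite : sigma_finite setT lebesgue_Rn_step.
Proof.
have [F UF mF] := sigma_finiteT (prod_measure (@lebesgue_measure R) mu).
exists (fun i => @unconsRn R n @^-1` F i).
  by rewrite -preimage_bigcup -UF preimage_setT.
move=> i; have [mFi Fioo] := mF i; split.
  by rewrite -[X in measurable X]setTI; exact: measurable_unconsRn.
rewrite /lebesgue_Rn_step /pushforward -comp_preimage.
by rewrite (_ : _ \o _ = id) ?preimage_id//; apply/funext => x; exact: consRnK.
Qed.

HB.instance Definition _ := Measure_isSigmaFinite.Build _ _ _ lebesgue_Rn_step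
  step_sigma_finite.

End lebesgue_Rn_step.

Fixpoint lebesgue_Rn (R : realType) (n : nat) :
    {sigma_finite_measure set (Rn R n) -> \bar R} :=
  match n with
  | 0 => [the {sigma_finite_measure set (Rn R 0) -> \bar R} of
           dirac ([tuple] : Rn R 0)]
  | m.+1 => [the {sigma_finite_measure set (Rn R m.+1) -> \bar R} of
              lebesgue_Rn_step (lebesgue_Rn R m)]
  end.

Lemma lebesgue_RnS (R : realType) (n : nat) (A : set (measurableTypeR R))
    (B : set (Rn R n)) : measurable A -> measurable B ->
  lebesgue_Rn R n.+1 [set t | A (thead t) /\ B [tuple of behead t]] =
  (lebesgue_measure A * lebesgue_Rn R n B)%E.
Proof.
move=> mA mB; rewrite /= /lebesgue_Rn_step /pushforward.
rewrite -(product_measure1E (@lebesgue_measure R))//; congr (_ _).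
apply/seteqP; split => -[x t] /= [Ax Bt]; split => //=;
  by move: Bt; congr (B _); apply: val_inj.
Qed.

Section euclidean.
Context (R : realType) (n : nat).
Implicit Types x y : Rn R n.

Definition dotRn x y : R := \sum_(i < n) tnth x i * tnth y i.

Definition normRn x : R := Num.sqrt (dotRn x x).

Definition unit_ballRn : set (Rn R n) := [set x | normRn x <= 1].

End euclidean.

Arguments unit_ballRn R n : clear implicits.

(* R^{2k} and R^{2k+1}, with x = (x', x'', x_{2k+1}). *)
Notation freqT R k := (Rn R k * Rn R k)%type.
Notation spaceT R k := (Rn R k * Rn R k * measurableTypeR R)%type.

Section extension.
Context (R : realType) (k : nat).

Definition lebesgue_freq :
    {sigma_finite_measure set (freqT R k) -> \bar R} :=
  prod_measure (lebesgue_Rn R k) (lebesgue_Rn R k).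

Definition lebesgue_space :
    {sigma_finite_measure set (spaceT R k) -> \bar R} :=
  prod_measure lebesgue_freq (@lebesgue_measure R).

Definition dist_space (x y : spaceT R k) : R :=
  Num.sqrt (\sum_(i < k) (tnth x.1.1 i - tnth y.1.1 i) ^+ 2 +
            \sum_(i < k) (tnth x.1.2 i - tnth y.1.2 i) ^+ 2 +
            (x.2 - y.2) ^+ 2).

Definition ball_space (c : spaceT R k) (r : R) : set (spaceT R k) :=
  [set x | dist_space c x <= r].

Definition cexp (t : R) : R[i] := cos t +i* sin t.

Definition phase (x : spaceT R k) (z : freqT R k) : R :=
  dotRn x.1.1 z.1 + dotRn x.1.2 z.2 + x.2 * (normRn z.1 ^+ 4 - normRn z.2 ^+ 4).

End extension.

Section complex_integral.
Context d (T : measurableType d) (R : realType).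
Variable mu : {measure set T -> \bar R}.
Implicit Types (D : set T) (f : T -> R[i]).

Definition cintegral D f : R[i] :=
  (\int[mu]_(x in D) complex.Re (f x)) +i* (\int[mu]_(x in D) complex.Im (f x)).

Definition cmeasurable D f : Prop :=
  measurable_fun D (@complex.Re R \o f) /\ measurable_fun D (@complex.Im R \o f).

(* Measurability for the completion of mu. *)
Definition ae_cmeasurable D f : Prop :=
  exists2 h : T -> R[i], cmeasurable D h &
    {ae mu, forall x, D x -> f x = h x}.

Definition cLnorm (p : R) D f : \bar R :=
  ('N[mu]_p%:E[(fun x => (Normc.normc (f x))%:E) \_ D])%E.

Definition cLfun (p : R) D f : Prop :=
  ae_cmeasurable D f /\ (cLnorm p D f < +oo)%E.

End complex_integral.

Definition extension_op (R : realType) (k : nat) (Q : set (freqT R k))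
    (g : freqT R k -> R[i]) (x : spaceT R k) : R[i] :=
  cintegral (lebesgue_freq R k) Q (fun z => g z * cexp (phase x z)).

(* Main.v *)
(* The weak-type (2, q) estimate at the critical exponent q = 2 + 4 / k, followed
   by summation over dyadic level sets, gives the bound for p > q with no loss
   in R; the factor R^eps >= 1 is thrown away.

   For the weak-type estimate let A be a level set {E g > lambda} of finite
   measure.  By duality (lambda |A|)^2 is at most |g|_2^2 times the quadratic
   form of the kernel K(x - x'), the Fourier transform of the surface measure;
   the indicator of the frequency domain may be replaced by the larger weight
   w = exp (- |xi|^2 - |eta|^2).  Split the form at |t - t'| = T, where t is the
   last coordinate.  For |t - t'| <= T, positivity bounds the form by its
   diagonal t = t', where K is a Gaussian in the remaining variables; this
   contributes O(T |A|).  For |t - t'| > T the pointwise decay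
   |K| <= C |t - t'|^(- k / 2) contributes O(T^(- k / 2) |A|^2).  Optimizing T
   yields |A| <= C (|g|_2 / lambda)^q.

   K is a product of two integrals of exp (- |xi|^2) e(a . xi + t |xi|^4) over
   R^k.  Their decay t^(- k / 4) is uniform in a: rotate the contour about the
   critical point, xi = x0 + l z with l running from 1 to 1 + i / 4.  The
   integral is unchanged up to the Jacobian, and at the end point the phase
   contributes the damping factor exp (- c sqrt t |z|^2). *)

From HB Require Import structures.
Require Import Defs.
From mathcomp Require Import all_boot all_order all_algebra.
From mathcomp Require Import complex ring lra.
From mathcomp Require Import all_classical all_reals all_analysis.
From mathcomp Require Import measurable_realfun lebesgue_integral_under.
Import Order.TTheory GRing.Theory Num.Theory.
Import numFieldNormedType.Exports.

Set Implicit Arguments.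
Unset Strict Implicit.
Unset Printing Implicit Defensive.

Local Open Scope classical_set_scope.
Local Open Scope ring_scope.

(** * Dominated real-valued integrals *)

(** The Hessian of |xi|^4 vanishes at the origin, so a bound uniform in a cannot rest on second
    derivatives. What survives is convexity of fourth order: for every x0, the part of |x0 + z|^4 of
    degree at least 2 in z is bounded below by a multiple of |z|^4. Rotation turns this into damping
    by exp (- c t |z|^4), hence by exp (2 - sqrt t |z|^2), a Gaussian of width t^(- 1 / 4) and mass
    of order t^(- k / 4). The Gaussian weight extends analytically in l and leaves no boundary
    terms, which a sharp cutoff would. All integrals are real: a complex integral is the family of
    the real parts of its multiples by e^(i th), and th = 0 and th = pi / 2 recover its modulus.
    Holomorphy in l enters as the Cauchy-Riemann equations for the exponent. The indefinite sign in
    |xi|^4 - |eta|^4 does no harm, since the kernel factors and each factor decays for both signs of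
    time. Kernel decay of order sigma = k / 2 yields the exponent 2 + 2 / sigma; strict inequality p
    > q makes the dyadic sum geometric. *)

Section dominated.
Context d (T : measurableType d) (R : realType).
Variable mu : {measure set T -> \bar R}.

Lemma integrable_dominated (f g : T -> R) : measurable_fun setT f ->
  (forall x, `|f x| <= g x) -> mu.-integrable setT (EFin \o g) ->
  mu.-integrable setT (EFin \o f).
Proof.
move=> mf fg ig; apply: (@le_integrable _ _ _ mu _ _ _ (EFin \o g)) => //.
  exact/measurable_EFinP.
move=> x _ /=; rewrite lee_fin (le_trans (fg x))// ler_norm//.
Qed.

Lemma integrable_scalel (k : R) (f : T -> R) : mu.-integrable setT (EFin \o f) ->
  mu.-integrable setT (EFin \o (fun x => k * f x)).
Proof. by move=> /(integrableZl measurableT k); apply: eq_integrable. Qed.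

Lemma integrable_scaler (k : R) (f : T -> R) : mu.-integrable setT (EFin \o f) ->
  mu.-integrable setT (EFin \o (fun x => f x * k)).
Proof. by move=> /(integrableZr measurableT k); apply: eq_integrable. Qed.

Lemma integrable_add (f g : T -> R) : mu.-integrable setT (EFin \o f) ->
  mu.-integrable setT (EFin \o g) ->
  mu.-integrable setT (EFin \o (fun x => f x + g x)).
Proof. by move=> /integrableD h /(h measurableT); apply: eq_integrable. Qed.

Lemma integrable_sub (f g : T -> R) : mu.-integrable setT (EFin \o f) ->
  mu.-integrable setT (EFin \o g) ->
  mu.-integrable setT (EFin \o (fun x => f x - g x)).
Proof. by move=> /integrableB h /(h measurableT); apply: eq_integrable. Qed.

Lemma integrable_indic_lty (A : set T) : measurable A -> (mu A < +oo)%E ->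
  mu.-integrable setT (EFin \o (\1_A : T -> R)).
Proof.
move=> mA Aoo; apply/integrableP; split; first by apply/measurable_EFinP; exact: measurable_indic.
under eq_integral do rewrite /= ger0_norm ?indicE//.
by under eq_integral do rewrite -indicE; rewrite integral_indic// setIT.
Qed.

Lemma EFin_Rintegral (f : T -> R) : mu.-integrable setT (EFin \o f) ->
  ((\int[mu]_x f x)%:E = \int[mu]_x (f x)%:E)%E.
Proof. by move=> intf; rewrite /Rintegral fineK//; exact: integrable_fin_num. Qed.

Lemma normr_Rintegral_le (f g : T -> R) : measurable_fun setT f ->
  (forall x, `|f x| <= g x) -> mu.-integrable setT (EFin \o g) ->
  `|\int[mu]_x f x| <= \int[mu]_x g x.
Proof.
move=> mf fg ig; have intf := integrable_dominated mf fg ig.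
apply: le_trans (le_normr_Rintegral measurableT intf) _.
by apply: le_Rintegral => //; exact: integrable_norm.
Qed.

End dominated.

(** * Fubini for real integrands under a product majorant *)

Section product_dominated.
Context d1 d2 (T1 : measurableType d1) (T2 : measurableType d2) (R : realType).
Variables (m1 : {sigma_finite_measure set T1 -> \bar R})
  (m2 : {sigma_finite_measure set T2 -> \bar R}).
Variables (f : T1 * T2 -> R) (g : T1 -> R) (h : T2 -> R).
Hypothesis mf : measurable_fun setT f.
Hypothesis fgh : forall x y, `|f (x, y)| <= g x * h y.
Hypothesis ig : m1.-integrable setT (EFin \o g).
Hypothesis ih : m2.-integrable setT (EFin \o h).

Let mfx x : measurable_fun setT (fun y => f (x, y)).
Proof. exact: measurableT_comp. Qed.

Let mfy y : measurable_fun setT (fun x => f (x, y)).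
Proof. by apply: (measurableT_comp mf); exact: pair2_measurable. Qed.

Lemma integrable_section1 x : m2.-integrable setT (EFin \o (fun y => f (x, y))).
Proof.
apply: (@integrable_dominated _ _ _ _ _ (fun y => g x * h y)) => //.
exact: integrable_scalel.
Qed.

Lemma integrable_section2 y : m1.-integrable setT (EFin \o (fun x => f (x, y))).
Proof.
apply: (@integrable_dominated _ _ _ _ _ (fun x => g x * h y)) => //.
exact: integrable_scaler.
Qed.

Lemma integrable_product : (m1 \x m2)%E.-integrable setT (EFin \o f).
Proof.
apply/integrable12ltyP; first exact/measurable_EFinP.
apply: (@le_lt_trans _ _ (\int[m1]_x ((g x)%:E * (\int[m2]_y h y)%:E))%E).
  apply: ge0_le_integral => //.
  - by move=> x _; exact: integral_ge0.
  - apply: (measurable_fun_fubini_tonelli_F (abse \o (EFin \o f))) => //=.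
    by apply: measurableT_comp => //; exact/measurable_EFinP.
  - apply: emeasurable_funM => //; exact: measurable_int ig.
  - move=> x _; rewrite EFin_Rintegral// -integralZl//.
    apply: ge0_le_integral => //.
    + by apply: measurableT_comp => //; apply/measurable_EFinP; exact: mfx.
    + apply: emeasurable_funM => //; exact: measurable_int ih.
    + by move=> y _ /=; rewrite -EFinM lee_fin.
under eq_integral do rewrite -EFinM.
rewrite (_ : (\int[m1]_x _)%E = (\int[m1]_x (g x * \int[m2]_y h y))%:E) ?ltry//.
rewrite EFin_Rintegral//.
exact: integrable_scaler.
Qed.

Lemma integrable_RintegralF :
  m1.-integrable setT (EFin \o (fun x => \int[m2]_y f (x, y))).
Proof.
have := integrable_fubini_F integrable_product.
by apply: eq_integrable => // x _; rewrite /fubini_F /= EFin_Rintegral//;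
  exact: integrable_section1.
Qed.

Lemma integrable_RintegralG :
  m2.-integrable setT (EFin \o (fun y => \int[m1]_x f (x, y))).
Proof.
apply: (@integrable_dominated _ _ _ _ _ (fun y => (\int[m1]_x g x) * h y)) => //.
- apply/measurable_EFinP.
  have := measurable_fubini_G integrable_product.
  apply: eq_measurable_fun => y _; rewrite /fubini_G /= EFin_Rintegral//.
  exact: integrable_section2.
- move=> y; rewrite -RintegralZr//.
  by apply: normr_Rintegral_le => //; exact: integrable_scaler.
- exact: integrable_scalel.
Qed.

Lemma Rintegral_product12 :
  \int[(m1 \x m2)%E]_z f z = \int[m1]_x \int[m2]_y f (x, y).
Proof.
rewrite /Rintegral -integral12_prod_meas1; last exact: integrable_product.
congr fine; apply: eq_integral => x _.
by rewrite /fubini_F -EFin_Rintegral//; exact: integrable_section1.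
Qed.

Lemma Rintegral_product21 :
  \int[(m1 \x m2)%E]_z f z = \int[m2]_y \int[m1]_x f (x, y).
Proof.
rewrite /Rintegral -integral21_prod_meas1; last exact: integrable_product.
congr fine; apply: eq_integral => x _.
by rewrite /fubini_G -EFin_Rintegral//; exact: integrable_section2.
Qed.

Lemma RFubini :
  \int[m1]_x \int[m2]_y f (x, y) = \int[m2]_y \int[m1]_x f (x, y).
Proof. by rewrite -Rintegral_product12 Rintegral_product21. Qed.

End product_dominated.

Section trigo_extra.
Context (R : realType).
Implicit Types x : R.

Lemma measurable_cosR : measurable_fun setT (@cos R).
Proof. by apply: continuous_measurable_fun; exact: continuous_cos. Qed.

Lemma measurable_sinR : measurable_fun setT (@sin R).
Proof. by apply: continuous_measurable_fun; exact: continuous_sin. Qed.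

Lemma normr_cos_le1 x : `|cos x| <= 1.
Proof. by rewrite ler_norml cos_geN1 cos_le1. Qed.

Lemma normr_sin_le1 x : `|sin x| <= 1.
Proof. by rewrite ler_norml sin_geN1 sin_le1. Qed.

End trigo_extra.

(** * Integration on R^n *)

Section affine1.
Context (R : realType).

Definition affineR (c b : R) (x : measurableTypeR R) : measurableTypeR R :=
  c * x + b.

Lemma measurable_affineR c b : measurable_fun setT (affineR c b).
Proof. by apply: measurable_funD => //; exact: measurable_funM. Qed.

(** Uniqueness of Lebesgue measure: the scaled pushforward gives each interval []l, r]] its
    length. *)
Lemma lebesgue_measure_affine c b (A : set (measurableTypeR R)) :
  0 < c -> measurable A ->
  lebesgue_measure A = (c%:E * lebesgue_measure (affineR c b @^-1` A))%E.
Proof.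
move=> c0 mA.
pose m := mscale (NngNum (ltW c0)) (pushforward lebesgue_measure (affineR c b)).
rewrite (@lebesgue_measure_unique R (m (measurable_affineR c b)))// => _ [[l r] _] <-.
change (lebesgue_measure `]l, r] =
  c%:E * lebesgue_measure (affineR c b @^-1` `]l, r]))%E.
rewrite (_ : _ @^-1` _ = `](l - b) / c, (r - b) / c]%classic); last first.
  apply/seteqP; split => x /=; rewrite !in_itv/= /affineR ltr_pdivrMr// ler_pdivlMr//;
  by rewrite ltrBlDr lerBrDr mulrC.
rewrite !lebesgue_measure_itv/= !lte_fin ltr_pM2r ?invr_gt0// ltrD2r.
case: ifPn => _; last by rewrite mule0.
by rewrite -!EFinB -EFinM -mulrBl mulrC divfK ?gt_eqF//; congr EFin; ring.
Qed.

Lemma ge0_integral_affine c b (f : measurableTypeR R -> \bar R) : 0 < c ->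
  measurable_fun setT f -> (forall x, 0 <= f x)%E ->
  (\int[lebesgue_measure]_x f (c * x + b)%R =
   (c^-1)%:E * \int[lebesgue_measure]_x f x)%E.
Proof.
move=> c0 mf f0.
pose m := mscale (NngNum (ltW c0)) (pushforward lebesgue_measure (affineR c b)).
rewrite [in RHS](@eq_measure_integral _ _ _ _ (m (measurable_affineR c b))); last first.
  by move=> A mA _; exact: (lebesgue_measure_affine b c0 mA).
rewrite /m ge0_integral_mscale//.
rewrite muleA -EFinM mulVf ?gt_eqF// mul1e.
exact/esym/(@ge0_integral_pushforward _ _ _ _ R (affineR c b)
  (measurable_affineR c b) lebesgue_measure setT f measurableT mf
  (fun x _ => f0 x)).
Qed.

End affine1.

Section lebesgue_Rn_integral.
Context (R : realType).
Local Notation leb := (@lebesgue_measure R).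

Lemma ge0_integral_Rn0 (f : Rn R 0 -> \bar R) : measurable_fun setT f ->
  (\int[lebesgue_Rn R 0]_x f x = f [tuple])%E.
Proof. by move=> mf; rewrite integral_dirac//= diracT mul1e. Qed.

Lemma ge0_integral_RnS n (f : Rn R n.+1 -> \bar R) : measurable_fun setT f ->
  (forall x, 0 <= f x)%E ->
  (\int[lebesgue_Rn R n.+1]_x f x =
   \int[leb]_x \int[lebesgue_Rn R n]_t f (consRn (x, t)))%E.
Proof.
move=> mf f0.
have mfc : measurable_fun setT (f \o @consRn R n).
  by apply: measurableT_comp => //; exact: measurable_consRn.
rewrite -(@fubini_tonelli1 _ _ _ _ _ leb (lebesgue_Rn R n) (f \o @consRn R n))//;
  last by move=> x; exact: f0.
exact: (@ge0_integral_pushforward _ _ _ _ R (@consRn R n)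
  (@measurable_consRn R n) (prod_measure leb (lebesgue_Rn R n)) setT f measurableT mf
  (fun x _ => f0 x)).
Qed.

Definition affineRn n (c : R) (b x : Rn R n) : Rn R n :=
  [tuple c * tnth x i + tnth b i | i < n].

Lemma measurable_tnthR n (i : 'I_n) :
  measurable_fun setT (fun x : Rn R n => tnth x i : R).
Proof. exact: measurable_tnth. Qed.

Lemma measurable_affineRn n c (b : Rn R n) : measurable_fun setT (affineRn c b).
Proof.
apply/measurable_fun_tnthP => i.
rewrite (_ : _ \o _ = fun x => c * tnth x i + tnth b i); last first.
  by apply/funext => x /=; rewrite tnth_mktuple.
by apply: measurable_funD => //; apply: measurable_funM => //; exact: measurable_tnthR.
Qed.

Lemma tnth_consRn0 n x (t : Rn R n) : tnth (consRn (x, t)) ord0 = x.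
Proof. by []. Qed.

Lemma tnth_consRnS n x (t : Rn R n) j : tnth (consRn (x, t)) (lift ord0 j) = tnth t j.
Proof. by rewrite (tnth_nth (tnth t j))/= -tnth_nth. Qed.

Lemma unconsRnK n : cancel (@unconsRn R n) (@consRn R n).
Proof. by move=> b; rewrite [RHS]tuple_eta; apply: val_inj. Qed.

Lemma affineRn_cons n c (b : Rn R n.+1) x (t : Rn R n) :
  affineRn c b (consRn (x, t)) =
  consRn (c * x + (unconsRn b).1, affineRn c (unconsRn b).2 t).
Proof.
rewrite -{1}(unconsRnK b); case: (unconsRn b) => b0 b' /=.
apply: eq_from_tnth => i; rewrite tnth_mktuple.
case: (unliftP ord0 i) => [j ->|->]; last by rewrite !tnth_consRn0.
by rewrite !tnth_consRnS tnth_mktuple.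
Qed.

(** Homotheties and translations are the only changes of variables that the proof makes. They act on
    each coordinate separately, so Tonelli peels off one coordinate at a time, each contributing a
    factor c^-1. *)
Lemma ge0_integral_affineRn n c (b : Rn R n) (f : Rn R n -> \bar R) : 0 < c ->
  measurable_fun setT f -> (forall x, 0 <= f x)%E ->
  (\int[lebesgue_Rn R n]_x f (affineRn c b x) =
   (c ^- n)%:E * \int[lebesgue_Rn R n]_x f x)%E.
Proof.
move=> c0; elim: n b f => [|n IH] b f mf f0.
  rewrite !ge0_integral_Rn0//; last first.
    by apply: (measurableT_comp mf); exact: measurable_affineRn.
  by rewrite expr0 invr1 mul1e; congr f; apply: eq_from_tnth => -[].
have mfc : measurable_fun setT (f \o @consRn R n).
  by apply: measurableT_comp => //; exact: measurable_consRn.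
rewrite !ge0_integral_RnS//; last first.
  by apply: (measurableT_comp mf); exact: measurable_affineRn.
under eq_integral.
  move=> x _; under eq_integral do rewrite affineRn_cons.
  rewrite (IH _ (fun t => f (consRn (c * x + (unconsRn b).1, t))))//; last first.
    by apply: (measurableT_comp mfc); exact: pair1_measurable.
  over.
have mF : measurable_fun setT
    (fun x => \int[lebesgue_Rn R n]_t f (consRn (x, t)))%E.
  by apply: (measurable_fun_fubini_tonelli_F (f \o @consRn R n)) => // x; exact: f0.
rewrite (@ge0_integral_affine _ _ _ (fun x => (c ^- n)%:E *
  \int[lebesgue_Rn R n]_t f (consRn (x, t))))%E//.
- have cn0 : (0 <= (c ^- n)%:E)%E by rewrite lee_fin invr_ge0 exprn_ge0// ltW.
  rewrite ge0_integralZl//.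
    by rewrite muleA -EFinM exprS invfM.
  by move=> x _; exact: integral_ge0.
- by apply: emeasurable_funM.
- move=> x; rewrite mule_ge0//; last exact: integral_ge0.
  by rewrite lee_fin invr_ge0 exprn_ge0// ltW.
Qed.

End lebesgue_Rn_integral.

Section Rn_Rintegral.
Context (R : realType).
Local Notation leb := (@lebesgue_measure R).

Lemma integrable_affineRn n c (b : Rn R n) (f : Rn R n -> R) : 0 < c ->
  (lebesgue_Rn R n).-integrable setT (EFin \o f) ->
  (lebesgue_Rn R n).-integrable setT (EFin \o (f \o affineRn c b)).
Proof.
move=> c0 /integrableP[mf foo]; apply/integrableP; split.
  by apply: (measurableT_comp mf); exact: measurable_affineRn.
have mf' : measurable_fun setT (fun x => `|(f x)%:E|)%E by exact: measurableT_comp.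
have /= -> := @ge0_integral_affineRn R n c b (fun x => `|(f x)%:E|)%E c0 mf'
  (fun x => abse_ge0 _).
by apply: lte_mul_pinfty => //; rewrite lee_fin invr_ge0 exprn_ge0// ltW.
Qed.

Lemma Rintegral_affineRn n c (b : Rn R n) (f : Rn R n -> R) : 0 < c ->
  (lebesgue_Rn R n).-integrable setT (EFin \o f) ->
  \int[lebesgue_Rn R n]_x f (affineRn c b x) =
  c ^- n * \int[lebesgue_Rn R n]_x f x.
Proof.
move=> c0 intf; have mf := measurable_int _ intf.
rewrite /Rintegral integralE [in RHS]integralE.
rewrite [X in fine (X - _)](_ : _ = (c ^- n)%:E *
    \int[lebesgue_Rn R n]_x ((EFin \o f)^\+ x))%E; last first.
  rewrite -(ge0_integral_affineRn b c0 (measurable_funepos mf))//.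
  by apply: eq_integral => x _; rewrite -[RHS]/((_ \o affineRn c b) x) -funepos_comp.
rewrite [X in fine (_ - X) = _](_ : _ = (c ^- n)%:E *
    \int[lebesgue_Rn R n]_x ((EFin \o f)^\- x))%E; last first.
  rewrite -(ge0_integral_affineRn b c0 (measurable_funeneg mf))//.
  by apply: eq_integral => x _; rewrite -[RHS]/((_ \o affineRn c b) x) -funeneg_comp.
have p := integrable_pos_fin_num measurableT intf.
have m := integrable_neg_fin_num measurableT intf.
by rewrite -muleBr// ?fin_num_adde_defl ?fin_numN// fineM// fin_numB p m.
Qed.

Lemma Rintegral_RnS n (f : Rn R n.+1 -> R) :
  measurable_fun setT f ->
  (prod_measure leb (lebesgue_Rn R n)).-integrable setT (EFin \o f \o @consRn R n) ->
  (lebesgue_Rn R n.+1).-integrable setT (EFin \o f) /\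
  \int[lebesgue_Rn R n.+1]_x f x = \int[prod_measure leb (lebesgue_Rn R n)]_z f (consRn z).
Proof.
move=> mf intf; have mEf : measurable_fun setT (EFin \o f) by exact/measurable_EFinP.
split.
  exact: (@integrable_pushforward _ _ _ _ R (@consRn R n)
    (@measurable_consRn R n) (prod_measure leb (lebesgue_Rn R n)) setT (EFin \o f) mEf intf measurableT).
congr fine.
exact: (@integral_pushforward _ _ _ _ R (@consRn R n)
    (@measurable_consRn R n) (prod_measure leb (lebesgue_Rn R n)) setT (EFin \o f) mEf intf measurableT).
Qed.

Lemma measurable_dotRn d (T : measurableType d) n (F G : T -> Rn R n) :
  measurable_fun setT F -> measurable_fun setT G ->
  measurable_fun setT (fun x => dotRn (F x) (G x)).
Proof.
move=> mF mG; apply: measurable_sum => i.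
by apply: measurable_funM;
  [apply: (measurableT_comp (@measurable_tnthR R n i) mF)|
   apply: (measurableT_comp (@measurable_tnthR R n i) mG)].
Qed.

Lemma dotRn_cons n x y (s t : Rn R n) :
  dotRn (consRn (x, s)) (consRn (y, t)) = x * y + dotRn s t.
Proof.
rewrite /dotRn big_ord_recl !tnth_consRn0; congr (_ + _).
by apply: eq_bigr => i _; rewrite !tnth_consRnS.
Qed.

Lemma dotRn_ge0 n (x : Rn R n) : 0 <= dotRn x x.
Proof. by apply: sumr_ge0 => i _; rewrite -expr2 sqr_ge0. Qed.

Lemma integrable_gaussRn n :
  (lebesgue_Rn R n).-integrable setT (EFin \o (fun x => expR (- dotRn x x))).
Proof.
have mg m : measurable_fun setT (fun x : Rn R m => expR (- dotRn x x)).
  by apply: measurableT_comp => //; apply: measurableT_comp => //; exact: measurable_dotRn.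
elim: n => [|n IH].
  apply/integrableP; split; first by apply/measurable_EFinP; exact: mg.
  rewrite ge0_integral_Rn0; last by apply: measurableT_comp => //; apply/measurable_EFinP; exact: mg.
  by rewrite /= ltry.
apply Rintegral_RnS => //.
apply: (@integrable_product _ _ _ _ _ leb (lebesgue_Rn R n)
  (fun z => expR (- dotRn (consRn z) (consRn z)))
  (fun x => expR (- x ^+ 2)) (fun x => expR (- dotRn x x))) => //.
- by apply: (measurableT_comp (mg _)); exact: measurable_consRn.
- by move=> x y; rewrite dotRn_cons ger0_norm ?expR_ge0// opprD expRD expr2.
- exact: integrableT_gauss.
Qed.

End Rn_Rintegral.

(** * Contour rotation and decay of the quartic integral *)

Section oscillatory_derivative.
Context d (Z : measurableType d) (R : realType).
Variable mu : {measure set Z -> \bar R}.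
Variables (P Q P' Q' : R -> Z -> R) (a b : R) (G : Z -> R).
Let I : set R := `]a, b[.
Hypothesis mP : forall r, measurable_fun setT (P r).
Hypothesis mQ : forall r, measurable_fun setT (Q r).
Hypothesis dP : forall r z, I r -> is_derive r 1 (P^~ z) (P' r z).
Hypothesis dQ : forall r z, I r -> is_derive r 1 (Q^~ z) (Q' r z).
Hypothesis PG : forall r z, I r -> expR (P r z) <= G z.
Hypothesis PG' : forall r z, I r -> expR (P r z) * (`|P' r z| + `|Q' r z|) <= G z.
Hypothesis iG : mu.-integrable setT (EFin \o G).

Let f r z := expR (P r z) * cos (Q r z).
Let f' r z := expR (P r z) * (P' r z * cos (Q r z) - Q' r z * sin (Q r z)).

Lemma is_derive_expR_cos r z : I r -> is_derive r 1 (f ^~ z) (f' r z).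
Proof.
move=> Ir; have dPz := dP z Ir; have dQz := dQ z Ir.
have : is_derive r 1 ((expR \o P ^~ z) * (cos \o Q ^~ z)) (f' r z).
  apply: is_derive_eq; rewrite /f' /GRing.scale /=; ring.
by [].
Qed.

(** The integrand is the real part of exp (P + i Q). A single majorant [G], uniform for the
    parameter in [I], controls it and its derivative. The contour rotation and the Gaussian
    integrals both instantiate this. *)
Lemma is_derive_Rintegral_expR_cos r : I r ->
  is_derive r 1 (fun r => \int[mu]_z f r z) (\int[mu]_z f' r z).
Proof.
move=> Ir.
have G0 z : 0 <= G z by apply: le_trans (PG z Ir); exact: expR_ge0.
have intf x : I x -> mu.-integrable setT (EFin \o f x).
  move=> Ix; apply: (@integrable_dominated _ _ _ _ _ G) => //.
    by apply: measurable_funM; apply: measurableT_comp => //; exact: measurable_cosR.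
  move=> z; rewrite normrM (ger0_norm (expR_ge0 _)).
  by rewrite (le_trans _ (PG z Ix))// ler_piMr ?expR_ge0 ?normr_cos_le1.
have df x z : I x -> setT z -> derivable (f ^~ z) x 1.
  by move=> Ix _; case: (is_derive_expR_cos z Ix).
have d1f x z : I x -> partial1of2 f x z = f' x z.
  move=> Ix; rewrite /partial1of2 derive1E.
  by case: (is_derive_expR_cos z Ix).
have f'G x z : I x -> setT z -> `|partial1of2 f x z| <= G z.
  move=> Ix _; rewrite d1f//; apply: le_trans (PG' z Ix).
  rewrite normrM (ger0_norm (expR_ge0 _)) ler_pM2l ?expR_gt0//.
  rewrite (le_trans (ler_normB _ _))// !normrM.
  by apply: lerD; rewrite ler_piMr ?normr_cos_le1 ?normr_sin_le1.
apply: DeriveDef.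
  exact: (derivable_under_integral measurableT Ir intf df G0 iG f'G).
rewrite -derive1E.
rewrite (differentiation_under_integral measurableT Ir intf df G0 iG f'G).
by apply: eq_Rintegral => z _; rewrite /= d1f.
Qed.

End oscillatory_derivative.

(** * Algebra of the rotated quartic exponent *)

Section rotated_phase.
Context (R : realType).
Variables (m t : R).
Implicit Types u v p q r s : R.

(* Real and imaginary parts of
     - |x0 + l z|^2 + i (x . (x0 + l z) + t |x0 + l z|^4),  l = u + i v,
   continued analytically in l, where x = - 4 t |x0|^2 x0 makes x0 the critical
   point of the phase, and m = |x0|^2, p = x0 . z, q = |z|^2. *)
Definition rot_re u v p q : R :=
  - (m + 2 * u * p + (u ^+ 2 - v ^+ 2) * q)
  - t * (2 * u * v * (2 * m * q + 4 * p ^+ 2)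
         + 4 * (3 * u ^+ 2 * v - v ^+ 3) * (p * q)
         + (4 * u ^+ 3 * v - 4 * u * v ^+ 3) * q ^+ 2).

Definition rot_im u v p q : R :=
  - (2 * v * p + 2 * u * v * q)
  + t * (- 3 * m ^+ 2 + (u ^+ 2 - v ^+ 2) * (2 * m * q + 4 * p ^+ 2)
         + 4 * (u ^+ 3 - 3 * u * v ^+ 2) * (p * q)
         + (u ^+ 4 - 6 * u ^+ 2 * v ^+ 2 + v ^+ 4) * q ^+ 2).

(** The u-derivatives of [rot_re] and [rot_im]. By the Cauchy-Riemann equations they also express
    the derivatives in v and along rays. *)
Definition rot_re_u u v p q : R :=
  - (2 * p + 2 * u * q)
  - t * (2 * v * (2 * m * q + 4 * p ^+ 2) + 24 * u * v * (p * q)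
         + (12 * u ^+ 2 * v - 4 * v ^+ 3) * q ^+ 2).

Definition rot_im_u u v p q : R :=
  - (2 * v * q)
  + t * (2 * u * (2 * m * q + 4 * p ^+ 2)
         + 12 * (u ^+ 2 - v ^+ 2) * (p * q)
         + (4 * u ^+ 3 - 12 * u * v ^+ 2) * q ^+ 2).

(** The exponent sees l and z only through l z, so a real dilation of l is a dilation of z, under
    which p and q have degrees 1 and 2. *)
Lemma rot_re_scale r u v p q :
  rot_re (r * u) (r * v) p q = rot_re u v (r * p) (r ^+ 2 * q).
Proof. rewrite /rot_re; ring. Qed.

Lemma rot_im_scale r u v p q :
  rot_im (r * u) (r * v) p q = rot_im u v (r * p) (r ^+ 2 * q).
Proof. rewrite /rot_im; ring. Qed.

Lemma is_derive_rot_re_v v p q :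
  is_derive v 1 (fun v => rot_re 1 v p q) (- rot_im_u 1 v p q).
Proof.
apply: is_derive_eq; rewrite /rot_im_u /GRing.scale /=; ring.
Qed.

Lemma is_derive_rot_im_v v p q :
  is_derive v 1 (fun v => rot_im 1 v p q) (rot_re_u 1 v p q).
Proof.
apply: is_derive_eq; rewrite /rot_re_u /GRing.scale /=; ring.
Qed.

Lemma is_derive_rot_re_r s r p q :
  is_derive r 1 (fun r => rot_re r (r * s) p q)
    (rot_re_u r (r * s) p q - s * rot_im_u r (r * s) p q).
Proof.
apply: is_derive_eq; rewrite /rot_re_u /rot_im_u /GRing.scale /=; ring.
Qed.

Lemma is_derive_rot_im_r s r p q :
  is_derive r 1 (fun r => rot_im r (r * s) p q)
    (rot_im_u r (r * s) p q + s * rot_re_u r (r * s) p q).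
Proof.
apply: is_derive_eq; rewrite /rot_re_u /rot_im_u /GRing.scale /=; ring.
Qed.

Hypothesis t0 : 0 <= t.

(** The t-part of the exponent is nonpositive, so the bound does not see t: rotating in the
    direction v > 0 only damps. *)
Lemma rot_re_le s p q : 0 <= s <= 3^-1 -> 0 <= q -> p ^+ 2 <= m * q ->
  rot_re 1 s p q <= - (m + 2 * p + q) + s ^+ 2 * q.
Proof.
move=> s03 q0 pmq.
(* This is the coefficient of - 4 s t. Replace m q by the smaller p^2 and complete the square in p;
   what remains, 1/4 - s^2/2 - s^4/12, is positive for s <= 1/3. *)
have h : 0 <= (m * q + 2 * p ^+ 2) + (3 - s ^+ 2) * (p * q) + (1 - s ^+ 2) * q ^+ 2.
  have : 0 <= 3 * (p + (3 - s ^+ 2) / 6 * q) ^+ 2 +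
     (4^-1 - s ^+ 2 / 2 - s ^+ 4 / 12) * q ^+ 2.
    apply: addr_ge0; first by rewrite mulr_ge0 ?sqr_ge0.
    rewrite mulr_ge0 ?sqr_ge0//.
    have : s ^+ 2 <= 9^-1 by nra.
    rewrite (_ : s ^+ 4 = s ^+ 2 * s ^+ 2); last by ring.
    have : 0 <= s ^+ 2 by apply: sqr_ge0.
    nra.
  lra.
have : 0 <= t * (4 * s * ((m * q + 2 * p ^+ 2) + (3 - s ^+ 2) * (p * q) + (1 - s ^+ 2) * q ^+ 2)).
  by rewrite !mulr_ge0//; lra.
rewrite /rot_re; lra.
Qed.

(** At s = 1/4 the remainder of the completed square exceeds 1/5, which gives damping t q^2 / 5. It
    is weakened to a linear function of q so that a Gaussian integral results. The last hypothesis
    is |x0 + z|^2 >= 0. *)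
Lemma rot_re_quarter p q : 1 <= t -> 0 <= q -> p ^+ 2 <= m * q -> 0 <= m + 2 * p + q ->
  rot_re 1 4^-1 p q <= 2 - Num.sqrt t * q.
Proof.
move=> t1 q0 pmq mpq.
have h : q ^+ 2 / 5 <= (m * q + 2 * p ^+ 2) + (3 - 4^-1 ^+ 2) * (p * q) + (1 - 4^-1 ^+ 2) * q ^+ 2.
  have : 0 <= 3 * (p + (3 - 4^-1 ^+ 2) / 6 * q) ^+ 2.
    by rewrite mulr_ge0 ?sqr_ge0.
  have : 0 <= q ^+ 2 by apply: sqr_ge0.
  lra.
have h1 : t * (q ^+ 2 / 5) <= t * ((m * q + 2 * p ^+ 2) + (3 - 4^-1 ^+ 2) * (p * q) + (1 - 4^-1 ^+ 2) * q ^+ 2).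
  by rewrite ler_wpM2l.
have : rot_re 1 4^-1 p q <= q / 16 - t * (q ^+ 2 / 5).
  rewrite /rot_re; lra.
move=> /le_trans; apply.
have st : Num.sqrt t ^+ 2 = t by rewrite sqr_sqrtr.
have s1 : 1 <= Num.sqrt t by rewrite -sqrtr1 ler_sqrt// (lt_le_trans ltr01).
rewrite -{1}st.
move: (Num.sqrt t) s1 => c c1.
(* With X = c q and q <= X, the claim is 17/16 X - X^2 / 5 <= 2; the square is centred at the
   maximizer of the left side. *)
have : 0 <= (c * q - 5 * 17 / 32) ^+ 2 by apply: sqr_ge0.
have : 0 <= (c - 1) * q by rewrite mulr_ge0// subr_ge0.
lra.
Qed.

(** Supplies the Gaussian majorant. The interval around r = 1 is there because the integral will be
    differentiated in r at 1. *)
Lemma rot_re_le_gauss r s p q : 2^-1 <= r <= 2 -> 0 <= s <= 3^-1 -> 0 <= m -> 0 <= q ->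
  p ^+ 2 <= m * q -> rot_re r (r * s) p q <= m - q / 16.
Proof.
move=> r12 s03 m0 q0 pmq.
rewrite -{1}[r]mulr1 rot_re_scale.
have pmq' : (r * p) ^+ 2 <= m * (r ^+ 2 * q).
  rewrite exprMn (_ : m * _ = r ^+ 2 * (m * q)); last by ring.
  by rewrite ler_wpM2l ?sqr_ge0.
have q0' : 0 <= r ^+ 2 * q by rewrite mulr_ge0 ?sqr_ge0.
apply: le_trans (rot_re_le s03 q0' pmq') _.
have rq : q / 4 <= r ^+ 2 * q.
  by rewrite mulrC ler_wpM2r//; nra.
have ss : s ^+ 2 <= 9^-1 by nra.
move: (r ^+ 2 * q) (r * p) pmq' rq q0' => {pmq r12} q' p' pmq' rq q0'.
have : s ^+ 2 * q' <= 9^-1 * q' by rewrite ler_wpM2r.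
suff : - (2 * p') <= 2 * m + q' / 2 by lra.
have : `|2 * p'| <= 2 * m + q' / 2.
  rewrite -(@ler_pXn2r _ 2)// ?nnegrE//; last lra.
  rewrite real_normK ?num_real//.
  have : 0 <= (2 * m - q' / 2) ^+ 2 by apply: sqr_ge0.
  lra.
by rewrite ler_norml => /andP[]; lra.
Qed.

(** Only polynomial growth in q matters, since the Gaussian majorant absorbs it; 1000 is a generous
    count of the monomials, each at most a multiple of N or t N^2. *)
Lemma rot_re_shift_le r s p q : 0 <= m -> 0 <= q -> p ^+ 2 <= m * q ->
  2^-1 <= r <= 2 -> 0 <= s <= 3^-1 ->
  `|rot_re_u r (r * s) p q| + `|rot_im_u r (r * s) p q| <=
  1000 * (1 + t) * (1 + m) ^+ 2 * (1 + q) ^+ 2.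
Proof.
move=> m0 q0 pmq r12 s03.
set N := (1 + m) * (1 + q).
have N1 : 1 <= N by rewrite /N; nra.
have NN : N <= N ^+ 2 by rewrite expr2 ler_peMl//; lra.
have pN : `|p| <= N.
  rewrite -(@ler_pXn2r _ 2)// ?nnegrE//; last lra.
  rewrite real_normK ?num_real// (le_trans pmq)//.
  apply: le_trans NN; rewrite /N; nra.
have qN : q <= N by rewrite /N; nra.
have mqN : m * q <= N by rewrite /N; nra.
have mqN2 : m * q <= N ^+ 2 by lra.
have ppN : p ^+ 2 <= N ^+ 2 by lra.
have pqN : `|p * q| <= N ^+ 2.
  by rewrite normrM expr2 (ger0_norm q0) ler_pM.
have qqN : q ^+ 2 <= N ^+ 2 by rewrite ler_pXn2r// nnegrE//; lra.
have pp0 : 0 <= p ^+ 2 by apply: sqr_ge0.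
have qq0 : 0 <= q ^+ 2 by apply: sqr_ge0.
have mq0 : 0 <= m * q by apply: mulr_ge0.
have v0 : 0 <= r * s by nra.
have v1 : r * s <= 2/3 by nra.
have r0 : 0 <= r by lra.
have r2 : r <= 2 by lra.
have bnd c x M K : `|c| <= K -> `|x| <= M -> `|c * x| <= K * M.
  by move=> cK xM; rewrite normrM ler_pM.
have mp : `|2 * m * q + 4 * p ^+ 2| <= 6 * N ^+ 2.
  by rewrite ger0_norm; clear -mqN2 ppN pp0 mq0; lra.
move: (r * s) v0 v1 => v v0 v1.
have L1 : `|2 * v * (2 * m * q + 4 * p ^+ 2)| <= 2 * (6 * N ^+ 2).
  by apply: (bnd _ _ _ _) => //; rewrite ger0_norm; clear -v0 v1; lra.
have L2 : `|24 * r * v * (p * q)| <= 48 * N ^+ 2.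
  apply: (bnd _ _ _ _) => //; rewrite ger0_norm; clear -v0 v1 r0 r2; nra.
have r3 : r ^+ 2 <= 4 by clear -r0 r2; nra.
have v3 : v ^+ 2 <= 1 by clear -v0 v1; nra.
have r30 : 0 <= r ^+ 2 by apply: sqr_ge0.
have v30 : 0 <= v ^+ 2 by apply: sqr_ge0.
have L3 : `|(12 * r ^+ 2 * v - 4 * v ^+ 3) * q ^+ 2| <= 60 * N ^+ 2.
  apply: (bnd _ _ _ _); last by rewrite ger0_norm.
  rewrite (_ : _ - _ = v * (12 * r ^+ 2 - 4 * v ^+ 2)); last by ring.
  rewrite (_ : 60 = 1 * 60); last by ring.
  by apply: (bnd _ _ _ _); rewrite ler_norml; clear -v0 v1 r3 v3 r30 v30; lra.
have L4 : `|2 * r * (2 * m * q + 4 * p ^+ 2)| <= 4 * (6 * N ^+ 2).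
  by apply: (bnd _ _ _ _) => //; rewrite ger0_norm; clear -r0 r2; lra.
have L5 : `|12 * (r ^+ 2 - v ^+ 2) * (p * q)| <= 60 * N ^+ 2.
  by apply: (bnd _ _ _ _) => //; rewrite ler_norml; clear -r3 v3 r30 v30; lra.
have L6 : `|(4 * r ^+ 3 - 12 * r * v ^+ 2) * q ^+ 2| <= 60 * N ^+ 2.
  apply: (bnd _ _ _ _); last by rewrite ger0_norm.
  rewrite (_ : _ - _ = r * (4 * r ^+ 2 - 12 * v ^+ 2)); last by ring.
  rewrite (_ : 60 = 2 * 30); last by ring.
  by apply: (bnd _ _ _ _); rewrite ler_norml; clear -r0 r2 r3 v3 r30 v30; lra.
have rq : r * q <= 2 * N by rewrite ler_pM.
have vq : v * q <= 1 * N by rewrite ler_pM//; clear -v1; lra.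
have rq0 : 0 <= r * q by rewrite mulr_ge0.
have vq0 : 0 <= v * q by rewrite mulr_ge0.
have A : `|rot_re_u r v p q| <= 6 * N + t * (200 * N ^+ 2).
  rewrite /rot_re_u (le_trans (ler_normB _ _))//; apply: lerD.
    by rewrite normrN; move: pN; clear -vq0 rq0 vq rq; rewrite !ler_norml; lra.
  rewrite normrM (ger0_norm t0) ler_wpM2l//.
  by move: L1 L2 L3; clear; rewrite !ler_norml; lra.
have B : `|rot_im_u r v p q| <= 2 * N + t * (200 * N ^+ 2).
  rewrite /rot_im_u (le_trans (ler_normD _ _))//; apply: lerD.
    by move: pN; clear -vq0 rq0 vq rq; rewrite normrN !ler_norml; lra.
  rewrite normrM (ger0_norm t0) ler_wpM2l//.
  by move: L4 L5 L6; clear; rewrite !ler_norml; lra.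
have tN : 0 <= t * N ^+ 2 by rewrite mulr_ge0// sqr_ge0.
rewrite -[_ * _ * (1 + q) ^+ 2]mulrA -exprMn -/N.
by clear -A B tN NN N1; lra.
Qed.

End rotated_phase.

Section dotRn_algebra.
Context (R : realType) (n : nat).
Implicit Types (x y z : Rn R n) (c : R).

Lemma dotRnC x y : dotRn x y = dotRn y x.
Proof. by apply: eq_bigr => i _; rewrite mulrC. Qed.

Lemma dotRn_affine_r c x y z :
  dotRn x (affineRn c y z) = c * dotRn x z + dotRn x y.
Proof.
rewrite /dotRn mulr_sumr -big_split/=; apply: eq_bigr => i _.
rewrite tnth_mktuple; ring.
Qed.

Lemma dotRn_affine c y z :
  dotRn (affineRn c y z) (affineRn c y z) =
  c ^+ 2 * dotRn z z + 2 * c * dotRn y z + dotRn y y.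
Proof.
rewrite dotRn_affine_r !(dotRnC (affineRn _ _ _)) !dotRn_affine_r (dotRnC z y); ring.
Qed.

Lemma dotRn_CauchySchwarz x y : dotRn x y ^+ 2 <= dotRn x x * dotRn y y.
Proof.
have h c : 0 <= c ^+ 2 * dotRn y y + 2 * c * dotRn x y + dotRn x x.
  by rewrite -dotRn_affine; exact: dotRn_ge0.
have y0 := dotRn_ge0 y; have x0 := dotRn_ge0 x.
have [yy|yy] := eqVneq (dotRn y y) 0.
  rewrite yy mulr0.
  have [->|xy] := eqVneq (dotRn x y) 0; first by rewrite expr0n.
  (* When y.y = 0 the form is affine in c, and this c would give it the value -1. *)
  have := h (- (dotRn x x + 1) / (2 * dotRn x y)); rewrite yy mulr0 add0r.
  rewrite (_ : _ + _ = - 1); last by field.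
  by rewrite oppr_ge0 ler10.
have yp : 0 < dotRn y y by rewrite lt_def yy.
have := h (- dotRn x y / dotRn y y).
rewrite (_ : _ + _ + _ = dotRn x x - dotRn x y ^+ 2 / dotRn y y); last by field.
by rewrite subr_ge0 ler_pdivrMr.
Qed.

End dotRn_algebra.

Section gauss_scaled.
Context (R : realType) (n : nat).

Definition origRn : Rn R n := [tuple 0 | _ < n].

Lemma dotRn_orig x : dotRn origRn x = 0.
Proof. by rewrite /dotRn big1// => i _; rewrite tnth_mktuple mul0r. Qed.

Lemma dotRn_scale c x : dotRn (affineRn c origRn x) (affineRn c origRn x) = c ^+ 2 * dotRn x x.
Proof. by rewrite dotRn_affine !dotRn_orig mulr0 !addr0. Qed.

Lemma integrable_gauss_scaled (c : R) : 0 < c ->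
  (lebesgue_Rn R n).-integrable setT (EFin \o (fun x => expR (- (c ^+ 2 * dotRn x x)))).
Proof.
move=> c0; have := integrable_affineRn origRn c0 (integrable_gaussRn R n).
by apply: eq_integrable => // x _ /=; rewrite dotRn_scale.
Qed.

Lemma Rintegral_gauss_scaled (c : R) : 0 < c ->
  \int[lebesgue_Rn R n]_x expR (- (c ^+ 2 * dotRn x x)) =
  c ^- n * \int[lebesgue_Rn R n]_x expR (- dotRn x x).
Proof.
move=> c0; rewrite -(Rintegral_affineRn origRn c0 (integrable_gaussRn R n)).
by apply: eq_Rintegral => x _; rewrite dotRn_scale.
Qed.

End gauss_scaled.

(** * Invariance of the integral under rotation of the contour *)

Section rotation.
Context (R : realType) (n : nat) (x0 : Rn R n) (t : R).
Hypothesis t0 : 0 <= t.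
Let m := dotRn x0 x0.
Let p (z : Rn R n) := dotRn x0 z.
Let q (z : Rn R n) := dotRn z z.
Local Notation mu := (lebesgue_Rn R n).
Local Notation A := (fun u v z => rot_re m t u v (p z) (q z)).
Local Notation B := (fun u v z => rot_im m t u v (p z) (q z)).
Local Notation Au := (fun u v z => rot_re_u m t u v (p z) (q z)).
Local Notation Bu := (fun u v z => rot_im_u m t u v (p z) (q z)).

Let m0 : 0 <= m. Proof. exact: dotRn_ge0. Qed.
Let q0 z : 0 <= q z. Proof. exact: dotRn_ge0. Qed.
Let pq z : p z ^+ 2 <= m * q z. Proof. exact: dotRn_CauchySchwarz. Qed.

Let mp : measurable_fun setT p.
Proof. by apply: measurable_dotRn. Qed.

Let mq : measurable_fun setT q.
Proof. by apply: measurable_dotRn. Qed.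

Let mquad c0 c1 c2 c3 c4 c5 : measurable_fun setT (fun z => c0 + c1 * p z + c2 * q z
  + c3 * p z ^+ 2 + c4 * (p z * q z) + c5 * q z ^+ 2).
Proof.
have mc (c : R) (f : Rn R n -> R) : measurable_fun setT f -> measurable_fun setT (fun z => c * f z : R).
  by move=> mf; apply: measurable_funM => //.
have mp2 : measurable_fun setT (fun z => p z ^+ 2) by apply: measurable_funX; exact: mp.
have mq2 : measurable_fun setT (fun z => q z ^+ 2) by apply: measurable_funX; exact: mq.
have mpq : measurable_fun setT (fun z => p z * q z).
  by apply: measurable_funM; [exact: mp|exact: mq].
apply: measurable_funD; last exact: mc.
apply: measurable_funD; last exact: mc.
apply: measurable_funD; last exact: mc.
apply: measurable_funD; last exact: mc.
by apply: measurable_funD => //; exact: mc.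
Qed.

Let mA u v : measurable_fun setT (A u v).
Proof.
apply: (@eq_measurable_fun _ _ _ _ _ (fun z => - m + - (2 * u) * p z
  + (- (u ^+ 2 - v ^+ 2) - t * (2 * u * v * (2 * m))) * q z
  + (- t * (2 * u * v * 4)) * p z ^+ 2
  + (- t * (4 * (3 * u ^+ 2 * v - v ^+ 3))) * (p z * q z)
  + (- t * (4 * u ^+ 3 * v - 4 * u * v ^+ 3)) * q z ^+ 2)); last exact: mquad.
by move=> z _; rewrite /rot_re; ring.
Qed.

Let mB u v : measurable_fun setT (B u v).
Proof.
apply: (@eq_measurable_fun _ _ _ _ _ (fun z => - t * (3 * m ^+ 2) + - (2 * v) * p z
  + (- (2 * u * v) + t * ((u ^+ 2 - v ^+ 2) * (2 * m))) * q z
  + (t * ((u ^+ 2 - v ^+ 2) * 4)) * p z ^+ 2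
  + (t * (4 * (u ^+ 3 - 3 * u * v ^+ 2))) * (p z * q z)
  + (t * (u ^+ 4 - 6 * u ^+ 2 * v ^+ 2 + v ^+ 4)) * q z ^+ 2)); last exact: mquad.
by move=> z _; rewrite /rot_im; ring.
Qed.

Let mAu u v : measurable_fun setT (Au u v).
Proof.
apply: (@eq_measurable_fun _ _ _ _ _ (fun z => 0 + - 2 * p z
  + (- (2 * u) - t * (2 * v * (2 * m))) * q z
  + (- t * (2 * v * 4)) * p z ^+ 2 + (- t * (24 * u * v)) * (p z * q z)
  + (- t * (12 * u ^+ 2 * v - 4 * v ^+ 3)) * q z ^+ 2)); last exact: mquad.
by move=> z _; rewrite /rot_re_u; ring.
Qed.

Let mBu u v : measurable_fun setT (Bu u v).
Proof.
apply: (@eq_measurable_fun _ _ _ _ _ (fun z => 0 + 0 * p z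
  + (- (2 * v) + t * (2 * u * (2 * m))) * q z
  + (t * (2 * u * 4)) * p z ^+ 2 + (t * (12 * (u ^+ 2 - v ^+ 2))) * (p z * q z)
  + (t * (4 * u ^+ 3 - 12 * u * v ^+ 2)) * q z ^+ 2)); last exact: mquad.
by move=> z _; rewrite /rot_im_u; ring.
Qed.

Let L := 1000 * (1 + t) * (1 + m) ^+ 2.

Let L0 : 0 <= L.
Proof. by apply: mulr_ge0; [apply: mulr_ge0; [exact: ler0n|exact: addr_ge0]|exact: sqr_ge0]. Qed.

(** [G] dominates the integrand and its derivatives. Of the Gaussian rate 1/16, half absorbs (1 +
    q)^2 through 1 + q <= 64 exp (q / 64), and rate 1/32 is left, written as a square to fit
    [integrable_gauss_scaled]. The factor 2 pays for derivatives along rays, which mix [Au] and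
    [Bu]. [G] may depend on x0 and t: it only licenses limits under the integral and enters no final
    bound. *)
Let K := expR m * (1 + 2 * L * 64 ^+ 2).
Let c32 : R := Num.sqrt 32^-1.
Let G z := K * expR (- (c32 ^+ 2 * q z)).

Let c32E : c32 ^+ 2 = 32^-1. Proof. by rewrite sqr_sqrtr. Qed.

Let iG : mu.-integrable setT (EFin \o G).
Proof.
apply: integrable_scalel; apply: integrable_gauss_scaled.
by rewrite sqrtr_gt0.
Qed.

Let gauss_le r s z : 2^-1 <= r <= 2 -> 0 <= s <= 3^-1 ->
  expR (A r (r * s) z) <= expR m * expR (- (q z / 16)).
Proof.
by move=> r12 s3; rewrite -expRD ler_expR; exact: rot_re_le_gauss.
Qed.

Let poly_gauss z : (1 + q z) ^+ 2 * expR (- (q z / 16)) <= 64 ^+ 2 * expR (- (c32 ^+ 2 * q z)).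
Proof.
rewrite c32E.
have e1 : 1 + q z <= 64 * expR (q z / 64).
  have := expR_ge1Dx (q z / 64); have := q0 z; lra.
have e2 : (1 + q z) ^+ 2 <= 64 ^+ 2 * expR (q z / 32).
  rewrite (_ : 64 ^+ 2 * _ = (64 * expR (q z / 64)) ^+ 2).
    by rewrite ler_pXn2r// ?nnegrE ?mulr_ge0 ?expR_ge0//; have := q0 z; lra.
  by rewrite exprMn -expRM_natl; congr (_ * expR _); field.
apply: (@le_trans _ _ (64 ^+ 2 * expR (q z / 32) * expR (- (q z / 16)))).
  by rewrite ler_wpM2r ?expR_ge0.
rewrite -mulrA -expRD ler_pM2l//; rewrite ler_expR; lra.
Qed.

Let AG r s z : 2^-1 <= r <= 2 -> 0 <= s <= 3^-1 ->
  expR (A r (r * s) z) <= G z.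
Proof.
move=> r12 s3; apply: le_trans (gauss_le z r12 s3) _.
rewrite /G /K -[leRHS]mulrA ler_pM2l ?expR_gt0//.
apply: (@le_trans _ _ (1 * expR (- (c32 ^+ 2 * q z)))).
  rewrite mul1r ler_expR c32E; have := q0 z; lra.
rewrite ler_wpM2r ?expR_ge0// lerDl.
by apply: mulr_ge0; [apply: mulr_ge0; [exact: ler0n|exact: L0]|exact: ltW].
Qed.

Let AG' r s z X Y : 2^-1 <= r <= 2 -> 0 <= s <= 3^-1 ->
  X + Y <= 2 * (`|Au r (r * s) z| + `|Bu r (r * s) z|) ->
  expR (A r (r * s) z) * (X + Y) <= G z.
Proof.
move=> r12 s3 XY.
have b := rot_re_shift_le t0 m0 (q0 z) (pq z) r12 s3.
apply: (@le_trans _ _ (expR m * expR (- (q z / 16)) * (2 * (L * (1 + q z) ^+ 2)))).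
  apply: (@le_trans _ _ (expR (A r (r * s) z) * (2 * (L * (1 + q z) ^+ 2)))).
    rewrite ler_wpM2l ?expR_ge0//; apply: le_trans XY _.
    by rewrite ler_pM2l.
  rewrite ler_wpM2r//; last exact: gauss_le.
  by apply: mulr_ge0 => //; apply: mulr_ge0; [exact: L0|exact: sqr_ge0].
rewrite (_ : _ * _ = expR m * (2 * L * ((1 + q z) ^+ 2 * expR (- (q z / 16))))); last by ring.
rewrite /G /K -[leRHS]mulrA ler_pM2l ?expR_gt0//.
apply: (@le_trans _ _ (2 * L * (64 ^+ 2 * expR (- (c32 ^+ 2 * q z))))).
  by rewrite ler_wpM2l// mulr_ge0.
have := expR_ge0 (- (c32 ^+ 2 * q z)); move: (expR _) => E E0.
by rewrite mulrA [leRHS]mulrDl mul1r lerDr.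
Qed.

(** Let J(l) be the integral of exp (A + i B) over z, with l = 1 + i v. This is the real part of
    e^(i th) J(l): th = 0 gives Re J and th = pi / 2 gives - Im J. *)
Definition rotJ (th v : R) : R :=
  \int[mu]_z (expR (A 1 v z) * cos (B 1 v z + th)).

(** The real part of e^(i th) J'(l); hence shifting th by pi / 2 multiplies J' by i. *)
Let U (th v : R) : R := \int[mu]_z (expR (A 1 v z) *
  (Au 1 v z * cos (B 1 v z + th) - Bu 1 v z * sin (B 1 v z + th))).

Lemma is_derive_shift_arg (f : R -> R) (x df th : R) : is_derive x 1 f df ->
  is_derive x 1 (fun y => f y + th) df.
Proof. by move=> h; apply: is_derive_eq; rewrite addr0. Qed.

Let integrable_rotJ th r s : 2^-1 <= r <= 2 -> 0 <= s <= 3^-1 ->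
  mu.-integrable setT (EFin \o (fun z => expR (A r (r * s) z) * cos (B r (r * s) z + th))).
Proof.
move=> r12 s3; apply: (@integrable_dominated _ _ _ _ _ G) => //.
  apply: measurable_funM; first by apply: measurableT_comp => //; exact: mA.
  apply: (measurableT_comp (@measurable_cosR R)).
  by apply: measurable_funD => //; exact: mB.
move=> z; rewrite normrM (ger0_norm (expR_ge0 _)).
by rewrite (le_trans _ (AG z r12 s3))// ler_piMr ?expR_ge0 ?normr_cos_le1.
Qed.

Let rotJ_scale th r s : 0 < r -> 0 <= s <= 3^-1 ->
  r ^+ n * \int[mu]_z (expR (A r (r * s) z) * cos (B r (r * s) z + th)) = rotJ th s.
Proof.
move=> r0 s3.
have i1 : mu.-integrable setT (EFin \o (fun z => expR (A 1 s z) * cos (B 1 s z + th))).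
  have := @integrable_rotJ th 1 s _ s3; rewrite mul1r; apply.
  by apply/andP; split; lra.
have := Rintegral_affineRn (origRn R n) r0 i1.
rewrite /rotJ => e.
rewrite (_ : \int[mu]_z _ = r ^- n * \int[mu]_z (expR (A 1 s z) * cos (B 1 s z + th))).
  by rewrite mulrA divff ?mul1r// expf_neq0// gt_eqF.
rewrite -e; apply: eq_Rintegral => z _.
rewrite -{1 3}[r]mulr1 rot_re_scale rot_im_scale /p /q.
by rewrite dotRn_scale dotRn_affine_r (dotRnC _ (origRn R n)) dotRn_orig addr0.
Qed.

Let integrable_U th s : 0 <= s <= 3^-1 ->
  mu.-integrable setT (EFin \o (fun z => expR (A 1 s z) *
  (Au 1 s z * cos (B 1 s z + th) - Bu 1 s z * sin (B 1 s z + th)))).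
Proof.
move=> s3; have r12 : 2^-1 <= (1 : R) <= 2 by apply/andP; split; lra.
apply: (@integrable_dominated _ _ _ _ _ G) => //.
  have mB' : measurable_fun setT (fun z => B 1 s z + th).
    by apply: measurable_funD => //; exact: mB.
  apply: measurable_funM; first by apply: measurableT_comp => //; exact: mA.
  apply: measurable_funB.
    by apply: measurable_funM; [exact: mAu|exact: (measurableT_comp (@measurable_cosR R))].
  by apply: measurable_funM; [exact: mBu|exact: (measurableT_comp (@measurable_sinR R))].
move=> z; rewrite normrM (ger0_norm (expR_ge0 _)).
have h := @AG' 1 s z (`|Au 1 s z|) (`|Bu 1 s z|) r12 s3.
rewrite !mul1r in h; apply: le_trans (h _); last first.
  by rewrite ler_peMl ?addr_ge0// ler1n.
rewrite ler_wpM2l ?expR_ge0// (le_trans (ler_normB _ _))// !normrM.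
by apply: lerD; rewrite ler_piMr ?normr_cos_le1 ?normr_sin_le1.
Qed.

(** The Euler relation l J'(l) = - n J(l) at l = 1 + i s, multiplied by e^(i th). It expresses that
    r^n J(r l) does not depend on r > 0, by the dilation z -> r z; the derivative at r = 1 therefore
    vanishes. *)
Let dA_r (th s : R) : 0 <= s <= 3^-1 ->
  - n%:R * rotJ th s = U th s + s * U (th + pi / 2) s.
Proof.
move=> s3.
have I12 (r : R) : `]2^-1, 2[%classic r -> 2^-1 <= r <= 2.
  by rewrite /= in_itv/= => /andP[/ltW-> /ltW->].
have I1 : (`]2^-1, 2[%classic : set R) 1 by rewrite /= in_itv/=; apply/andP; split; lra.
have mB' r : measurable_fun setT (fun z => B r (r * s) z + th).
  by apply: measurable_funD => //; exact: mB.
have := @is_derive_Rintegral_expR_cos _ _ R mu (fun r z => A r (r * s) z)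
  (fun r z => B r (r * s) z + th)
  (fun r z => Au r (r * s) z - s * Bu r (r * s) z)
  (fun r z => Bu r (r * s) z + s * Au r (r * s) z) 2^-1 2 G
  (fun r => mA _ _) mB' _ _ _ _ iG 1 I1.
move=> /(_ (fun r z _ => is_derive_rot_re_r _ _ _ _ _ _)).
move=> /(_ (fun r z _ => is_derive_shift_arg _ (is_derive_rot_im_r _ _ _ _ _ _))).
move=> /(_ (fun r z Ir => AG z (I12 r Ir) s3)).
have h (r : R) z : `]2^-1, 2[%classic r -> expR (A r (r * s) z) *
   (`|Au r (r * s) z - s * Bu r (r * s) z| + `|Bu r (r * s) z + s * Au r (r * s) z|) <= G z.
  move=> /I12 r12; apply: AG' => //.
  have s1 : `|s| <= 1 by rewrite ger0_norm; lra.
  apply: (@le_trans _ _ ((`|Au r (r * s) z| + `|s * Bu r (r * s) z|) +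
     (`|Bu r (r * s) z| + `|s * Au r (r * s) z|))).
    by apply: lerD; [exact: ler_normB|exact: ler_normD].
  rewrite !normrM.
  have := ler_piMl (normr_ge0 (Au r (r * s) z)) s1.
  have := ler_piMl (normr_ge0 (Bu r (r * s) z)) s1.
  lra.
move=> /(_ h) dF {h}.
set F := (fun r : R => _) in dF.
have dn : is_derive (1 : R) 1 ((id : R -> R) ^+ n * F)
   (\int[mu]_z (expR (A 1 (1 * s) z) *
      ((Au 1 (1 * s) z - s * Bu 1 (1 * s) z) * cos (B 1 (1 * s) z + th)
       - (Bu 1 (1 * s) z + s * Au 1 (1 * s) z) * sin (B 1 (1 * s) z + th)))
    + F 1 * n%:R).
  have dX := @is_deriveX R R id n (1 : R) 1 1 (is_derive_id _ _).
  apply: (@is_derive_eq _ _ _ _ _ _ _ _ (is_deriveM dX dF)).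
  by rewrite exprfctE /GRing.scale /= !expr1n !mul1r !mulr1.
have cF : is_derive (1 : R) 1 ((id : R -> R) ^+ n * F) 0.
  have := is_derive_cst (rotJ th s) (1 : R) (1 : R).
  apply: near_eq_is_derive.
    have : \forall r \near (1 : R), 0 < r by apply: lt_nbhsr; exact: ltr01.
    by apply: filterS => r r0; rewrite exprfctE /= -(rotJ_scale th r0 s3).
have F1 : F 1 = rotJ th s.
  by rewrite -(rotJ_scale th (@ltr01 R) s3) expr1n mul1r.
have := @derive_val _ _ _ _ _ _ _ cF; rewrite (@derive_val _ _ _ _ _ _ _ dn).
rewrite F1 !mul1r => /eqP.
rewrite addr_eq0 => /eqP e.
rewrite mulNr mulrC -e /U.
rewrite -RintegralZl//; last exact: integrable_U.
rewrite -RintegralD//; last 2 first.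
  exact: integrable_U.
  by apply: integrable_scalel; exact: integrable_U.
apply: eq_Rintegral => z _; rewrite addrA cosDpihalf sinDpihalf; ring.
Qed.

(** Along l = 1 + i v the derivative of J is i J'(l). The majorant holds only for v >= 0, so the end
    point v = 0 is left to [rotJ_cont]. *)
Let dA_v (th v : R) : 0 < v < 3^-1 ->
  is_derive v 1 (rotJ th) (U (th + pi / 2) v).
Proof.
move=> v03.
have I12 : 2^-1 <= (1 : R) <= 2 by apply/andP; split; lra.
have I3 (y : R) : `]0, 3^-1[%classic y -> 0 <= y <= 3^-1.
  by rewrite /= in_itv/= => /andP[/ltW-> /ltW->].
have Iv : (`]0, 3^-1[%classic : set R) v by rewrite /= in_itv.
have mB' r : measurable_fun setT (fun z => B 1 r z + th).
  by apply: measurable_funD => //; exact: mB.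
have := @is_derive_Rintegral_expR_cos _ _ R mu (fun v z => A 1 v z)
  (fun v z => B 1 v z + th) (fun v z => - Bu 1 v z) (fun v z => Au 1 v z) 0 3^-1 G
  (fun r => mA _ _) mB' _ _ _ _ iG v Iv.
move=> /(_ (fun r z _ => is_derive_rot_re_v _ _ _ _ _)).
move=> /(_ (fun r z _ => is_derive_shift_arg _ (is_derive_rot_im_v _ _ _ _ _))).
have h1 (r : R) z : `]0, 3^-1[%classic r -> expR (A 1 r z) <= G z.
  by move=> /I3 r3; have := AG z I12 r3; rewrite mul1r.
have h (r : R) z : `]0, 3^-1[%classic r -> expR (A 1 r z) *
   (`|- Bu 1 r z| + `|Au 1 r z|) <= G z.
  move=> /I3 r3.
  have := @AG' 1 r z `|- Bu 1 r z| `|Au 1 r z| I12 r3; rewrite mul1r; apply.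
  by rewrite normrN addrC ler_peMl ?addr_ge0// ler1n.
move=> /(_ h1 h) dF; apply: is_derive_eq.
apply: eq_Rintegral => z _; rewrite addrA cosDpihalf sinDpihalf; ring.
Qed.

Let U_pi th s : 0 <= s <= 3^-1 -> U (th + pi / 2 + pi / 2) s = - U th s.
Proof.
move=> s3; rewrite /U -mulN1r -RintegralZl//; last exact: integrable_U.
by apply: eq_Rintegral => z _; rewrite !addrA !cosDpihalf !sinDpihalf cosDpihalf; ring.
Qed.

(** For v < 0 the damping would turn into growth, so the parameter is clamped to [Num.max v 0];
    dominated convergence then applies on a two-sided neighbourhood of 0. *)
Let rotJ_cont th : rotJ th v @[v --> 0^'+] --> rotJ th 0.
Proof.
pose f (v : R) z := expR (A 1 (Num.max v 0) z) * cos (B 1 (Num.max v 0) z + th).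
have r12 : 2^-1 <= (1 : R) <= 2 by apply/andP; split; lra.
have I3 (v : R) : `]-1, 3^-1[%classic v -> 0 <= Num.max v 0 <= 3^-1.
  rewrite /= in_itv/= => /andP[v1 v3]; rewrite le_max lexx orbT ge_max (ltW v3)/=.
  lra.
have fint (v : R) : `]-1, 3^-1[%classic v -> mu.-integrable setT (EFin \o f v).
  by move=> /I3 v3; have := integrable_rotJ th r12 v3; rewrite mul1r.
have I0 : (0 : R) \in `]-1, 3^-1[%classic.
  by rewrite inE /= in_itv/=; apply/andP; split; lra.
have cf : {ae mu, forall z, setT z -> {in `]-1, 3^-1[%classic, continuous (f ^~ z)}}.
  apply: aeW => z _ v _.
  have cm : {for v, continuous (fun v : R => Num.max v 0)}.
    by apply: continuous_max; [exact: cvg_id|exact: cvg_cst].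
  have cA (y : R) : {for y, continuous (fun v : R => A 1 v z)}.
    by apply/differentiable_continuous/derivable1_diffP; case: (is_derive_rot_re_v m t y (p z) (q z)).
  have cB (y : R) : {for y, continuous (fun v : R => B 1 v z)}.
    by apply/differentiable_continuous/derivable1_diffP; case: (is_derive_rot_im_v m t y (p z) (q z)).
  have c1 : {for v, continuous (fun v : R => expR (A 1 (Num.max v 0) z))}.
    apply: (@continuous_comp _ _ _ (fun v : R => A 1 (Num.max v 0) z) expR); last exact: continuous_expR.
    by apply: (@continuous_comp _ _ _ (fun v : R => Num.max v 0) (fun v => A 1 v z)).
  have c2 : {for v, continuous (fun v : R => B 1 (Num.max v 0) z)}.
    by apply: (@continuous_comp _ _ _ (fun v : R => Num.max v 0) (fun v => B 1 v z)).
  have c3 : {for v, continuous (fun v : R => cos (B 1 (Num.max v 0) z + th))}.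
    apply: (@continuous_comp _ _ _ (fun v : R => B 1 (Num.max v 0) z + th) cos); last exact: continuous_cos.
    exact: (cvgD c2 (cvg_cst _)).
  exact: (cvgM c1 c3).
have fG (v : R) : `]-1, 3^-1[%classic v -> {ae mu, forall z, setT z -> `|f v z| <= G z}.
  move=> /I3 v3; apply: aeW => z _; rewrite /f normrM (ger0_norm (expR_ge0 _)).
  have := AG z r12 v3; rewrite mul1r; apply: le_trans.
  by rewrite ler_piMr ?expR_ge0 ?normr_cos_le1.
have := continuity_under_integral measurableT fint cf iG fG I0.
move=> /cvg_at_right_filter.
rewrite (_ : \int[mu]_x f 0 x = rotJ th 0); last by rewrite /f maxxx.
apply: cvg_trans; apply: near_eq_cvg; near=> v.
rewrite /rotJ /f; apply: eq_Rintegral => z _.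
have v0 : 0 < v by near: v; exact: nbhs_right_gt.
by rewrite (max_idPl (ltW v0)).
Unshelve. all: by end_near. Qed.

(** The Euler relation makes l^n J(l) constant along the segment. Only its squared modulus, [phi],
    is needed: its derivative vanishes in the interior, and the mean value theorem compares v = 0
    with v = 1/4. *)
Lemma rotJ_invariant :
  rotJ 0 0 ^+ 2 + rotJ (pi / 2) 0 ^+ 2 =
  (1 + 4^-1 ^+ 2) ^+ n * (rotJ 0 4^-1 ^+ 2 + rotJ (pi / 2) 4^-1 ^+ 2).
Proof.
pose phi (v : R) := (1 + v ^+ 2) ^+ n * (rotJ 0 v ^+ 2 + rotJ (pi / 2) v ^+ 2).
have h1 (v : R) : is_derive v 1 (fun y : R => 1 + y ^+ 2) (2 * v).
  by apply: is_derive_eq; rewrite /GRing.scale /=; ring.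
have dphi (v : R) : 0 < v < 3^-1 -> is_derive v 1 phi 0.
  move=> v03; have v03' : 0 <= v <= 3^-1 by case/andP: v03 => /ltW -> /ltW ->.
  have d0 := dA_v 0 v03; have d1 := dA_v (pi / 2) v03.
  have e0 := dA_r 0 v03'; have e1 := dA_r (pi / 2) v03'.
  have Upi : U (pi / 2 + pi / 2) v = - U 0 v by rewrite -(U_pi 0 v03') add0r.
  rewrite add0r in d0 e0; rewrite Upi in d1 e1.
  rewrite (_ : phi = (fun y : R => 1 + y ^+ 2) ^+ n
     * (rotJ 0 ^+ 2 + rotJ (pi / 2) ^+ 2)); last first.
    by apply/funext => y; rewrite /phi !exprfctE.
  have h := is_deriveM (is_deriveX n (h1 v)) (is_deriveD (is_deriveX 2 d0) (is_deriveX 2 d1)).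
  apply: (@is_derive_eq _ _ _ _ _ _ _ _ h); rewrite {h} /GRing.scale /=.
  have vv : 1 + v ^+ 2 != 0 by have := sqr_ge0 v; lra.
  (* [E1] and [E0] solve the two real equations contained in l J' = - n J by multiplying with the
     conjugate of l, whence the factor |l|^2 = 1 + v^2. *)
  have E1 : U (pi / 2) v * (1 + v ^+ 2) = - n%:R * (rotJ (pi / 2) v + v * rotJ 0 v).
    transitivity ((U (pi / 2) v + v * - U 0 v) + v * (U 0 v + v * U (pi / 2) v)).
      ring.
    by rewrite -e1 -e0; ring.
  have E0 : U 0 v * (1 + v ^+ 2) = - n%:R * (rotJ 0 v - v * rotJ (pi / 2) v).
    transitivity ((U 0 v + v * U (pi / 2) v) - v * (U (pi / 2) v + v * - U 0 v)).
      ring.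
    by rewrite -e1 -e0; ring.
  rewrite exprfctE !expr1.
  rewrite (_ : (rotJ 0 ^+ 2 + rotJ (pi / 2) ^+ 2) v = rotJ 0 v ^+ 2 + rotJ (pi / 2) v ^+ 2)//.
  have nX (k : nat) : k%:R * (1 + v ^+ 2) ^+ k.-1 * (1 + v ^+ 2) = k%:R * (1 + v ^+ 2) ^+ k.
    by case: k => [|k]; rewrite ?mul0r// -mulrA -exprSr.
  apply: (mulIf vv); rewrite mul0r mulrDl.
  rewrite [X in X + _ = 0](_ : _ = (1 + v ^+ 2) ^+ n * (2 * rotJ 0 v * (U (pi / 2) v * (1 + v ^+ 2))
     - 2 * rotJ (pi / 2) v * (U 0 v * (1 + v ^+ 2)))); last by ring.
  rewrite E1 E0 [X in _ + X = 0](_ : _ = (rotJ 0 v ^+ 2 + rotJ (pi / 2) v ^+ 2) * (2 * v) *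
    (n%:R * (1 + v ^+ 2) ^+ n.-1 * (1 + v ^+ 2))); last by ring.
  rewrite nX; ring.
have c1 (y : R) : 0 < y < 3^-1 -> {for y, continuous phi}.
  by move=> /dphi [+ _]; move=> /derivable1_diffP/differentiable_continuous.
have cphi : {within `[0, 4^-1], continuous phi}.
  apply/continuous_within_itvP; first by rewrite invr_gt0 ltr0n.
  split.
  - move=> v; rewrite in_itv/= => /andP[v0 v4]; apply: c1; rewrite v0/=; lra.
  - apply: cvgM.
      have [+ _] := is_deriveX n (h1 0).
      by rewrite exprfctE => /derivable1_diffP/differentiable_continuous/cvg_at_right_filter.
    apply: cvgD; rewrite expr2; under eq_fun do rewrite expr2.
      by apply: cvgM; exact: rotJ_cont.
    by apply: cvgM; exact: rotJ_cont.
  - apply: cvg_at_left_filter; apply: c1.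
    by apply/andP; split; lra.
have := @MVT R phi (fun=> 0) 0 4^-1 _ _ cphi.
rewrite invr_gt0 ltr0n => /(_ isT)[v|v _].
  rewrite in_itv/= => /andP[v0 v4]; apply: dphi; rewrite v0/=; lra.
rewrite mul0r => /eqP; rewrite subr_eq0 => /eqP phiE.
rewrite -[RHS]/(phi 4^-1) phiE.
by rewrite /phi expr0n addr0 expr1n mul1r.
Qed.

Lemma rotJ_quarter_le th : 1 <= t ->
  `|rotJ th 4^-1| <= expR 2 * (Num.sqrt (Num.sqrt t) ^- n * \int[mu]_z expR (- dotRn z z)).
Proof.
move=> t1; pose c := Num.sqrt (Num.sqrt t).
have t_gt0 : 0 < t by exact: lt_le_trans t1.
have c0 : 0 < c by rewrite /c !sqrtr_gt0.
have cc : c ^+ 2 = Num.sqrt t by rewrite sqr_sqrtr// sqrtr_ge0.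
rewrite -(Rintegral_gauss_scaled n c0) -RintegralZl//; last exact: integrable_gauss_scaled.
apply: normr_Rintegral_le.
- apply: measurable_funM; first by apply: measurableT_comp => //; exact: mA.
  apply: (measurableT_comp (@measurable_cosR R)).
  by apply: measurable_funD => //; exact: mB.
- move=> z; rewrite normrM (ger0_norm (expR_ge0 _)) -expRD.
  rewrite (@le_trans _ _ (expR (A 1 4^-1 z)))//.
    by rewrite ler_piMr ?expR_ge0 ?normr_cos_le1.
  rewrite ler_expR cc; apply: rot_re_quarter => //.
  have := dotRn_ge0 (affineRn 1 x0 z).
  by rewrite dotRn_affine -/(p z) -/(q z) -/m; lra.
- by apply: integrable_scalel; exact: integrable_gauss_scaled.
Qed.

End rotation.

(** * Decay of the quartic integral, uniform in the linear term *)

Section decay.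
Context (R : realType) (n : nat).
Local Notation mu := (lebesgue_Rn R n).

(** The map x -> |x|^2 x is onto, so every linear term has a critical point to balance it: x0 = - r
    a with 4 t |a|^2 r^3 = 1. This is the source of uniformity in a. *)
Lemma quartic_critical_point (t : R) (a : Rn R n) : 0 < t ->
  exists x0 : Rn R n, forall z, dotRn a z = - (4 * t * dotRn x0 x0) * dotRn x0 z.
Proof.
move=> t0; have [a0|a0] := eqVneq (dotRn a a) 0.
  exists a => z; have := dotRn_CauchySchwarz a z.
  rewrite a0 mul0r mulr0 oppr0 mul0r => h; apply/eqP.
  by rewrite -sqrf_eq0 eq_le h sqr_ge0.
have ap : 0 < dotRn a a by rewrite lt_def a0 dotRn_ge0.
pose r := (4 * t * dotRn a a)^-1 `^ 3^-1.
have k0 : 0 < 4 * t * dotRn a a by rewrite !mulr_gt0.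
have r3 : r ^+ 3 = (4 * t * dotRn a a)^-1.
  by rewrite -powR_mulrn ?powR_ge0// -powRrM mulVf ?pnatr_eq0// powRr1// invr_ge0 ltW.
exists (affineRn (- r) (origRn R n) a) => z.
rewrite dotRn_scale sqrrN (dotRnC (affineRn _ _ _) z) dotRn_affine_r.
rewrite (dotRnC z a) (dotRnC z (origRn R n)) dotRn_orig addr0.
rewrite (_ : - _ * _ = (4 * t * dotRn a a) * r ^+ 3 * dotRn a z); last by ring.
by rewrite r3 divff ?mul1r// gt_eqF.
Qed.

Definition quartic_int (a : Rn R n) (t th : R) : R :=
  \int[mu]_x (expR (- dotRn x x) * cos (dotRn a x + t * dotRn x x ^+ 2 + th)).

Lemma measurable_quartic a t th : measurable_fun setT
  (fun x : Rn R n => expR (- dotRn x x) * cos (dotRn a x + t * dotRn x x ^+ 2 + th)).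
Proof.
have mq : measurable_fun setT (fun x : Rn R n => dotRn x x) by exact: measurable_dotRn.
apply: measurable_funM; first by apply: measurableT_comp => //; exact: measurableT_comp.
apply: (measurableT_comp (@measurable_cosR R)).
apply: measurable_funD => //; apply: measurable_funD; first exact: measurable_dotRn.
by apply: measurable_funM => //; exact: measurable_funX.
Qed.

Lemma integrable_quartic a t th : mu.-integrable setT (EFin \o
  (fun x : Rn R n => expR (- dotRn x x) * cos (dotRn a x + t * dotRn x x ^+ 2 + th))).
Proof.
apply: integrable_dominated (measurable_quartic a t th) _ (integrable_gaussRn R n) => x.
by rewrite normrM (ger0_norm (expR_ge0 _)) ler_piMr ?expR_ge0 ?normr_cos_le1.
Qed.

(** (1 + (1/4)^2)^n is the squared Jacobian |l|^(2 n) at l = 1 + i / 4, the 2 accounts for the two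
    components th = 0 and th = pi / 2, and exp 2 comes from [rot_re_quarter]. *)
Definition decay_cst : R := Num.sqrt (2 * (1 + 4^-1 ^+ 2) ^+ n) *
  (expR 2 * \int[mu]_z expR (- dotRn z z)).

Lemma quartic_int_decay a t th : 1 <= t -> th = 0 \/ th = pi / 2 ->
  `|quartic_int a t th| <= decay_cst * Num.sqrt (Num.sqrt t) ^- n.
Proof.
move=> t1 thE; have t0 : 0 < t by exact: lt_le_trans t1.
have [x0 ax0] := quartic_critical_point a t0.
(* Translate by x0. Since x0 is critical, the terms of the phase linear in z cancel, which leaves
   [rot_im] at v = 0. *)
have E th' : quartic_int a t th' = rotJ x0 t th' 0.
  have := Rintegral_affineRn x0 (@ltr01 R) (integrable_quartic a t th').
  rewrite expr1n invr1 mul1r /quartic_int => <-; apply: eq_Rintegral => z _.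
  rewrite !dotRn_affine dotRn_affine_r !ax0; congr (expR _ * cos _).
    by rewrite /rot_re; ring.
  by rewrite /rot_im; ring.
pose D := expR 2 * (Num.sqrt (Num.sqrt t) ^- n * \int[mu]_z expR (- dotRn z z)).
have D0 : 0 <= D by apply: le_trans (rotJ_quarter_le x0 (ltW t0) 0 t1); exact: normr_ge0.
have h th' : rotJ x0 t th' 4^-1 ^+ 2 <= D ^+ 2.
  by rewrite -[leLHS]real_normK ?num_real// ler_pXn2r ?nnegrE//; exact: rotJ_quarter_le (ltW t0) _ t1.
have -> : decay_cst * Num.sqrt (Num.sqrt t) ^- n = Num.sqrt (2 * (1 + 4^-1 ^+ 2) ^+ n) * D.
  by rewrite /decay_cst /D; ring.
have K0 : 0 <= 2 * (1 + 4^-1 ^+ 2) ^+ n :> R.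
  by rewrite mulr_ge0// exprn_ge0// addr_ge0// sqr_ge0.
have D1 : 0 <= Num.sqrt (2 * (1 + 4^-1 ^+ 2) ^+ n) * D by apply: mulr_ge0 => //; exact: sqrtr_ge0.
rewrite -(@ler_pXn2r _ 2)// ?nnegrE// real_normK ?num_real//.
rewrite exprMn sqr_sqrtr//.
apply: (@le_trans _ _ (rotJ x0 t 0 0 ^+ 2 + rotJ x0 t (pi / 2) 0 ^+ 2)).
  by rewrite E; case: thE => ->; [rewrite lerDl|rewrite lerDr]; exact: sqr_ge0.
rewrite (rotJ_invariant x0 (ltW t0)) [2 * _]mulrC -mulrA.
have k0 : 0 <= (1 + 4^-1 ^+ 2) ^+ n :> R by rewrite exprn_ge0// addr_ge0// sqr_ge0.
rewrite ler_wpM2l//; have := h 0; have := h (pi / 2); lra.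
Qed.

End decay.

(** * The Gaussian slice at equal times *)

Section gauss_fourier.
Context (R : realType) (n : nat) (a : Rn R n).
Local Notation mu := (lebesgue_Rn R n).
Let m := dotRn a a.
Let p (z : Rn R n) := dotRn a z.
Let q (z : Rn R n) := dotRn z z.

Let m0 : 0 <= m. Proof. exact: dotRn_ge0. Qed.
Let q0 z : 0 <= q z. Proof. exact: dotRn_ge0. Qed.

Let pmq z : `|p z| <= m + q z.
Proof.
have pq : p z ^+ 2 <= m * q z := dotRn_CauchySchwarz a z.
have mz := q0 z; rewrite -(@ler_pXn2r _ 2)// ?nnegrE ?addr_ge0// real_normK ?num_real//.
apply: (le_trans pq); nra.
Qed.

Let mp : measurable_fun setT p.
Proof. by apply: measurable_dotRn. Qed.

Let mq : measurable_fun setT q.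
Proof. by apply: measurable_dotRn. Qed.

Definition gauss_cos (r th : R) : R :=
  \int[mu]_z (expR (- q z) * cos (r * p z + th)).

Definition gauss_moment (r th : R) : R :=
  \int[mu]_z (expR (- q z) * (p z * cos (r * p z + th))).

Let G (K : R) z := K * expR (- (2^-1 ^+ 2 * q z)).

Let iG K : mu.-integrable setT (EFin \o G K).
Proof. by apply: integrable_scalel; apply: integrable_gauss_scaled. Qed.

Let qG z : (1 + q z) * expR (- (q z / 2)) <= 4 * expR (- (2^-1 ^+ 2 * q z)).
Proof.
have e1 : 1 + q z <= 4 * expR (q z / 4).
  have := expR_ge1Dx (q z / 4); have := q0 z; lra.
apply: (@le_trans _ _ (4 * expR (q z / 4) * expR (- (q z / 2)))).
  by rewrite ler_wpM2r ?expR_ge0.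
rewrite -mulrA -expRD ler_pM2l// ler_expR; lra.
Qed.

(** Every domination in this section is of this kind: Gaussian rate 1/2 against linear growth in q,
    at the price of half the rate. *)
Let le_G (K X P : R) z : 0 <= K -> P <= m - q z / 2 -> X <= K * (1 + q z) ->
  expR P * X <= G (expR m * (K * 4)) z.
Proof.
move=> K0 Pm XK; apply: (@le_trans _ _ (expR P * (K * (1 + q z)))).
  by rewrite ler_wpM2l ?expR_ge0.
apply: (@le_trans _ _ (expR (m - q z / 2) * (K * (1 + q z)))).
  by rewrite ler_wpM2r ?ler_expR// mulr_ge0// addr_ge0.
rewrite expRD /G; have := qG z; move: (expR (- (2^-1 ^+ 2 * q z))) => E h.
rewrite -!mulrA ler_pM2l ?expR_gt0// mulrCA ler_wpM2l// [leLHS]mulrC.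
exact: h.
Qed.

Let mphase r th : measurable_fun setT (fun z => r * p z + th).
Proof. by apply: measurable_funD => //; apply: measurable_funM. Qed.

Let integrable_gauss_moment r th : mu.-integrable setT
  (EFin \o (fun z => expR (- q z) * (p z * cos (r * p z + th)))).
Proof.
apply: (@integrable_dominated _ _ _ _ _ (G (expR m * ((1 + m) * 4)))) => //.
  apply: measurable_funM; first by apply: measurableT_comp => //; exact: measurableT_comp.
  by apply: measurable_funM => //; apply: (measurableT_comp (@measurable_cosR R)).
move=> z; rewrite normrM (ger0_norm (expR_ge0 _)); have := q0 z; have := m0 => m_ge0 qz.
apply: le_G; [by rewrite addr_ge0|lra|].
rewrite normrM (@le_trans _ _ `|p z|)// ?ler_piMr ?normr_cos_le1//.
apply: le_trans (pmq z) _; nra.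
Qed.

Lemma is_derive_gauss_cos (r th : R) :
  is_derive r 1 (gauss_cos^~ th) (gauss_moment r (th + pi / 2)).
Proof.
have Ir : (`]r - 1, r + 1[%classic : set R) r by rewrite /= in_itv/=; apply/andP; split; lra.
have mP (s : R) : measurable_fun setT (fun z => - q z) by exact: measurableT_comp.
have dP (s : R) z : `]r - 1, r + 1[%classic s -> is_derive s 1 (fun _ : R => - q z) 0.
  by move=> _; exact: is_derive_cst.
have dQ (s : R) z : `]r - 1, r + 1[%classic s -> is_derive s 1 (fun s : R => s * p z + th) (p z).
  by move=> _; apply: is_derive_eq; rewrite /GRing.scale /=; ring.
have K0 : 0 <= 1 + m by have := m0; lra.
have PG (s : R) z : `]r - 1, r + 1[%classic s -> expR (- q z) <= G (expR m * ((1 + m) * 4)) z.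
  move=> _; have := q0 z; have := m0 => m_ge0 q_ge0.
  rewrite -[leLHS]mulr1; apply: le_G => //; first lra.
  nra.
have PG' (s : R) z : `]r - 1, r + 1[%classic s ->
    expR (- q z) * (`|0 : R| + `|p z|) <= G (expR m * ((1 + m) * 4)) z.
  move=> _; have := q0 z; have := m0 => m_ge0 q_ge0.
  rewrite normr0 add0r; apply: le_G => //; first lra.
  by apply: le_trans (pmq z) _; nra.
have := is_derive_Rintegral_expR_cos mP (fun r => mphase r th) dP dQ PG PG' (iG _) Ir.
move=> h; apply: is_derive_eq; apply: eq_Rintegral => z _.
by rewrite addrA cosDpihalf; ring.
Qed.

Let integrable_gauss_cos r th : mu.-integrable setT
  (EFin \o (fun z => expR (- q z) * cos (r * p z + th))).
Proof.
apply: integrable_dominated (integrable_gaussRn R n) => //.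
  apply: measurable_funM; first by apply: measurableT_comp => //; exact: measurableT_comp.
  exact: (measurableT_comp (@measurable_cosR R)).
by move=> z; rewrite normrM (ger0_norm (expR_ge0 _)) ler_piMr ?expR_ge0 ?normr_cos_le1.
Qed.

(* Translation invariance: the derivative at s = 0 of the integral of
   exp(-|z + s a|^2) cos(r a.(z + s a) + th + pi/2) vanishes. *)
Lemma gauss_cos_moment (r th : R) :
  r * m * gauss_cos r th = - 2 * gauss_moment r (th + pi / 2).
Proof.
have I0 : (`]-1, 1[%classic : set R) 0 by rewrite /= in_itv/=; apply/andP; split; lra.
have mP (s : R) : measurable_fun setT (fun z => - (q z + 2 * s * p z + s ^+ 2 * m)).
  apply: measurableT_comp => //; apply: measurable_funD => //.
  by apply: measurable_funD => //; exact: measurable_funM.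
have mQ (s : R) : measurable_fun setT (fun z => r * (p z + s * m) + (th + pi / 2)).
  apply: measurable_funD => //; apply: measurable_funM => //; exact: measurable_funD.
have dP (s : R) z : `]-1, 1[%classic s ->
    is_derive s 1 (fun s : R => - (q z + 2 * s * p z + s ^+ 2 * m)) (- (2 * p z + 2 * s * m)).
  by move=> _; apply: is_derive_eq; rewrite /GRing.scale /=; ring.
have dQ (s : R) z : `]-1, 1[%classic s ->
    is_derive s 1 (fun s : R => r * (p z + s * m) + (th + pi / 2)) (r * m).
  by move=> _; apply: is_derive_eq; rewrite /GRing.scale /=; ring.
have K0 : 0 <= (`|r| + 4) * (1 + m) by rewrite mulr_ge0// addr_ge0//.
have Ple (s : R) z : `]-1, 1[%classic s -> - (q z + 2 * s * p z + s ^+ 2 * m) <= m - q z / 2.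
  rewrite /= in_itv/= => /andP[s1 s2].
  (* Half of |z + 2 s a|^2 >= 0 bounds the cross term: 2 s p >= - q / 2 - 2 s^2 m. *)
  have := dotRn_ge0 (affineRn (2 * s) z a).
  rewrite dotRn_affine (dotRnC z) -/(p z) -/(q z) -/m.
  have : s ^+ 2 * m <= m by rewrite ler_piMl//; nra.
  lra.
have PG (s : R) z : `]-1, 1[%classic s -> expR (- (q z + 2 * s * p z + s ^+ 2 * m)) <=
    G (expR m * (((`|r| + 4) * (1 + m)) * 4)) z.
  move=> /Ple sz; rewrite -[leLHS]mulr1; apply: le_G => //.
  have := q0 z; have := m0; have := normr_ge0 r; move: (q z) (`|r|) => u v v0 m1 u0.
  have h1 : 1 <= (1 + m) * (1 + u) by nra.
  have v4 : 1 <= v + 4 by lra.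
  rewrite -mulrA; move: ((1 + m) * (1 + u)) h1 => w h1.
  by rewrite -[leLHS]mulr1 ler_pM.
have PG' (s : R) z : `]-1, 1[%classic s -> expR (- (q z + 2 * s * p z + s ^+ 2 * m)) *
    (`|- (2 * p z + 2 * s * m)| + `|r * m|) <= G (expR m * (((`|r| + 4) * (1 + m)) * 4)) z.
  move=> Is; have sz := Ple _ z Is; apply: le_G => //.
  move: Is; rewrite /= in_itv/= => /andP[s1 s2].
  have := pmq z; have := q0 z; have := m0; have := normr_ge0 r.
  rewrite normrN normrM (ger0_norm m0).
  have h : `|2 * p z + 2 * s * m| <= 2 * `|p z| + 2 * m.
    rewrite (le_trans (ler_normD _ _))// !normrM (ger0_norm m0) !normr_nat lerD2l.
    rewrite ler_wpM2r// ler_piMr// ler_norml; apply/andP; split; lra.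
  move: (q z) (`|r|) (`|p z|) h => u v w h v0 m1 u0 wu.
  have := mulr_ge0 v0 u0; have := mulr_ge0 (mulr_ge0 v0 m1) u0; have := mulr_ge0 m1 u0.
  lra.
have dF := is_derive_Rintegral_expR_cos mP mQ dP dQ PG PG' (iG _) I0.
have cF : is_derive (0 : R) 1 (fun s : R => \int[mu]_z (expR (- (q z + 2 * s * p z + s ^+ 2 * m))
    * cos (r * (p z + s * m) + (th + pi / 2)))) 0.
  rewrite (_ : (fun s => _) = cst (gauss_cos r (th + pi / 2))); first exact: is_derive_cst.
  apply/funext => s; rewrite /=.
  have := Rintegral_affineRn (affineRn s (origRn R n) a) (@ltr01 R) (integrable_gauss_cos r (th + pi / 2)).
  rewrite expr1n invr1 mul1r /gauss_cos => <-; apply: eq_Rintegral => z _.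
  rewrite /p /q dotRn_affine dotRn_scale (dotRnC (affineRn s _ _)) !dotRn_affine_r.
  rewrite !(dotRnC _ (origRn R n)) !dotRn_orig (dotRnC z a) -/m.
  by congr (expR _ * cos _); ring.
have := @derive_val _ _ _ _ _ _ _ cF; rewrite (@derive_val _ _ _ _ _ _ _ dF).
rewrite /gauss_cos /gauss_moment => e.
rewrite -!RintegralZl//.
rewrite -[RHS]subr0 -[in RHS]e -RintegralB//.
- apply: eq_Rintegral => z _; rewrite !addrA !cosDpihalf !sinDpihalf.
  rewrite !(mulr0, mul0r, addr0, expr0n)/=; ring.
- by apply: integrable_scalel; exact: integrable_gauss_moment.
apply: (@eq_integrable _ _ _ mu setT measurableT
    (EFin \o (fun z => -2 * (expR (- q z) * (p z * cos (r * p z + (th + pi / 2))))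
     - r * m * (expR (- q z) * cos (r * p z + th))))).
  move=> z _ /=; rewrite !addrA !cosDpihalf !sinDpihalf.
  by rewrite !(mulr0, mul0r, addr0, expr0n)/=; congr EFin; ring.
by apply: integrable_sub; apply: integrable_scalel.
Qed.

(** Write F(r) for [gauss_cos r th]. The two preceding lemmas combine to F' = - (r m / 2) F, so exp
    (r^2 m / 4) F(r) is constant; compare r = 1 with r = 0. *)
Lemma gauss_cosE th : gauss_cos 1 th = expR (- (m / 4)) * cos th * \int[mu]_z expR (- q z).
Proof.
have d (r : R) : is_derive r 1 ((expR \o (fun r => r ^+ 2 * (m / 4))) * gauss_cos^~ th) 0.
  have dr := is_derive_gauss_cos r th.
  have de : is_derive r 1 (fun r : R => r ^+ 2 * (m / 4)) (r * (m / 2)).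
    by apply: is_derive_eq; rewrite /GRing.scale /=; field.
  have h := is_deriveM (is_derive1_comp (is_derive_expR _) de) dr.
  apply: (@is_derive_eq _ _ _ _ _ _ _ _ h); rewrite /GRing.scale /=.
  have := gauss_cos_moment r th.
  move: (gauss_cos r th) (gauss_moment _ _) => x y e.
  rewrite (_ : y = - (r * m * x) / 2); last by rewrite e; field.
  by field.
have := is_derive_0_is_cst 1 0 d.
rewrite (_ : (_ * _) 1 = expR (1 ^+ 2 * (m / 4)) * gauss_cos 1 th)//.
rewrite (_ : (_ * _) 0 = expR (0 ^+ 2 * (m / 4)) * gauss_cos 0 th)//.
rewrite expr1n mul1r expr0n mul0r expR0 mul1r => e.
have em : expR (m / 4) != 0 by rewrite gt_eqF ?expR_gt0.
apply: (mulfI em); rewrite e expRN !mulrA divff// mul1r.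
rewrite /gauss_cos -RintegralZl//; last exact: integrable_gaussRn.
by apply: eq_Rintegral => z _; rewrite mul0r add0r mulrC.
Qed.

Lemma gauss_cos_le th :
  `|gauss_cos 1 th| <= expR (- (m / 4)) * \int[mu]_z expR (- q z).
Proof.
have I0 : 0 <= \int[mu]_z expR (- q z).
  by apply: Rintegral_ge0 => z _; exact: expR_ge0.
rewrite gauss_cosE !normrM (ger0_norm (expR_ge0 _)) (ger0_norm I0).
by apply: ler_wpM2r => //; rewrite ler_piMr ?expR_ge0 ?normr_cos_le1.
Qed.

End gauss_fourier.

(** * The weak-type estimate *)

Section parametrized_integral.
Context d1 d2 (T1 : measurableType d1) (T2 : measurableType d2) (R : realType).
Variable m2 : {sigma_finite_measure set T2 -> \bar R}.

(** Integrability of the sections is not assumed: the integral is [fine] of a difference of two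
    Tonelli integrals. *)
Lemma measurable_Rintegral_param (f : T1 * T2 -> R) : measurable_fun setT f ->
  measurable_fun setT (fun x => \int[m2]_y f (x, y)).
Proof.
move=> mf; have mEf : measurable_fun setT (EFin \o f) by exact/measurable_EFinP.
rewrite /Rintegral.
apply: (@measurableT_comp _ _ _ _ _ _ fine) => //.
rewrite (_ : (fun x => _) = (fun x => (\int[m2]_y ((EFin \o f)^\+ (x, y)) -
  \int[m2]_y ((EFin \o f)^\- (x, y)))%E)).
  apply: emeasurable_funB.
    by apply: measurable_fun_fubini_tonelli_F => //; exact: measurable_funepos.
  by apply: measurable_fun_fubini_tonelli_F => //; exact: measurable_funeneg.
apply/funext => x; rewrite integralE; congr (_ - _)%E.
  by apply: eq_integral => y _; rewrite -[RHS]/((_ \o (fun y => (x, y))) y) -funepos_comp.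
by apply: eq_integral => y _; rewrite -[RHS]/((_ \o (fun y => (x, y))) y) -funeneg_comp.
Qed.

Lemma Rintegral_mulmul (m1 : {sigma_finite_measure set T1 -> \bar R}) (f : T1 -> R) (g : T2 -> R) :
  m1.-integrable setT (EFin \o f) -> m2.-integrable setT (EFin \o g) ->
  (\int[m1]_x f x) * (\int[m2]_y g y) = \int[(m1 \x m2)%E]_z (f z.1 * g z.2).
Proof.
move=> intf intg.
have mf : measurable_fun setT f by exact/measurable_EFinP/(measurable_int _ intf).
have mg : measurable_fun setT g by exact/measurable_EFinP/(measurable_int _ intg).
rewrite (@Rintegral_product12 _ _ _ _ _ m1 m2 (fun z => f z.1 * g z.2) (fun x => `|f x|) (fun y => `|g y|)) //.
- rewrite -RintegralZr//; apply: eq_Rintegral => x _ /=.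
  by rewrite RintegralZl.
- by apply: measurable_funM; exact: measurableT_comp.
- by move=> x y /=; rewrite normrM.
- exact: integrable_norm.
- exact: integrable_norm.
Qed.

Lemma integrable_mulmul (m1 : {sigma_finite_measure set T1 -> \bar R}) (f : T1 -> R) (g : T2 -> R) :
  m1.-integrable setT (EFin \o f) -> m2.-integrable setT (EFin \o g) ->
  (m1 \x m2)%E.-integrable setT (EFin \o (fun z => f z.1 * g z.2)).
Proof.
move=> intf intg.
have mf : measurable_fun setT f by exact/measurable_EFinP/(measurable_int _ intf).
have mg : measurable_fun setT g by exact/measurable_EFinP/(measurable_int _ intg).
apply: (@integrable_product _ _ _ _ _ m1 m2 (fun z => f z.1 * g z.2) (fun x => `|f x|) (fun y => `|g y|)) => //.
- by apply: measurable_funM; exact: measurableT_comp.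
- by move=> x y /=; rewrite normrM.
- exact: integrable_norm.
- exact: integrable_norm.
Qed.

End parametrized_integral.

Section near_far.
Context dY dZ (Y : measurableType dY) (Z : measurableType dZ) (R : realType).
Variables (mY : {sigma_finite_measure set Y -> \bar R})
  (mZ : {sigma_finite_measure set Z -> \bar R}).
Local Notation leb := (@lebesgue_measure R).
Local Notation timeR := (measurableTypeR R).
Variables (phi : Y * timeR * Z -> R) (w : Z -> R).
Hypothesis mphi : measurable_fun setT phi.
Hypothesis w0 : forall z, 0 <= w z.
Hypothesis iw : mZ.-integrable setT (EFin \o w).

Let mw : measurable_fun setT w.
Proof. exact/measurable_EFinP/(measurable_int _ iw). Qed.

(** The real part of K(x - x'). The imaginary part is antisymmetric in x and x', so it drops out of
    the quadratic form of a real indicator. *)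
Definition kern (x x' : Y * timeR) : R :=
  \int[mZ]_z (w z * cos (phi (x, z) - phi (x', z))).

Let W := \int[mZ]_z w z.

Lemma kern_le x x' : `|kern x x'| <= W.
Proof.
apply: normr_Rintegral_le iw => //.
  apply: measurable_funM => //; apply: (measurableT_comp (@measurable_cosR R)).
  by apply: measurable_funB; apply: (measurableT_comp mphi).
by move=> z; rewrite normrM (ger0_norm (w0 z)) ler_piMr ?normr_cos_le1.
Qed.

(** The majorant [al y * \1_I t] of the indicator is qualitative: it gives A finite measure and
    justifies the exchanges of integrals, but enters no final constant. *)
Variables (A : set (Y * timeR)) (al : Y -> R) (I : set timeR).
Hypothesis mA : measurable A.
Hypothesis mI : measurable I.
Hypothesis Ioo : (leb I < +oo)%E.
Hypothesis al0 : forall y, 0 <= al y.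
Hypothesis ial : mY.-integrable setT (EFin \o al).
Hypothesis Aal : forall y t, \1_A (y, t) <= al y * \1_I t :> R.

Let indA : Y * timeR -> R := \1_A.
Let indI : timeR -> R := \1_I.

Let indA0 x : 0 <= indA x. Proof. by rewrite /indA indicE. Qed.
Let indI0 t : 0 <= indI t. Proof. by rewrite /indI indicE. Qed.
Let indI1 t : indI t <= 1. Proof. by rewrite /indI indicE; case: (_ \in _). Qed.
Let mindA : measurable_fun setT indA. Proof. exact: measurable_indic. Qed.
Let iI : leb.-integrable setT (EFin \o indI).
Proof. exact: integrable_indic_lty. Qed.

Let alI := \int[mY]_y al y.
Let alI0 : 0 <= alI. Proof. exact: Rintegral_ge0. Qed.

Section slab.
Variable tr : R -> R.
Hypothesis mtr : measurable_fun setT tr.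
Hypothesis tr1 : forall x, `|tr x| <= 1.

(** With [tr] equal to cos or sin, a component of the Fourier transform of the slice of A at time t,
    read at the frequency z. *)
Definition slab_int (t : timeR) (z : Z) : R :=
  \int[mY]_y (indA (y, t) * tr (phi (y, t, z))).

Lemma measurable_slab_integrand : measurable_fun setT
  (fun u : timeR * Z * Y => indA (u.2, u.1.1) * tr (phi (u.2, u.1.1, u.1.2))).
Proof.
apply: measurable_funM.
  apply: (measurableT_comp mindA); apply: measurable_fun_pair => //.
  exact: measurableT_comp.
apply: (measurableT_comp mtr); apply: (measurableT_comp mphi).
apply: measurable_fun_pair; last exact: measurableT_comp.
by apply: measurable_fun_pair => //; exact: measurableT_comp.
Qed.

Lemma measurable_slab_int : measurable_fun setT (fun u : timeR * Z => slab_int u.1 u.2).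
Proof.
by have := measurable_Rintegral_param mY measurable_slab_integrand.
Qed.

Lemma integrable_slab t z : mY.-integrable setT
  (EFin \o (fun y => indA (y, t) * tr (phi (y, t, z)))).
Proof.
apply: (@integrable_dominated _ _ _ _ _ (fun y => al y * indI t)).
- exact: (measurableT_comp measurable_slab_integrand (pair1_measurable (t, z))).
- move=> y; rewrite normrM (ger0_norm (indA0 _)); apply: le_trans (Aal y t).
  by rewrite ler_piMr.
- exact: integrable_scaler.
Qed.

Lemma slab_int_le t z : `|slab_int t z| <= alI * indI t.
Proof.
rewrite -RintegralZr//; apply: normr_Rintegral_le.
- exact: (measurableT_comp measurable_slab_integrand (pair1_measurable (t, z))).
- move=> y; rewrite normrM (ger0_norm (indA0 _)); apply: le_trans (Aal y t).
  by rewrite ler_piMr.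
- exact: integrable_scaler.
Qed.

Lemma integrable_slab_int z : leb.-integrable setT (EFin \o (slab_int ^~ z)).
Proof.
apply: (@integrable_dominated _ _ _ _ _ (fun t => alI * indI t)).
- exact: (measurableT_comp measurable_slab_int (pair2_measurable z)).
- by move=> t; exact: slab_int_le.
- exact: integrable_scalel.
Qed.

Definition set_int (z : Z) : R := \int[(mY \x leb)%E]_x (indA x * tr (phi (x, z))).

Lemma set_intE z : set_int z = \int[leb]_t slab_int t z.
Proof.
rewrite /set_int (@Rintegral_product21 _ _ _ _ _ mY leb _ al indI)//.
  apply: measurable_funM => //; apply: (measurableT_comp mtr).
  exact: (measurableT_comp mphi).
move=> y t; rewrite normrM (ger0_norm (indA0 _)); apply: le_trans (Aal y t).
by rewrite ler_piMr.
Qed.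

End slab.

Let mcos := @measurable_cosR R.
Let msin := @measurable_sinR R.
Let cos1 := @normr_cos_le1 R.
Let sin1 := @normr_sin_le1 R.

Let ac := slab_int cos.
Let as_ := slab_int sin.
Let L (t : timeR) : R := \int[mY]_y indA (y, t).
Let mYY := prod_measure mY mY.

Let alal : mYY.-integrable setT (EFin \o (fun p => al p.1 * al p.2)).
Proof. exact: integrable_mulmul. Qed.

Let indA_al y t : indA (y, t) <= al y.
Proof. by apply: le_trans (Aal y t) _; rewrite ler_piMr. Qed.

(** The inner product, with weight w, of the Fourier transforms of two slices. It is positive
    semidefinite in this form; [slab_formE] rewrites it through the kernel. *)
Definition slab_form (t s : timeR) : R :=
  \int[mZ]_z (w z * (ac t z * ac s z + as_ t z * as_ s z)).

Let pairf t s z (p : Y * Y) : R :=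
  indA (p.1, t) * indA (p.2, s) * cos (phi (p.1, t, z) - phi (p.2, s, z)).

Let mpair_ind t s : measurable_fun setT (fun p : Y * Y => indA (p.1, t) * indA (p.2, s)).
Proof.
by apply: measurable_funM; apply: (measurableT_comp mindA); exact: measurable_fun_pair.
Qed.

Let mpairf t s : measurable_fun setT (fun u : Z * (Y * Y) => pairf t s u.1 u.2).
Proof.
apply: measurable_funM.
  exact: (measurableT_comp (mpair_ind t s) measurable_snd).
apply: (measurableT_comp mcos); apply: measurable_funB; apply: (measurableT_comp mphi).
  apply: measurable_fun_pair => //; apply: measurable_fun_pair => //.
  exact: measurableT_comp.
apply: measurable_fun_pair => //; apply: measurable_fun_pair => //.
exact: measurableT_comp.
Qed.

Let pairf_le t s z p : `|pairf t s z p| <= al p.1 * al p.2.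
Proof.
rewrite !normrM !(ger0_norm (indA0 _)) -[leRHS]mulr1.
by rewrite ler_pM ?mulr_ge0// ler_pM.
Qed.

Let slab_pair t s z : ac t z * ac s z + as_ t z * as_ s z = \int[mYY]_p pairf t s z p.
Proof.
have ic t' := integrable_slab mcos cos1 t' z.
have is_ t' := integrable_slab msin sin1 t' z.
have bnd (tr : R -> R) : measurable_fun setT tr -> (forall x, `|tr x| <= 1) ->
    mYY.-integrable setT (EFin \o (fun p : Y * Y =>
      (indA (p.1, t) * tr (phi (p.1, t, z))) * (indA (p.2, s) * tr (phi (p.2, s, z))))).
  move=> mtr tr1; apply: integrable_dominated alal => //.
    apply: measurable_funM; apply: measurable_funM.
    - by apply: (measurableT_comp mindA); exact: measurable_fun_pair.
    - apply: (measurableT_comp mtr); apply: (measurableT_comp mphi).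
      by apply: measurable_fun_pair => //; exact: measurable_fun_pair.
    - by apply: (measurableT_comp mindA); exact: measurable_fun_pair.
    - apply: (measurableT_comp mtr); apply: (measurableT_comp mphi).
      by apply: measurable_fun_pair => //; exact: measurable_fun_pair.
  move=> p; rewrite !normrM !(ger0_norm (indA0 _)).
  have hb y t' x : indA (y, t') * `|tr x| <= al y.
    by apply: le_trans (indA_al y t'); rewrite ler_piMr.
  by rewrite ler_pM ?mulr_ge0.
rewrite (Rintegral_mulmul (ic t) (ic s)) (Rintegral_mulmul (is_ t) (is_ s)).
rewrite -(@RintegralD _ _ _ mYY)//; [|exact: bnd|exact: bnd].
apply: eq_Rintegral => p _; rewrite /pairf cosB; ring.
Qed.

Lemma slab_formE t s : slab_form t s =
  \int[mYY]_p (indA (p.1, t) * indA (p.2, s) * kern (p.1, t) (p.2, s)).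
Proof.
have mYY_ok z : mYY.-integrable setT (EFin \o pairf t s z).
  apply: integrable_dominated alal => //.
  exact: (measurableT_comp (mpairf t s) (pair1_measurable z)).
transitivity (\int[mZ]_z \int[mYY]_p (w z * pairf t s z p)).
  by apply: eq_Rintegral => z _; rewrite slab_pair RintegralZl.
rewrite (@RFubini _ _ _ _ _ mZ mYY (fun u => w u.1 * pairf t s u.1 u.2) w
  (fun p => al p.1 * al p.2))//=.
- apply: eq_Rintegral => p _; rewrite -RintegralZl//.
    by apply: eq_Rintegral => z _; rewrite /pairf; ring.
  apply: integrable_dominated iw => //.
    apply: measurable_funM => //; apply: (measurableT_comp mcos).
    by apply: measurable_funB; apply: (measurableT_comp mphi).
  by move=> z; rewrite normrM (ger0_norm (w0 z)) ler_piMr.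
- apply: measurable_funM => //; exact: measurableT_comp.
- by move=> z p; rewrite normrM (ger0_norm (w0 z)) ler_wpM2l.
Qed.

Let L0 t : 0 <= L t. Proof. exact: Rintegral_ge0. Qed.

Let iindA t : mY.-integrable setT (EFin \o (fun y => indA (y, t))).
Proof.
apply: integrable_dominated ial.
  exact: (measurableT_comp mindA (pair2_measurable t)).
by move=> y; rewrite ger0_norm.
Qed.

Let LI t : L t <= alI * indI t.
Proof.
by rewrite /alI -RintegralZr//; apply: le_Rintegral => //; exact: integrable_scaler.
Qed.

Let mL : measurable_fun setT L.
Proof.
exact: (measurable_Rintegral_param mY (f := fun u => indA (u.2, u.1))
  (measurableT_comp mindA (measurable_fun_pair measurable_snd measurable_fst))).
Qed.

Let iL : leb.-integrable setT (EFin \o L).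
Proof.
apply: (@integrable_dominated _ _ _ _ _ (fun t => alI * indI t)) => //.
  by move=> t; rewrite ger0_norm.
exact: integrable_scalel.
Qed.

Let mass := \int[leb]_t L t.

Lemma slab_form_far D t s : 0 <= D ->
  (forall y y', `|kern (y, t) (y', s)| <= D) -> slab_form t s <= D * (L t * L s).
Proof.
move=> D0 kD; rewrite slab_formE.
have ip : mYY.-integrable setT (EFin \o (fun p : Y * Y => indA (p.1, t) * indA (p.2, s))).
  apply: integrable_dominated alal => // p.
  by rewrite normrM !(ger0_norm (indA0 _)) ler_pM.
rewrite (Rintegral_mulmul (iindA t) (iindA s)) -RintegralZl//.
apply: (le_trans (ler_norm _)); apply: normr_Rintegral_le.
- apply: measurable_funM => //.
  apply: (measurable_Rintegral_param mZ (f := fun u => w u.2 * cos (phi (u.1.1, t, u.2) - phi (u.1.2, s, u.2)))).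
  apply: measurable_funM; first exact: measurableT_comp.
  apply: (measurableT_comp mcos); apply: measurable_funB; apply: (measurableT_comp mphi).
    by apply: measurable_fun_pair => //; apply: measurable_fun_pair => //; exact: measurableT_comp.
  by apply: measurable_fun_pair => //; apply: measurable_fun_pair => //; exact: measurableT_comp.
- move=> p; rewrite !normrM !(ger0_norm (indA0 _)) mulrC ler_wpM2r// mulr_ge0//.
- exact: integrable_scalel.
Qed.

(** Schur's test at a single time: one indicator is bounded by 1 and the kernel integrated out. The
    result is linear in [L t], whereas a sup bound on the kernel would be quadratic. *)
Lemma slab_form_diag kappa t (k : Y -> Y -> R) :
  (forall y y', `|kern (y, t) (y', t)| <= k y y') ->
  (forall y, mY.-integrable setT (EFin \o k y)) ->
  (forall y, \int[mY]_y' k y y' <= kappa) ->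
  slab_form t t <= kappa * L t.
Proof.
move=> kk ik kK; rewrite slab_formE.
have mK : measurable_fun setT (fun p : Y * Y => kern (p.1, t) (p.2, t)).
  apply: (measurable_Rintegral_param mZ (f := fun u => w u.2 * cos (phi (u.1.1, t, u.2) - phi (u.1.2, t, u.2)))).
  apply: measurable_funM; first exact: measurableT_comp.
  apply: (measurableT_comp mcos); apply: measurable_funB; apply: (measurableT_comp mphi).
    by apply: measurable_fun_pair => //; apply: measurable_fun_pair => //; exact: measurableT_comp.
  by apply: measurable_fun_pair => //; apply: measurable_fun_pair => //; exact: measurableT_comp.
have mF : measurable_fun setT (fun p : Y * Y => indA (p.1, t) * indA (p.2, t) * kern (p.1, t) (p.2, t)).
  exact: measurable_funM.
have Fle y y' : `|indA (y, t) * indA (y', t) * kern (y, t) (y', t)| <= W * al y * al y'.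
  rewrite !normrM !(ger0_norm (indA0 _)) mulrC -mulrA ler_pM ?mulr_ge0//; first exact: kern_le.
  by rewrite ler_pM.
have W0 : 0 <= W by exact: Rintegral_ge0.
rewrite (@Rintegral_product12 _ _ _ _ _ mY mY _ (fun y => W * al y) al mF Fle)//;
  last exact: integrable_scalel.
rewrite /L -RintegralZl//; apply: le_Rintegral => //.
- have := @integrable_RintegralF _ _ _ _ _ mY mY _ (fun y => W * al y) al mF Fle.
  by apply => // *; rewrite ?mulr_ge0//; exact: integrable_scalel.
- exact: integrable_scalel.
move=> y _; apply: (@le_trans _ _ (indA (y, t) * \int[mY]_y' k y y')); last first.
  by rewrite mulrC ler_wpM2r.
rewrite -RintegralZl//; apply: le_trans (ler_norm _) _; apply: normr_Rintegral_le.
- exact: (measurableT_comp mF (pair1_measurable y)).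
- move=> y'; rewrite !normrM !(ger0_norm (indA0 _)) -mulrA ler_wpM2l//.
  rewrite -[leRHS]mul1r ler_pM// /indA indicE; by case: (_ \in _).
- exact: integrable_scalel.
Qed.

(** Positivity of w together with 2 a b <= a^2 + b^2. Pairs of nearby times reduce to equal times,
    so no kernel bound is required for 0 < |t - s| <= T. *)
Lemma slab_form_mean t s : slab_form t s <= (slab_form t t + slab_form s s) / 2.
Proof.
have iz t' s' : mZ.-integrable setT (EFin \o (fun z => w z * (ac t' z * ac s' z + as_ t' z * as_ s' z))).
  have mslab (tr : R -> R) (mtr : measurable_fun setT tr) t'' :
      measurable_fun setT (fun z => slab_int tr t'' z).
    exact: (measurableT_comp (measurable_slab_int mtr) (pair1_measurable t'')).
  have ab z : `|ac t' z * ac s' z + as_ t' z * as_ s' z| <= 2 * (alI * alI).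
    have ub (tr : R -> R) (mtr : measurable_fun setT tr) (tr1 : forall x, `|tr x| <= 1) t'' :
      `|slab_int tr t'' z| <= alI.
      by apply: le_trans (slab_int_le mtr tr1 t'' z) _; rewrite ler_piMr.
    rewrite (le_trans (ler_normD _ _))// !normrM mulr_natl mulr2n.
    by apply: lerD; apply: ler_pM => //; exact: ub.
  apply: (@integrable_dominated _ _ _ _ _ (fun z => w z * (2 * (alI * alI)))).
  - by apply: measurable_funM => //; apply: measurable_funD; apply: measurable_funM; exact: mslab.
  - by move=> z; rewrite normrM (ger0_norm (w0 z)) ler_wpM2l.
  - exact: integrable_scaler.
rewrite /slab_form -RintegralD// mulrC -RintegralZl//; last exact: integrable_add.
apply: le_Rintegral => //.
  by apply: integrable_scalel; exact: integrable_add.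
move=> z _; rewrite -mulrDr mulrCA ler_wpM2l//.
have := sqr_ge0 (ac t z - ac s z); have := sqr_ge0 (as_ t z - as_ s z); lra.
Qed.

Let slab_form0 t s : ~~ ((t \in I) && (s \in I)) -> slab_form t s = 0.
Proof.
have z0 (tr : R -> R) (mtr : measurable_fun setT tr) (tr1 : forall x, `|tr x| <= 1) t' z :
    t' \notin I -> slab_int tr t' z = 0.
  move=> t'I; apply/eqP; rewrite -normr_le0; apply: le_trans (slab_int_le mtr tr1 t' z) _.
  by rewrite /indI indicE (negbTE t'I) mulr0.
move=> ts; rewrite /slab_form (@eq_Rintegral _ _ _ mZ setT (fun=> 0)) ?Rintegral_cst ?mul0r// => z _.
move: ts; rewrite negb_and => /orP[h|h].
  by rewrite /ac /as_ (z0 _ mcos cos1 _ _ h) (z0 _ msin sin1 _ _ h) !mul0r addr0 mulr0.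
by rewrite /ac /as_ (z0 _ mcos cos1 _ _ h) (z0 _ msin sin1 _ _ h) !mulr0 addr0 mulr0.
Qed.

Let leb2 := prod_measure leb leb.

Let iII : leb2.-integrable setT (EFin \o (fun u => indI u.1 * indI u.2)).
Proof. exact: integrable_mulmul. Qed.

Lemma Rintegral_set_int_sqr :
  \int[mZ]_z (w z * (set_int cos z ^+ 2 + set_int sin z ^+ 2)) =
  \int[leb2]_u slab_form u.1 u.2 /\
  leb2.-integrable setT (EFin \o (fun u => slab_form u.1 u.2)).
Proof.
have iab z : leb2.-integrable setT (EFin \o (fun u => slab_int cos u.1 z * slab_int cos u.2 z)) /\
   leb2.-integrable setT (EFin \o (fun u => slab_int sin u.1 z * slab_int sin u.2 z)).
  have h (tr : R -> R) (mtr : measurable_fun setT tr) (tr1 : forall x, `|tr x| <= 1) :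
    leb2.-integrable setT (EFin \o (fun u => slab_int tr u.1 z * slab_int tr u.2 z)).
    have ms : measurable_fun setT (fun t => slab_int tr t z).
      exact: (measurableT_comp (measurable_slab_int mtr) (pair2_measurable z)).
    apply: (@integrable_dominated _ _ _ _ _ (fun u => alI ^+ 2 * (indI u.1 * indI u.2))).
    - by apply: measurable_funM; exact: (measurableT_comp ms).
    - move=> u; rewrite normrM expr2 mulrACA.
      by apply: ler_pM => //; exact: slab_int_le.
    - exact: integrable_scalel.
  by split; apply: h.
set f := fun u : Z * (timeR * timeR) =>
  w u.1 * (ac u.2.1 u.1 * ac u.2.2 u.1 + as_ u.2.1 u.1 * as_ u.2.2 u.1).
have mf : measurable_fun setT f.
  apply: measurable_funM; first exact: measurableT_comp.
  have ms1 (tr : R -> R) (mtr : measurable_fun setT tr) :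
      measurable_fun setT (fun u : Z * (timeR * timeR) => slab_int tr u.2.1 u.1).
    have mp : measurable_fun setT (fun u : Z * (timeR * timeR) => (u.2.1, u.1)).
      by apply: measurable_fun_pair => //; exact: measurableT_comp.
    exact: (measurableT_comp (measurable_slab_int mtr) mp).
  have ms2 (tr : R -> R) (mtr : measurable_fun setT tr) :
      measurable_fun setT (fun u : Z * (timeR * timeR) => slab_int tr u.2.2 u.1).
    have mp : measurable_fun setT (fun u : Z * (timeR * timeR) => (u.2.2, u.1)).
      by apply: measurable_fun_pair => //; exact: measurableT_comp.
    exact: (measurableT_comp (measurable_slab_int mtr) mp).
  by apply: measurable_funD; apply: measurable_funM; [exact: ms1|exact: ms2|exact: ms1|exact: ms2].
have f_le z u : `|f (z, u)| <= w z * (2 * alI ^+ 2 * (indI u.1 * indI u.2)).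
  rewrite /f /= normrM (ger0_norm (w0 z)) ler_wpM2l// (le_trans (ler_normD _ _))//.
  have b (tr : R -> R) (mtr : measurable_fun setT tr) (tr1 : forall x, `|tr x| <= 1) :
     `|slab_int tr u.1 z * slab_int tr u.2 z| <= alI ^+ 2 * (indI u.1 * indI u.2).
    by rewrite normrM expr2 mulrACA; apply: ler_pM => //; exact: slab_int_le.
  rewrite -mulrA mulr_natl mulr2n.
  by apply: lerD; exact: b.
have dom : leb2.-integrable setT (EFin \o (fun u => 2 * alI ^+ 2 * (indI u.1 * indI u.2))).
  exact: integrable_scalel.
have d0 (u : timeR * timeR) : 0 <= 2 * alI ^+ 2 * (indI u.1 * indI u.2).
  by apply: mulr_ge0; apply: mulr_ge0 => //; exact: sqr_ge0.
split; last exact: (integrable_RintegralG mf f_le iw dom).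
rewrite -(RFubini mf f_le iw dom); apply: eq_Rintegral => z _.
have [ic is_] := iab z.
rewrite /f /= RintegralZl//; last exact: integrable_add.
congr (w z * _).
rewrite !set_intE// !expr2.
rewrite (Rintegral_mulmul (integrable_slab_int mcos cos1 z) (integrable_slab_int mcos cos1 z)).
rewrite (Rintegral_mulmul (integrable_slab_int msin sin1 z) (integrable_slab_int msin sin1 z)).
by rewrite -(@RintegralD _ _ _ leb2).
Qed.

Let near (T : R) (u : timeR * timeR) : R := \1_[set u : timeR * timeR | `|u.1 - u.2| <= T] u.

Let mnear T : measurable_fun setT (near T).
Proof.
apply: measurable_indic; rewrite -[X in measurable X]setTI.
apply: measurable_fun_le => //.
by apply: measurableT_comp => //; apply: measurable_funB.
Qed.

Let nearE T t s : near T (t, s) = (`|t - s| <= T)%R%:R.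
Proof. by rewrite /near indicE; congr ((nat_of_bool _)%:R); apply/idP/idP; rewrite inE. Qed.

Let near_sym T t s : near T (t, s) = near T (s, t).
Proof. by rewrite !nearE distrC. Qed.

Let Rintegral_near T t : 0 <= T -> \int[leb]_s (near T (t, s) * indI s) <= 2 * T.
Proof.
move=> T0; pose J := `[t - T, t + T]%classic : set timeR.
have Joo : leb J = (2 * T)%:E.
  rewrite lebesgue_measure_itv/= lte_fin; have [|] := ltrP (t - T) (t + T).
    by move=> _; congr EFin; ring.
  by move=> h; congr EFin; lra.
have iJ : leb.-integrable setT (EFin \o (\1_J : timeR -> R)).
  by apply: integrable_indic_lty; [exact: measurable_itv|rewrite [X in (X < _)%E]Joo ltry].
have -> : 2 * T = \int[leb]_s (\1_J s).
  rewrite /Rintegral integral_indic ?setIT//; last exact: measurable_itv.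
  by rewrite [X in fine X]Joo.
apply: (le_trans (ler_norm _)); apply: normr_Rintegral_le iJ => //.
  apply: measurable_funM; last exact: measurable_indic.
  exact: (measurableT_comp (mnear T) (pair1_measurable t)).
move=> s; rewrite normrM (ger0_norm (indI0 s)) nearE indicE.
have [tsT|_] := boolP (`|t - s| <= T); last by rewrite normr0 mul0r; case: (_ \in _).
rewrite normr1 mul1r (_ : (s \in J) = true) //.
by apply: mem_set; rewrite /J /= in_itv/=; move: tsT; rewrite ler_norml => /andP[? ?]; apply/andP; split; lra.
Qed.

Let near_far_mass kappa D T (k : Y -> Y -> R) : 0 <= T -> 0 <= D -> 0 <= kappa ->
  (forall t y y', `|kern (y, t) (y', t)| <= k y y') ->
  (forall y, mY.-integrable setT (EFin \o k y)) ->
  (forall y, \int[mY]_y' k y y' <= kappa) ->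
  (forall y y' t s, T < `|t - s| -> `|kern (y, t) (y', s)| <= D) ->
  \int[mZ]_z (w z * (set_int cos z ^+ 2 + set_int sin z ^+ 2)) <=
  2 * T * kappa * mass + D * mass ^+ 2.
Proof.
move=> T0 D0 k0 kk ik kK kD.
have [-> iform] := Rintegral_set_int_sqr.
have iLI : leb2.-integrable setT (EFin \o (fun u => L u.1 * indI u.2)).
  exact: integrable_mulmul.
have iIL : leb2.-integrable setT (EFin \o (fun u => indI u.1 * L u.2)).
  exact: integrable_mulmul.
have iLL : leb2.-integrable setT (EFin \o (fun u => L u.1 * L u.2)).
  exact: integrable_mulmul.
(* [indI] gives each term a product majorant, as Fubini requires; nothing is lost, because the form
   vanishes off I x I by [slab_form0]. *)
pose N u := near T u * (L u.1 * indI u.2 + indI u.1 * L u.2).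
have iN : leb2.-integrable setT (EFin \o N).
  apply: integrable_dominated (integrable_add iLI iIL).
    apply: measurable_funM => //; apply: measurable_funD; apply: measurable_funM.
    - exact: (measurableT_comp mL).
    - by apply: measurableT_comp => //; exact: measurable_indic.
    - by apply: measurableT_comp => //; exact: measurable_indic.
    - exact: (measurableT_comp mL).
  move=> u; have h : 0 <= L u.1 * indI u.2 + indI u.1 * L u.2 by rewrite addr_ge0 ?mulr_ge0.
  rewrite /N normrM (ger0_norm h) ler_piMl// /near indicE.
  by case: (_ \in _); rewrite ?normr1 ?normr0.
have N0 u : 0 <= N u.
  by rewrite /N /near indicE mulr_ge0// ?addr_ge0 ?mulr_ge0.
apply: (@le_trans _ _ (\int[leb2]_u (kappa / 2 * N u + D * (L u.1 * L u.2)))).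
  apply: le_Rintegral => //.
    by apply: integrable_add; exact: integrable_scalel.
  move=> [t s] _ /=.
  have R0 : 0 <= kappa / 2 * N (t, s) by rewrite mulr_ge0 ?divr_ge0// N0.
  have R1 : 0 <= D * (L t * L s) by rewrite !mulr_ge0.
  have [tsI|/slab_form0 ->] := boolP ((t \in I) && (s \in I)); last by rewrite addr_ge0.
  have [tsT|tsT] := leP (`|t - s|) T; last first.
    apply: (@le_trans _ _ (D * (L t * L s))); last by rewrite lerDr.
    by apply: slab_form_far => // y y'; exact: kD.
  apply: le_trans (_ : kappa / 2 * N (t, s) <= _); last by rewrite lerDl.
  apply: (le_trans (slab_form_mean t s)).
  have := slab_form_diag (kk t) ik kK; have := slab_form_diag (kk s) ik kK => hs ht.
  have -> : N (t, s) = L t + L s.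
    move/andP: tsI => [tI sI]; rewrite /N nearE tsT /indI !indicE tI sI.
    by rewrite !mul1r mulr1.
  move: hs ht; move: (slab_form t t) (slab_form s s) (L t) (L s) => a b x y hs ht; lra.
rewrite RintegralD//; [|exact: integrable_scalel..].
rewrite !RintegralZl//; apply: lerD; last first.
  by rewrite expr2 (Rintegral_mulmul iL iL).
have mI' : measurable_fun setT indI by exact: measurable_indic.
have near1 u : `|near T u| <= 1.
  by rewrite /near indicE; case: (_ \in _); rewrite ?normr1 ?normr0.
have m1 : measurable_fun setT (fun u => near T u * (L u.1 * indI u.2)).
  by apply: measurable_funM => //; apply: measurable_funM; exact: measurableT_comp.
have m2 : measurable_fun setT (fun u => near T u * (indI u.1 * L u.2)).
  by apply: measurable_funM => //; apply: measurable_funM; exact: measurableT_comp.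
have b1 t s : `|near T (t, s) * (L t * indI s)| <= L t * indI s.
  by rewrite normrM (ger0_norm (mulr_ge0 (L0 t) (indI0 s))) ler_piMl// mulr_ge0.
have b2 t s : `|near T (t, s) * (indI t * L s)| <= indI t * L s.
  by rewrite normrM (ger0_norm (mulr_ge0 (indI0 t) (L0 s))) ler_piMl// mulr_ge0.
have i1 : leb2.-integrable setT (EFin \o (fun u => near T u * (L u.1 * indI u.2))).
  exact: (integrable_product m1 b1 iL iI).
have i2 : leb2.-integrable setT (EFin \o (fun u => near T u * (indI u.1 * L u.2))).
  exact: (integrable_product m2 b2 iI iL).
have H1 : \int[leb2]_u (near T u * (L u.1 * indI u.2)) <= 2 * T * mass.
  rewrite (Rintegral_product12 m1 b1 iL iI) -RintegralZl//.
  apply: le_Rintegral => //.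
  - exact: (integrable_RintegralF m1 b1 iL iI).
  - exact: integrable_scalel.
  move=> t _ /=; rewrite mulrC.
  rewrite (@eq_Rintegral _ _ _ leb setT (fun s => L t * (near T (t, s) * indI s))); last first.
    by move=> s _; rewrite mulrCA.
  rewrite RintegralZl//; first by rewrite ler_wpM2l// Rintegral_near.
  apply: integrable_dominated iI => //.
    apply: measurable_funM => //.
    exact: (measurableT_comp (mnear T) (pair1_measurable t)).
  by move=> s; rewrite normrM (ger0_norm (indI0 s)) ler_piMl.
have H2 : \int[leb2]_u (near T u * (indI u.1 * L u.2)) <= 2 * T * mass.
  rewrite (Rintegral_product21 m2 b2 iI iL) -RintegralZl//.
  apply: le_Rintegral => //.
  - exact: (integrable_RintegralG m2 b2 iI iL).
  - exact: integrable_scalel.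
  move=> t _ /=; rewrite mulrC.
  rewrite (@eq_Rintegral _ _ _ leb setT (fun s => L t * (near T (t, s) * indI s))); last first.
    by move=> s _; rewrite near_sym mulrC -mulrA [X in _ * X]mulrC mulrCA; ring.
  rewrite RintegralZl//; first by rewrite ler_wpM2l// Rintegral_near.
  apply: integrable_dominated iI => //.
    apply: measurable_funM => //.
    exact: (measurableT_comp (mnear T) (pair1_measurable t)).
  by move=> s; rewrite normrM (ger0_norm (indI0 s)) ler_piMl.
rewrite (@eq_Rintegral _ _ _ leb2 setT (fun u => near T u * (L u.1 * indI u.2)
  + near T u * (indI u.1 * L u.2))); last by move=> u _; rewrite /N mulrDr.
rewrite RintegralD//.
rewrite (_ : 2 * T * kappa * mass = kappa / 2 * (2 * T * mass + 2 * T * mass)); last by field.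
by rewrite ler_wpM2l ?divr_ge0// lerD.
Qed.

Let Aint : (mY \x leb)%E.-integrable setT (EFin \o indA).
Proof.
apply: (@integrable_product _ _ _ _ _ mY leb indA al indI) => //.
by move=> y t; rewrite ger0_norm.
Qed.

Lemma near_far_finite : ((mY \x leb)%E A < +oo)%E.
Proof.
have /integrableP[_] := Aint.
under eq_integral do rewrite /= ger0_norm//.
by rewrite integral_indic// setIT.
Qed.

Let massE : fine ((mY \x leb)%E A) = mass.
Proof.
transitivity (\int[(mY \x leb)%E]_x indA x).
  by rewrite /Rintegral integral_indic// setIT.
rewrite (@Rintegral_product21 _ _ _ _ _ mY leb indA al indI)//.
by move=> y t; rewrite ger0_norm.
Qed.

Lemma near_far kappa D T (k : Y -> Y -> R) : 0 <= T -> 0 <= D -> 0 <= kappa ->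
  (forall t y y', `|kern (y, t) (y', t)| <= k y y') ->
  (forall y, mY.-integrable setT (EFin \o k y)) ->
  (forall y, \int[mY]_y' k y y' <= kappa) ->
  (forall y y' t s, T < `|t - s| -> `|kern (y, t) (y', s)| <= D) ->
  \int[mZ]_z (w z * (set_int cos z ^+ 2 + set_int sin z ^+ 2)) <=
  2 * T * kappa * fine ((mY \x leb)%E A) + D * fine ((mY \x leb)%E A) ^+ 2.
Proof. by rewrite massE; exact: near_far_mass. Qed.

Lemma integrable_w_set_int : mZ.-integrable setT
  (EFin \o (fun z => w z * (set_int cos z ^+ 2 + set_int sin z ^+ 2))).
Proof.
have ms (tr : R -> R) (mtr : measurable_fun setT tr) (tr1 : forall x, `|tr x| <= 1) :
    measurable_fun setT (set_int tr) /\ forall z, `|set_int tr z| <= \int[(mY \x leb)%E]_x indA x.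
  have mf : measurable_fun setT (fun u : Z * (Y * timeR) => indA u.2 * tr (phi (u.2, u.1))).
    apply: measurable_funM; first exact: measurableT_comp.
    apply: (measurableT_comp mtr); apply: (measurableT_comp mphi).
    exact: measurable_fun_pair.
  split; first exact: (measurable_Rintegral_param (prod_measure mY leb) mf).
  move=> z; apply: normr_Rintegral_le Aint.
    exact: (measurableT_comp mf (pair1_measurable z)).
  by move=> x; rewrite normrM (ger0_norm (indA0 x)) ler_piMr.
have [mc bc] := ms _ mcos cos1; have [msi bs] := ms _ msin sin1.
set M := \int[_]_x _ in bc bs.
apply: (@integrable_dominated _ _ _ _ _ (fun z => w z * (M ^+ 2 + M ^+ 2))).
- by apply: measurable_funM => //; apply: measurable_funD; exact: measurable_funX.
- move=> z; rewrite normrM (ger0_norm (w0 z)) ler_wpM2l// ger0_norm ?addr_ge0 ?sqr_ge0//.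
  have M0 : 0 <= M by apply: Rintegral_ge0.
  by apply: lerD; rewrite -[leLHS]real_normK ?num_real// ler_pXn2r ?nnegrE.
- exact: integrable_scaler.
Qed.

End near_far.

(** Turns a family of inequalities linear in P and Q, which can be proved pointwise under an
    integral, into Cauchy-Schwarz; the optimal b is X / P. *)
Lemma le_sqr_AMGM (R : realFieldType) (X P Q : R) : 0 <= X -> 0 <= P -> 0 <= Q ->
  (forall b, 0 < b -> 2 * X <= b * P + b^-1 * Q) -> X ^+ 2 <= P * Q.
Proof.
rewrite le_eqVlt => /orP[/eqP <- P0 Q0 _|X0 P0 Q0 h].
  by rewrite expr0n mulr_ge0.
have [P_gt0|P_le0] := ltP 0 P.
  have := h (X / P) (divr_gt0 X0 P_gt0).
  rewrite divfK ?gt_eqF// invf_div => {}h.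
  have : X <= P / X * Q by lra.
  by rewrite mulrAC ler_pdivlMr// -expr2.
have P00 : P = 0 by apply/eqP; rewrite eq_le P_le0.
have Q1 : 0 < Q + 1 by lra.
(* If P = 0 this b gives 2 X <= X Q / (Q + 1), which is absurd for X > 0. *)
have := h ((Q + 1) / X) (divr_gt0 Q1 X0).
rewrite P00 mulr0 add0r invf_div mulrAC ler_pdivlMr//; nra.
Qed.

(** * Duality and the measure of level sets *)

Section weak_type.
Context dY dZ (Y : measurableType dY) (Z : measurableType dZ) (R : realType).
Variables (mY : {sigma_finite_measure set Y -> \bar R})
  (mZ : {sigma_finite_measure set Z -> \bar R}).
Local Notation leb := (@lebesgue_measure R).
Local Notation timeR := (measurableTypeR R).
Variables (phi : Y * timeR * Z -> R) (w : Z -> R).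
Hypothesis mphi : measurable_fun setT phi.
Hypothesis w0 : forall z, 0 <= w z.
Hypothesis iw : mZ.-integrable setT (EFin \o w).
Variables (u v : Z -> R) (c0 : R).
Hypothesis c0_gt0 : 0 < c0.
Hypothesis mu_ : measurable_fun setT u.
Hypothesis mv : measurable_fun setT v.
Hypothesis supp : forall z, w z < c0 -> u z = 0 /\ v z = 0.
Hypothesis iuv : mZ.-integrable setT (EFin \o (fun z => u z ^+ 2 + v z ^+ 2)).

Let mw : measurable_fun setT w.
Proof. exact/measurable_EFinP/(measurable_int _ iw). Qed.

(** The real part of the extension of u - i v. *)
Definition wave (x : Y * timeR) : R :=
  \int[mZ]_z (u z * cos (phi (x, z)) + v z * sin (phi (x, z))).

Let G2 := \int[mZ]_z (u z ^+ 2 + v z ^+ 2).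

Let iuv1 : mZ.-integrable setT (EFin \o (fun z => `|u z| + `|v z|)).
Proof.
apply: (@integrable_dominated _ _ _ _ _ (fun z => (u z ^+ 2 + v z ^+ 2) + (2 / c0) * w z)).
- by apply: measurable_funD; exact: measurableT_comp.
- move=> z; rewrite ger0_norm ?addr_ge0//.
  have [/supp[-> ->]|wz] := ltP (w z) c0.
    by rewrite normr0 expr0n !addr0 add0r mulr_ge0// divr_ge0// ltW.
  have : 2 <= 2 / c0 * w z by rewrite mulrAC ler_pdivlMr// ler_pM2l.
  have := sqr_ge0 (`|u z| - 1); have := sqr_ge0 (`|v z| - 1).
  have := real_normK (num_real (u z)); have := real_normK (num_real (v z)).
  have := sqr_ge0 (u z); have := sqr_ge0 (v z).
  nra.
- by apply: integrable_add => //; exact: integrable_scalel.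
Qed.

Let muvf : measurable_fun setT (fun q : (Y * timeR) * Z =>
  u q.2 * cos (phi (q.1, q.2)) + v q.2 * sin (phi (q.1, q.2))).
Proof.
have mp : measurable_fun setT (fun q : (Y * timeR) * Z => phi (q.1, q.2)).
  rewrite (_ : (fun q => _) = phi)//; by apply/funext => -[].
by apply: measurable_funD; apply: measurable_funM; [exact: measurableT_comp|
  exact: (measurableT_comp (@measurable_cosR R))|exact: measurableT_comp|
  exact: (measurableT_comp (@measurable_sinR R))].
Qed.

Lemma measurable_wave : measurable_fun setT wave.
Proof. exact: (measurable_Rintegral_param mZ muvf). Qed.

Let uv_le x z : `|u z * cos (phi (x, z)) + v z * sin (phi (x, z))| <= `|u z| + `|v z|.
Proof.
rewrite (le_trans (ler_normD _ _))// !normrM.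
by apply: lerD; rewrite ler_piMr ?normr_cos_le1 ?normr_sin_le1.
Qed.

Let G20 : 0 <= G2.
Proof. by apply: Rintegral_ge0 => z _; rewrite addr_ge0 ?sqr_ge0. Qed.

Lemma integrable_wave x : mZ.-integrable setT
  (EFin \o (fun z => u z * cos (phi (x, z)) + v z * sin (phi (x, z)))).
Proof.
apply: integrable_dominated iuv1; last exact: uv_le.
exact: (measurableT_comp muvf (pair1_measurable x)).
Qed.

(** The trivial sup bound by Cauchy-Schwarz. As w >= c0 wherever u or v is nonzero, the integral of
    w over c0 plays the part of the measure of the support. *)
Lemma wave_sqr_le x : wave x ^+ 2 <= G2 * (2 * (\int[mZ]_z w z) / c0).
Proof.
have W0 : 0 <= \int[mZ]_z w z by exact: Rintegral_ge0.
rewrite -[leLHS]real_normK ?num_real//; apply: le_sqr_AMGM => //.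
  by rewrite mulr_ge0 ?invr_ge0 ?(ltW c0_gt0)// mulr_ge0.
move=> b b0; apply: (@le_trans _ _ (2 * \int[mZ]_z (`|u z| + `|v z|))).
  rewrite ler_pM2l//; apply: normr_Rintegral_le iuv1; last exact: uv_le.
  exact: (measurableT_comp muvf (pair1_measurable x)).
have -> : b^-1 * (2 * (\int[mZ]_z w z) / c0) = 2 / (b * c0) * \int[mZ]_z w z.
  by field; rewrite !gt_eqF.
rewrite -!RintegralZl// -RintegralD//; [|exact: integrable_scalel..].
apply: le_Rintegral => //.
- exact: integrable_scalel.
- by apply: integrable_add; exact: integrable_scalel.
move=> z _; have [/supp[-> ->]|wz] := ltP (w z) c0.
  rewrite normr0 expr0n/= !addr0 !mulr0 add0r mulr_ge0// divr_ge0// mulr_ge0// ltW//.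
apply: (@le_trans _ _ (b * (u z ^+ 2 + v z ^+ 2) + 2 / b)).
  have amgm (a : R) : 2 * `|a| <= b * a ^+ 2 + b^-1.
    rewrite -[a ^+ 2]real_normK ?num_real//.
    have : 0 <= b^-1 * (b * `|a| - 1) ^+ 2 by rewrite mulr_ge0 ?sqr_ge0// invr_ge0 ltW.
    rewrite (_ : b^-1 * _ = b * `|a| ^+ 2 + b^-1 - 2 * `|a|) ?subr_ge0//.
    by field; rewrite gt_eqF.
  have := amgm (u z); have := amgm (v z); lra.
rewrite lerD2l (_ : 2 / (b * c0) * w z = 2 / b * (w z / c0)); last by field; rewrite !gt_eqF.
by rewrite ler_peMr ?divr_ge0 ?(ltW b0)// ler_pdivlMr// mul1r.
Qed.

Variables (A : set (Y * timeR)) (al : Y -> R) (I : set timeR).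
Hypothesis mA : measurable A.
Hypothesis mI : measurable I.
Hypothesis Ioo : (leb I < +oo)%E.
Hypothesis al0 : forall y, 0 <= al y.
Hypothesis ial : mY.-integrable setT (EFin \o al).
Hypothesis Aal : forall y t, \1_A (y, t) <= al y * \1_I t :> R.

Let muA := fine ((mY \x leb)%E A).
Let mX := prod_measure mY leb.

Let iA : mX.-integrable setT (EFin \o (\1_A : _ -> R)).
Proof. by apply: integrable_indic_lty => //; exact: near_far_finite Aal. Qed.

Let muA0 : 0 <= muA. Proof. exact: fine_ge0. Qed.

(** Integrate [lam <= wave] over A and move the extension onto the indicator by Fubini. The factor 1
    / c0 is the price of replacing the indicator of the support of (u, v) by w. *)
Lemma level_set_duality (lam : R) : 0 <= lam -> (forall x, A x -> lam <= wave x) ->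
  (lam * muA) ^+ 2 <= G2 * (c0^-1 *
    \int[mZ]_z (w z * (set_int mY phi A cos z ^+ 2 + set_int mY phi A sin z ^+ 2))).
Proof.
move=> lam0 lamA.
have iset := integrable_w_set_int mphi w0 iw mA mI Ioo ial Aal.
have muAE : muA = \int[mX]_x (\1_A x).
  by rewrite /Rintegral integral_indic// setIT.
have mf : measurable_fun setT (fun q : (Y * timeR) * Z => \1_A q.1 *
    (u q.2 * cos (phi (q.1, q.2)) + v q.2 * sin (phi (q.1, q.2)))).
  apply: measurable_funM => //; apply: measurableT_comp => //; exact: measurable_indic.
have f_le x z : `|\1_A x * (u z * cos (phi (x, z)) + v z * sin (phi (x, z)))| <=
    \1_A x * (`|u z| + `|v z|).
  rewrite normrM ger0_norm ?indicE// ler_wpM2l//; exact: uv_le.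
have E z : u z * set_int mY phi A cos z + v z * set_int mY phi A sin z =
    \int[mX]_x (\1_A x * (u z * cos (phi (x, z)) + v z * sin (phi (x, z)))).
  have itr (tr : R -> R) (mtr : measurable_fun setT tr) (tr1 : forall x, `|tr x| <= 1) :
      mX.-integrable setT (EFin \o (fun x => \1_A x * tr (phi (x, z)))).
    apply: integrable_dominated iA.
      apply: measurable_funM; first exact: measurable_indic.
      by apply: (measurableT_comp mtr); apply: (measurableT_comp mphi).
    by move=> x; rewrite normrM ger0_norm ?indicE// ler_piMr.
  have ic := itr cos (@measurable_cosR R) (@normr_cos_le1 R).
  have is_ := itr sin (@measurable_sinR R) (@normr_sin_le1 R).
  rewrite /set_int -!(@RintegralZl _ _ _ mX)//.
  rewrite -(@RintegralD _ _ _ mX)//; [|exact: integrable_scalel..].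
  by apply: eq_Rintegral => x _; ring.
have S1 : lam * muA <= \int[mZ]_z (u z * set_int mY phi A cos z + v z * set_int mY phi A sin z).
  under eq_Rintegral do rewrite E.
  rewrite -(RFubini mf f_le iA iuv1) muAE -RintegralZl//.
  apply: le_Rintegral => //.
  - exact: integrable_scalel.
  - exact: (integrable_RintegralF mf f_le iA iuv1).
  move=> x _ /=; rewrite RintegralZl//; last exact: integrable_wave.
  rewrite mulrC indicE; have [|_] := boolP (x \in A); last by rewrite !mul0r.
  by rewrite inE !mul1r => /lamA.
apply: le_sqr_AMGM => //.
- exact: mulr_ge0.
- rewrite mulr_ge0 ?invr_ge0 ?(ltW c0_gt0)//; apply: Rintegral_ge0 => z _.
  by rewrite mulr_ge0// addr_ge0 ?sqr_ge0.
move=> b b0; apply: (@le_trans _ _ (2 * \int[mZ]_z (u z * set_int mY phi A cos z + v z * set_int mY phi A sin z))).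
  by rewrite ler_pM2l.
have iset2 : mZ.-integrable setT (EFin \o (fun z =>
    u z * set_int mY phi A cos z + v z * set_int mY phi A sin z)).
  have := integrable_RintegralG mf f_le iA iuv1.
  by apply: eq_integrable => // z _ /=; rewrite E.
rewrite mulrA -!RintegralZl// -RintegralD//; [|exact: integrable_scalel..].
apply: le_Rintegral => //.
- exact: integrable_scalel.
- by apply: integrable_add; exact: integrable_scalel.
move=> z _; move: (set_int _ _ _ cos z) (set_int _ _ _ sin z) => X X'.
have [/supp[-> ->]|wz] := ltP (w z) c0.
  rewrite !mul0r !addr0 expr0n/= mulr0 addr0 mulr0 add0r.
  apply: mulr_ge0; first by rewrite mulr_ge0// invr_ge0 ltW.
  by rewrite mulr_ge0// addr_ge0 ?sqr_ge0.
apply: (@le_trans _ _ (b * (u z ^+ 2 + v z ^+ 2) + b^-1 * (X ^+ 2 + X' ^+ 2))).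
  have amgm (a a' : R) : 2 * (a * a') <= b * a ^+ 2 + b^-1 * a' ^+ 2.
    have : 0 <= b^-1 * (b * a - a') ^+ 2 by rewrite mulr_ge0 ?sqr_ge0// invr_ge0 ltW.
    rewrite (_ : b^-1 * _ = b * a ^+ 2 + b^-1 * a' ^+ 2 - 2 * (a * a')) ?subr_ge0//.
    by field; rewrite gt_eqF.
  have := amgm (u z) X; have := amgm (v z) X'; lra.
rewrite lerD2l -!mulrA ler_wpM2l ?invr_ge0 ?(ltW b0)// mulrA ler_peMl ?addr_ge0 ?sqr_ge0//.
by rewrite ler_pdivlMl// mulr1.
Qed.

Lemma level_set_le (kappa D0 sigma lam : R) (k : Y -> Y -> R) :
  0 < sigma -> 0 < D0 -> 0 <= kappa ->
  (forall t y y', `|kern mZ phi w (y, t) (y', t)| <= k y y') ->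
  (forall y, mY.-integrable setT (EFin \o k y)) ->
  (forall y, \int[mY]_y' k y y' <= kappa) ->
  (forall y y' t s, 1 <= `|t - s| ->
    `|kern mZ phi w (y, t) (y', s)| * `|t - s| `^ sigma <= D0) ->
  0 < lam -> (forall x, A x -> lam <= wave x) -> c0 * lam ^+ 2 <= 2 * D0 * G2 ->
  muA <= 4 * kappa * G2 / (c0 * lam ^+ 2) *
    (2 * D0 * G2 / (c0 * lam ^+ 2)) `^ sigma^-1.
Proof.
move=> s0 D00 k0 hk ik kK kD lam0 lamA lamG.
have cl0 : 0 < c0 * lam ^+ 2 by rewrite mulr_gt0 ?exprn_gt0.
(* T is chosen with T^sigma = X: the far term is then exactly half of (lam |A|)^2 and can be
   absorbed on the left. The hypothesis on lam says X >= 1, hence T >= 1, where the kernel decay is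
   available. *)
set X := 2 * D0 * G2 / (c0 * lam ^+ 2); set T := X `^ sigma^-1.
have X1 : 1 <= X by rewrite /X ler_pdivlMr// mul1r.
have X0 : 0 < X by exact: lt_le_trans X1.
have G2_gt0 : 0 < G2.
  have := lt_le_trans cl0 lamG; rewrite pmulr_rgt0//; exact: mulr_gt0.
have T1 : 1 <= T.
  have <- : 1 `^ sigma^-1 = 1 :> R by rewrite powR1.
  by rewrite /T; apply: ge0_ler_powR; rewrite ?nnegrE ?invr_ge0 // ltW.
have TX : T `^ sigma = X by rewrite /T -powRrM mulVf ?gt_eqF// powRr1// ltW.
have T0 : 0 <= T by apply: le_trans T1.
have D'0 : 0 <= D0 / X by rewrite divr_ge0 ?ltW.
have far y y' t s : T < `|t - s| -> `|kern mZ phi w (y, t) (y', s)| <= D0 / X.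
  move=> Tts; rewrite ler_pdivlMr//.
  apply: le_trans (kD y y' t s (le_trans T1 (ltW Tts))).
  by rewrite ler_wpM2l// -TX; apply: ge0_ler_powR; rewrite ?nnegrE // ltW.
have := near_far mphi w0 iw mA mI Ioo al0 ial Aal T0 D'0 k0 hk ik kK far.
rewrite -/muA => nf.
have := level_set_duality (ltW lam0) lamA.
set Q := \int[mZ]_z _ in nf *; move=> dual.
have dual2 : (lam * muA) ^+ 2 <= G2 * (c0^-1 * (2 * T * kappa * muA + D0 / X * muA ^+ 2)).
  by apply: (le_trans dual); rewrite ler_wpM2l ?(ltW G2_gt0)// ler_wpM2l// invr_ge0 ltW.
have e1 : G2 * (c0^-1 * (2 * T * kappa * muA + D0 / X * muA ^+ 2)) =
   2 * T * kappa * G2 / c0 * muA + lam ^+ 2 / 2 * muA ^+ 2.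
  by rewrite /X; field; rewrite !gt_eqF.
rewrite e1 exprMn in dual2.
have [->|m0] := eqVneq muA 0.
  apply: mulr_ge0; last exact: powR_ge0.
  by apply: divr_ge0; [apply: mulr_ge0; [exact: mulr_ge0|exact: ltW]|exact: ltW].
have m_gt0 : 0 < muA by rewrite lt_def m0.
have : lam ^+ 2 / 2 * muA * muA <= 2 * T * kappa * G2 / c0 * muA.
  by move: dual2; rewrite expr2; lra.
rewrite ler_pM2r// => h.
rewrite (_ : _ * T = (2 * T * kappa * G2 / c0) / (lam ^+ 2 / 2)); last by field; rewrite !gt_eqF.
by rewrite ler_pdivlMr ?divr_gt0 ?exprn_gt0// mulrC.
Qed.

End weak_type.

(** * Dyadic summation over level sets *)

Section layer_cake.
Context d (X : measurableType d) (R : realType).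
Variable mu : {measure set X -> \bar R}.

Lemma dyadic_level (M x : R) : 0 < M -> 0 < x <= M ->
  exists j : nat, 2^-1 ^+ j.+1 * M < x <= 2^-1 ^+ j * M.
Proof.
move=> M0 /andP[x0 xM].
have ex : exists j : nat, 2^-1 ^+ j.+1 * M < x.
  exists (Num.bound (M / x)); rewrite exprVn -ltr_pdivlMr// -[ltRHS]invf_div.
  rewrite ltf_pV2 ?posrE ?divr_gt0 ?exprn_gt0//.
  apply: (lt_le_trans (archi_boundP (ltW (divr_gt0 M0 x0)))).
  by rewrite -natrX ler_nat (leq_trans (ltnW (ltn_expl _ (ltnSn 1))))// leq_exp2l.
exists (ex_minn ex); case: ex_minnP => j jx jmin; rewrite jx/=.
case: j jx jmin => [|j] jx jmin; first by rewrite expr0 mul1r.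
by rewrite leNgt; apply/negP => /jmin; rewrite ltnn.
Qed.

(** With l_j = M / 2^j, the part where N lies in (l_(j+1), l_j] contributes at most l_j^p K /
    l_(j+1)^q = K 2^q l_j^(p - q). These terms are geometric with ratio 2^(- (p - q)). The sup bound
    M stops the levels from above, where the sum would diverge. *)
Lemma layer_cake (A : set X) (N : X -> R) (M K p q : R) :
  measurable A -> measurable_fun setT N -> 0 < M -> 0 <= K -> 0 < q < p ->
  (forall x, 0 <= N x) -> (forall x, A x -> N x <= M) ->
  (forall l, 0 < l -> (mu (A `&` [set x | (l < N x)%R]) <= (K / l `^ q)%:E)%E) ->
  (\int[mu]_(x in A) ((N x) `^ p)%:E <=
   (K * M `^ (p - q) * 2 `^ q / (1 - 2^-1 `^ (p - q)))%:E)%E.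
Proof.
move=> mA mN M0 K0 /andP[q0 qp] N0 NM level.
have p0 : 0 < p by exact: lt_trans qp.
pose l (j : nat) : R := 2^-1 ^+ j * M.
have l0 j : 0 < l j by rewrite mulr_gt0 ?exprn_gt0.
pose E j := A `&` [set x | l j.+1 < N x].
have mE j : measurable (E j).
  apply: measurableI => //.
  rewrite (_ : [set x | _] = N @^-1` `]l j.+1, +oo[); last first.
    by apply/seteqP; split => x /=; rewrite in_itv/= andbT.
  by rewrite -[X in measurable X]setTI; exact: mN.
pose f j x := ((l j `^ p)%:E * (\1_(E j) x)%:E)%E : \bar R.
have f0 j x : (0 <= f j x)%E by rewrite mule_ge0// lee_fin ?powR_ge0// indicE.
have mf j : measurable_fun A (f j).
  apply: measurable_funTS; apply: emeasurable_funM => //.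
  by apply/measurable_EFinP; exact: measurable_indic.
apply: (@le_trans _ _ (\int[mu]_(x in A) \sum_(j <oo) f j x)%E).
  apply: ge0_le_integral => //.
  - by move=> x _; rewrite lee_fin powR_ge0.
  - apply: measurable_funTS; apply/measurable_EFinP.
    exact: (measurableT_comp (measurable_powR p) mN).
  - by apply: ge0_emeasurable_sum.
  move=> x Ax; have [Nx|Nx] := eqVneq (N x) 0.
    by rewrite Nx powR0 ?gt_eqF// nneseries_ge0.
  have [|j /andP[jN Nj]] := @dyadic_level M (N x) M0.
    by rewrite lt_def Nx N0 NM.
  apply: (@le_trans _ _ (f j x)).
    rewrite /f indicE mem_set ?mule1; last by split.
    by rewrite lee_fin; apply: ge0_ler_powR; rewrite ?nnegrE // ltW.
  apply: le_trans (nneseries_lim_ge j.+1 _); last by move=> *; exact: f0.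
  by rewrite big_nat_recr//= leeDr// sume_ge0.
rewrite integral_nneseries//.
pose rho : R := 2^-1 `^ (p - q).
have term j : (\int[mu]_(x in A) f j x <= (K * M `^ (p - q) * 2 `^ q * rho ^+ j)%:E)%E.
  have mE1 : measurable_fun A (fun x => (\1_(E j) x)%:E : \bar R).
    by apply: measurable_funTS; apply/measurable_EFinP; exact: measurable_indic.
  rewrite /f ge0_integralZl ?lee_fin ?powR_ge0//.
  rewrite integral_indic// setIC setIA setIid.
  apply: (@le_trans _ _ ((l j `^ p)%:E * (K / l j.+1 `^ q)%:E)%E).
    by rewrite lee_wpmul2l ?lee_fin ?powR_ge0//; exact: level.
  rewrite -EFinM lee_fin /l.
  have h0 (n : nat) : 0 <= 2^-1 ^+ n :> R by rewrite exprn_ge0.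
  have hX (n : nat) (r : R) : (2^-1 ^+ n) `^ r = (2^-1 `^ r) ^+ n.
    by rewrite -powR_mulrn// powRAC powR_mulrn// powR_ge0.
  have hh (r : R) : 2^-1 `^ r = (2 `^ r)^-1 by rewrite -powRN -powR_inv1// -powRrM mulN1r.
  rewrite !powRM ?(ltW M0)// !hX /rho !powRB ?gt_eqF// ?implybT//.
  have Mq : M `^ q != 0 by rewrite gt_eqF ?powR_gt0.
  have hp : 2^-1 `^ q != 0 :> R by rewrite gt_eqF ?powR_gt0.
  rewrite le_eqVlt; apply/orP; left; apply/eqP.
  rewrite -[2 `^ q]invrK -hh exprMn exprVn exprS.
  by field; rewrite hp Mq expf_neq0.
have c0 : 0 <= K * M `^ (p - q) * 2 `^ q by rewrite !mulr_ge0 ?powR_ge0.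
have rho0 : 0 < rho by rewrite powR_gt0.
have rho1 : rho < 1.
  have <- : 1 `^ (p - q) = 1 :> R by rewrite powR1.
  by apply: gt0_ltr_powR; rewrite ?subr_gt0 ?nnegrE// invf_lt1// ltr1n.
apply: lime_le.
  by apply: is_cvg_nneseries => j _ _; exact: integral_ge0.
apply: nearW => n.
apply: (@le_trans _ _ (\sum_(0 <= j < n) (K * M `^ (p - q) * 2 `^ q * rho ^+ j)%:E)%E).
  by apply: lee_sum => j _; exact: term.
rewrite sumEFin lee_fin.
have := @geometric_le_lim R n _ rho c0 rho0.
by rewrite (ger0_norm (ltW rho0)) => /(_ rho1); rewrite /series.
Qed.

End layer_cake.

(** * The kernel of the extension operator *)

Section kernel.
Context (R : realType) (k : nat).
Local Notation mR := (lebesgue_Rn R k).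
Local Notation timeR := (measurableTypeR R).

Definition gauss_weight (z : freqT R k) : R :=
  expR (- dotRn z.1 z.1) * expR (- dotRn z.2 z.2).

Lemma gauss_weight_ge0 z : 0 <= gauss_weight z.
Proof. by rewrite mulr_ge0 ?expR_ge0. Qed.

Lemma integrable_gauss_weight :
  (lebesgue_freq R k).-integrable setT (EFin \o gauss_weight).
Proof. exact: (integrable_mulmul (integrable_gaussRn R k) (integrable_gaussRn R k)). Qed.

Definition phase_uncurried (q : spaceT R k * freqT R k) : R := phase q.1 q.2.

Lemma normRn4 (x : Rn R k) : normRn x ^+ 4 = dotRn x x ^+ 2.
Proof. by rewrite (exprM _ 2 2) sqr_sqrtr// dotRn_ge0. Qed.

Lemma measurable_phase : measurable_fun setT phase_uncurried.
Proof.
have m11 : measurable_fun setT (fun q : spaceT R k * freqT R k => q.1.1.1).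
  by do 2 apply: measurableT_comp => //.
have m12 : measurable_fun setT (fun q : spaceT R k * freqT R k => q.1.1.2).
  by do 2 apply: measurableT_comp => //.
have m13 : measurable_fun setT (fun q : spaceT R k * freqT R k => q.1.2).
  by apply: measurableT_comp => //.
have m21 : measurable_fun setT (fun q : spaceT R k * freqT R k => q.2.1).
  by apply: measurableT_comp => //.
have m22 : measurable_fun setT (fun q : spaceT R k * freqT R k => q.2.2).
  by apply: measurableT_comp => //.
rewrite (_ : phase_uncurried = fun q => dotRn q.1.1.1 q.2.1 + dotRn q.1.1.2 q.2.2 +
  q.1.2 * (dotRn q.2.1 q.2.1 ^+ 2 - dotRn q.2.2 q.2.2 ^+ 2)); last first.
  by apply/funext => q; rewrite /phase_uncurried /phase !normRn4.
apply: measurable_funD; first by apply: measurable_funD; exact: measurable_dotRn.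
apply: measurable_funM => //; apply: measurable_funB.
  by apply: measurable_funX; exact: measurable_dotRn.
by apply: measurable_funX; exact: measurable_dotRn.
Qed.

(** The difference x - y, encoded through [affineRn] so that the translation lemmas for integrals
    apply to x directly. *)
Definition subRn (x y : Rn R k) : Rn R k := affineRn 1 (affineRn (- 1) (origRn R k) y) x.

Lemma dotRn_subl x y z : dotRn (subRn x y) z = dotRn x z - dotRn y z.
Proof.
rewrite /subRn dotRnC dotRn_affine_r (dotRnC z (affineRn _ _ _)) (dotRnC (affineRn _ _ _) z).
rewrite dotRn_affine_r (dotRnC z (origRn R k)) dotRn_orig (dotRnC z x) (dotRnC z y); ring.
Qed.

Lemma dotRn_subC x y : dotRn (subRn x y) (subRn x y) = dotRn (subRn y x) (subRn y x).
Proof.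
rewrite !dotRn_subl !(dotRnC _ (subRn _ _)) !dotRn_subl (dotRnC y x); ring.
Qed.

(** The addition formula for cos. The integrals with th = pi / 2 are minus those of sin, and the two
    signs cancel in the product. *)
Lemma kernE (x x' : spaceT R k) :
  kern (lebesgue_freq R k) phase_uncurried gauss_weight x x' =
  quartic_int (subRn x.1.1 x'.1.1) (x.2 - x'.2) 0 * quartic_int (subRn x.1.2 x'.1.2) (- (x.2 - x'.2)) 0
  - quartic_int (subRn x.1.1 x'.1.1) (x.2 - x'.2) (pi / 2) * quartic_int (subRn x.1.2 x'.1.2) (- (x.2 - x'.2)) (pi / 2).
Proof.
set a := subRn x.1.1 _; set b := subRn x.1.2 _; set t := x.2 - _.
rewrite /quartic_int !(Rintegral_mulmul (integrable_quartic _ _ _) (integrable_quartic _ _ _)).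
rewrite -(@RintegralB _ _ _ (lebesgue_freq R k))//; last 2 first.
- exact: (integrable_mulmul (integrable_quartic _ _ _) (integrable_quartic _ _ _)).
- exact: (integrable_mulmul (integrable_quartic _ _ _) (integrable_quartic _ _ _)).
apply: eq_Rintegral => z _.
rewrite !cosDpihalf !addr0.
rewrite (_ : phase_uncurried (x, z) - phase_uncurried (x', z) =
  (dotRn a z.1 + t * dotRn z.1 z.1 ^+ 2) + (dotRn b z.2 + - t * dotRn z.2 z.2 ^+ 2)).
  by rewrite cosD /gauss_weight; ring.
by rewrite /phase_uncurried /phase !normRn4 /a /b /t !dotRn_subl /=; ring.
Qed.

(** Complex conjugation reverses t and a together. It changes the sign of the component th = pi / 2,
    whence the absolute values. *)
Lemma quartic_intN (a : Rn R k) t th : th = 0 \/ th = pi / 2 ->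
  `|quartic_int a (- t) th| = `|quartic_int (subRn (origRn R k) a) t th|.
Proof.
have e x : dotRn (subRn (origRn R k) a) x = - dotRn a x.
  by rewrite dotRn_subl dotRn_orig sub0r.
case=> ->.
  congr (`|_|); apply: eq_Rintegral => x _; rewrite e -[in LHS]cosN; congr (_ * cos _); ring.
rewrite -[LHS]normrN; congr (`|_|); rewrite -mulN1r -RintegralZl//; last exact: integrable_quartic.
apply: eq_Rintegral => x _; rewrite e !cosDpihalf.
rewrite (_ : - dotRn a x + _ = - (dotRn a x + - t * dotRn x x ^+ 2)); last by ring.
by rewrite sinN; ring.
Qed.

Lemma quartic_int_decay_abs (a : Rn R k) t th : 1 <= `|t| -> th = 0 \/ th = pi / 2 ->
  `|quartic_int a t th| <= decay_cst R k * Num.sqrt (Num.sqrt `|t|) ^- k.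
Proof.
have [t0|t0] := leP 0 t => t1 thE.
  by rewrite (ger0_norm t0) in t1 *; exact: quartic_int_decay.
rewrite (ltr0_norm t0) in t1 *.
by rewrite -[t in quartic_int a t]opprK quartic_intN//; exact: quartic_int_decay.
Qed.

Lemma kern_decay (x x' : spaceT R k) : 1 <= `|x.2 - x'.2| ->
  `|kern (lebesgue_freq R k) phase_uncurried gauss_weight x x'| * `|x.2 - x'.2| `^ (k%:R / 2) <=
  2 * decay_cst R k ^+ 2.
Proof.
rewrite kernE; move: (x.2 - x'.2) => t t1.
have t0 : 0 < `|t| by exact: lt_le_trans t1.
set c := Num.sqrt (Num.sqrt `|t|).
have c0 : 0 < c by rewrite /c !sqrtr_gt0.
have cc : `|t| `^ (k%:R / 2) = c ^+ k * c ^+ k.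
  rewrite mulrC powRrM powR12_sqrt// powR_mulrn ?sqrtr_ge0//.
  by rewrite -exprD addnn -muln2 mulnC exprM sqr_sqrtr// sqrtr_ge0.
have tN1 : 1 <= `|- t| by rewrite normrN.
have b (a : Rn R k) th : th = 0 \/ th = pi / 2 -> `|quartic_int a t th| <= decay_cst R k * c ^- k.
  by move=> h; exact: quartic_int_decay_abs.
have b' (a : Rn R k) th : th = 0 \/ th = pi / 2 -> `|quartic_int a (- t) th| <= decay_cst R k * c ^- k.
  by move=> h; have := quartic_int_decay_abs a tN1 h; rewrite normrN.
have ck : c ^+ k != 0 by rewrite expf_neq0// gt_eqF.
apply: (@le_trans _ _ (2 * (decay_cst R k * c ^- k) ^+ 2 * (c ^+ k * c ^+ k))).
  rewrite cc; apply: ler_wpM2r; first by rewrite mulr_ge0// exprn_ge0// ltW.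
  rewrite (le_trans (ler_normB _ _))// !normrM.
  set X := decay_cst R k / c ^+ k.
  rewrite (_ : 2 * X ^+ 2 = X * X + X * X); last by ring.
  have th0 : (0 : R) = 0 \/ (0 : R) = pi / 2 by left.
  have thpi : (pi / 2 : R) = 0 \/ (pi / 2 : R) = pi / 2 by right.
  by apply: lerD; apply: ler_pM => //;
    [exact: (b _ _ th0)|exact: (b' _ _ th0)|exact: (b _ _ thpi)|exact: (b' _ _ thpi)].
rewrite le_eqVlt; apply/orP; left; apply/eqP; field; exact: ck.
Qed.

Let g := \int[mR]_z expR (- dotRn z z).

(** At equal times both factors of the kernel are Fourier transforms of a Gaussian, of rate 1/4 =
    (1/2)^2. The difference is y' - y since y' is the variable integrated in Schur's test. *)
Definition diag_kern (y y' : freqT R k) : R :=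
  2 * g ^+ 2 * (expR (- (2^-1 ^+ 2 * dotRn (subRn y'.1 y.1) (subRn y'.1 y.1))) *
                expR (- (2^-1 ^+ 2 * dotRn (subRn y'.2 y.2) (subRn y'.2 y.2)))).

Lemma kern_diag_le (y y' : freqT R k) (t : timeR) :
  `|kern (lebesgue_freq R k) phase_uncurried gauss_weight (y, t) (y', t)| <= diag_kern y y'.
Proof.
have g0 : 0 <= g by apply: Rintegral_ge0 => z _; exact: expR_ge0.
have b (a : Rn R k) th : `|quartic_int a 0 th| <= expR (- (2^-1 ^+ 2 * dotRn a a)) * g.
  have := gauss_cos_le a th; rewrite (_ : 2^-1 ^+ 2 * dotRn a a = dotRn a a / 4); last by field.
  apply: le_trans; rewrite /quartic_int /gauss_cos le_eqVlt; apply/orP; left; apply/eqP.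
  by congr (`|_|); apply: eq_Rintegral => x _; rewrite mul0r addr0 mul1r.
rewrite kernE /= subrr oppr0 /diag_kern (dotRn_subC y'.1) (dotRn_subC y'.2).
rewrite (le_trans (ler_normB _ _))// !normrM.
set e1 := expR _; set e2 := expR _.
rewrite (_ : 2 * g ^+ 2 * (e1 * e2) = (e1 * g) * (e2 * g) + (e1 * g) * (e2 * g)); last by ring.
by apply: lerD; apply: ler_pM => //; exact: b.
Qed.

Let igd : mR.-integrable setT (EFin \o (fun x => expR (- (2^-1 ^+ 2 * dotRn x x)))).
Proof. by apply: integrable_gauss_scaled; rewrite invr_gt0. Qed.

Let igs y : mR.-integrable setT
  (EFin \o (fun x => expR (- (2^-1 ^+ 2 * dotRn (subRn x y) (subRn x y))))).
Proof. exact: (integrable_affineRn _ (@ltr01 R) igd). Qed.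

Lemma integrable_diag_kern y : (lebesgue_freq R k).-integrable setT (EFin \o diag_kern y).
Proof. by apply: integrable_scalel; exact: (integrable_mulmul (igs y.1) (igs y.2)). Qed.

Definition diag_cst : R := 2 * g ^+ 2 *
  (\int[mR]_x expR (- (2^-1 ^+ 2 * dotRn x x))) ^+ 2.

Lemma diag_cst_ge0 : 0 <= diag_cst.
Proof. by apply: mulr_ge0; [apply: mulr_ge0 => //|]; exact: sqr_ge0. Qed.

Lemma Rintegral_diag_kern y : \int[lebesgue_freq R k]_y' diag_kern y y' <= diag_cst.
Proof.
rewrite RintegralZl//; last exact: (integrable_mulmul (igs y.1) (igs y.2)).
have e y0 : \int[mR]_x expR (- (2^-1 ^+ 2 * dotRn (subRn x y0) (subRn x y0))) =
    \int[mR]_x expR (- (2^-1 ^+ 2 * dotRn x x)).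
  by have := Rintegral_affineRn (affineRn (- 1) (origRn R k) y0) (@ltr01 R) igd;
    rewrite expr1n invr1 mul1r.
have := Rintegral_mulmul (igs y.1) (igs y.2); rewrite (e y.1) (e y.2) => <-.
by rewrite /diag_cst; set J := Rintegral _ _ _; rewrite (expr2 J).
Qed.

End kernel.

(** * Almost everywhere equal integrands *)

Section ae_integral.
Local Open Scope ereal_scope.
Context d (T : measurableType d) (R : realType).
Variable mu : {measure set T -> \bar R}.
Import HBNNSimple.

(* No measurability of [f] is assumed: the library's integral of a nonnegative
   function is a supremum over the simple functions below it, which null sets
   do not affect. *)
Lemma ge0_ae_eq_integralT (f h : T -> \bar R) (N : set T) :
  measurable N -> mu N = 0 -> (forall x, 0 <= f x) -> (forall x, 0 <= h x) ->
  measurable_fun setT h -> (forall x, ~ N x -> f x = h x) ->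
  \int[mu]_x f x = \int[mu]_x h x.
Proof.
move=> mN N0 f0 h0 mh fh.
have mNc : measurable (~` N) by exact: measurableC.
have trunc (g : {nnsfun T >-> R}) : \int[mu]_x (g x)%:E = \int[mu]_x (proj_nnsfun g mNc x)%:E.
  apply: ge0_ae_eq_integral => //.
  - exact/measurable_EFinP.
  - exact/measurable_EFinP.
  - by move=> x _; rewrite lee_fin.
  - by move=> x _; rewrite lee_fin.
  exists N; split => // x /= /not_implyP[_ gx]; apply: contrapT => Nx; apply: gx.
  by rewrite /proj_nnsfun /= mindicE mem_set ?mulr1.
have le1 (f1 h1 : T -> \bar R) : (forall x, 0 <= f1 x) -> (forall x, 0 <= h1 x) ->
    (forall x, ~ N x -> f1 x = h1 x) -> \int[mu]_x f1 x <= \int[mu]_x h1 x.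
  move=> f10 h10 fh1; rewrite !ge0_integralTE//.
  apply: ge_ereal_sup => _ [g gf <-]; apply: ereal_sup_ubound.
  exists (proj_nnsfun g mNc).
    move=> x; rewrite /proj_nnsfun /= mindicE; have [|xN] := boolP (x \in ~` N).
      by rewrite inE mulr1 => /fh1 <-; exact: gf.
    by rewrite mulr0.
  by rewrite -!integralT_nnsfun -trunc.
by apply/eqP; rewrite eq_le !le1// => x /fh.
Qed.

(** Only [h] is measurable: an input of the extension operator is measurable for the completion
    alone, and is exchanged here for its Borel representative. *)
Lemma ae_eq_integral_measurable (f h : T -> \bar R) (D : set T) :
  measurable D -> measurable_fun D h -> {ae mu, forall x, D x -> f x = h x} ->
  \int[mu]_(x in D) f x = \int[mu]_(x in D) h x.
Proof.
move=> mD mh [N [mN N0 subN]].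
have fh x : ~ N x -> (f \_ D) x = (h \_ D) x.
  move=> Nx; rewrite !patchE; case: ifPn => // /set_mem Dx.
  by apply: contrapT => fx; apply: Nx; apply: subN => /= /(_ Dx).
rewrite integral_mkcond [RHS]integral_mkcond integralE [RHS]integralE.
have mhD : measurable_fun setT (h \_ D) by exact/(measurable_restrictT _ mD).
congr (_ - _); apply: (ge0_ae_eq_integralT mN N0) => //.
- exact: measurable_funepos.
- by move=> x /fh; rewrite !funeposE => ->.
- exact: measurable_funeneg.
- by move=> x /fh; rewrite !funenegE => ->.
Qed.

End ae_integral.

(** * The extension estimate *)

Section balls.
Context (R : realType) (k : nat).
Local Notation Q := (unit_ballRn R k `*` unit_ballRn R k).

Lemma dotRn_sub (x y : Rn R k) :
  dotRn (subRn x y) (subRn x y) = \sum_(i < k) (tnth x i - tnth y i) ^+ 2.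
Proof. by apply: eq_bigr => i _; rewrite !tnth_mktuple mulN1r addr0 mul1r expr2. Qed.

Lemma unit_ballRnE : unit_ballRn R k = [set x | dotRn x x <= 1].
Proof.
by apply/seteqP; split=> x /=; rewrite /unit_ballRn /normRn /= -(@ler_sqrt _ (dotRn x x) 1)// sqrtr1.
Qed.

Lemma measurable_unit_ballRn : measurable (unit_ballRn R k).
Proof.
rewrite unit_ballRnE.
have mf : measurable_fun setT (fun x : Rn R k => dotRn x x) by exact: measurable_dotRn.
rewrite (_ : [set x | _] = (fun x : Rn R k => dotRn x x) @^-1` `]-oo, 1]); last first.
  by apply/seteqP; split => x /=; rewrite in_itv.
by rewrite -[X in measurable X]setTI; exact: mf.
Qed.

(** On the product of balls |xi|^2 + |eta|^2 <= 2, so exp (- 2) serves as the lower bound c0 for the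
    weight. *)
Lemma gauss_weight_ball (z : freqT R k) : gauss_weight z < expR (- 2) -> ~ Q z.
Proof.
rewrite unit_ballRnE => zlt [/= z1 z2]; move: zlt.
by rewrite /gauss_weight -expRD ltr_expR; lra.
Qed.

Lemma measurable_ball_space (c : spaceT R k) r : measurable (ball_space c r).
Proof.
have mf : measurable_fun setT (dist_space c).
  apply: (measurableT_comp (continuous_measurable_fun (@sqrt_continuous R))).
  have msq (F : spaceT R k -> Rn R k) (a : Rn R k) : measurable_fun setT F ->
      measurable_fun setT (fun x => \sum_(i < k) (tnth a i - tnth (F x) i) ^+ 2).
    move=> mF; apply: measurable_sum => i; apply: measurable_funX.
    by apply: measurable_funB => //; exact: (measurableT_comp (@measurable_tnthR R k i) mF).
  apply: measurable_funD; last first.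
    by apply: measurable_funX; apply: measurable_funB.
  by apply: measurable_funD; apply: msq; apply: measurableT_comp.
rewrite (_ : ball_space c r = dist_space c @^-1` `]-oo, r]); last first.
  by apply/seteqP; split => x /=; rewrite in_itv.
by rewrite -[X in measurable X]setTI; exact: mf.
Qed.

(** The factor exp (r^2) makes the Gaussian at least 1 on the ball. Its integral grows with r,
    harmlessly: the majorant [al] leaves no trace in the level set bound. *)
Definition ball_weight (c : spaceT R k) (r : R) (y : freqT R k) : R :=
  expR (r ^+ 2) * (expR (- dotRn (subRn y.1 c.1.1) (subRn y.1 c.1.1)) *
                   expR (- dotRn (subRn y.2 c.1.2) (subRn y.2 c.1.2))).

Lemma integrable_ball_weight c r :
  (lebesgue_freq R k).-integrable setT (EFin \o ball_weight c r).
Proof.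
have igs (y : Rn R k) : (lebesgue_Rn R k).-integrable setT
    (EFin \o (fun x => expR (- dotRn (subRn x y) (subRn x y)))).
  exact: (integrable_affineRn _ (@ltr01 R) (integrable_gaussRn R k)).
by apply: integrable_scalel; exact: (integrable_mulmul (igs c.1.1) (igs c.1.2)).
Qed.

Lemma ball_weight_ge0 c r y : 0 <= ball_weight c r y.
Proof. by rewrite !mulr_ge0 ?expR_ge0. Qed.

Lemma ball_space_dominated (c : spaceT R k) (r : R) (A : set (spaceT R k)) y t :
  0 <= r -> A `<=` ball_space c r ->
  \1_A (y, t) <= ball_weight c r y * \1_(`[c.2 - r, c.2 + r]%classic : set (measurableTypeR R)) t :> R.
Proof.
move=> r0 Ac; rewrite !indicE; have [|_] := boolP ((y, t) \in A); last first.
  by rewrite mulr_ge0// ball_weight_ge0.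
rewrite inE => /Ac; rewrite /ball_space /= /dist_space /=.
have e (a b : Rn R k) : \sum_(i < k) (tnth a i - tnth b i) ^+ 2 = dotRn (subRn b a) (subRn b a).
  by rewrite -dotRn_sub dotRn_subC.
rewrite !e -[r]ger0_norm// -sqrtr_sqr ler_sqrt ?sqr_ge0// sqrtr_sqr ger0_norm//.
have := dotRn_ge0 (subRn y.1 c.1.1); have := dotRn_ge0 (subRn y.2 c.1.2).
rewrite /ball_weight; move: (dotRn _ _) (dotRn _ _) => b a b0 a0 hr.
have ct : `|t - c.2| <= r.
  rewrite -[leRHS]ger0_norm// -!sqrtr_sqr ler_sqrt ?sqr_ge0//; have := sqr_ge0 (c.2 - t); lra.
rewrite mem_set ?mulr1.
  by rewrite -!expRD -expR0 ler_expR; have := sqr_ge0 (c.2 - t); lra.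
by rewrite /= in_itv/=; move: ct; rewrite ler_norml => /andP[]; lra.
Qed.

End balls.

(** * The weak-type bound for the quartic phase *)

Section level.
Context (R : realType) (k : nat).
Hypothesis k_gt0 : (0 < k)%N.
Local Notation Q := (unit_ballRn R k `*` unit_ballRn R k).
Local Notation mF := (lebesgue_freq R k).
Local Notation sigma := (k%:R / 2 : R).

(** One constant for two tasks: it bounds the decay constant of the kernel and, through the integral
    of the weight, the sup bound for the wave; the 1 makes it positive. *)
Definition far_cst : R := 2 * decay_cst R k ^+ 2 + \int[mF]_z gauss_weight z + 1.

Definition level_cst : R :=
  4 * diag_cst R k / expR (- 2) * (2 * far_cst / expR (- 2)) `^ sigma^-1.

Let W0 : 0 <= \int[mF]_z gauss_weight z.
Proof. by apply: Rintegral_ge0 => z _; exact: gauss_weight_ge0. Qed.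

Lemma far_cst_gt0 : 0 < far_cst.
Proof. by rewrite ltr_wpDl// addr_ge0// mulr_ge0 ?sqr_ge0. Qed.

Lemma level_cst_ge0 : 0 <= level_cst.
Proof.
apply: mulr_ge0; last exact: powR_ge0.
by apply: divr_ge0; [apply: mulr_ge0 => //; exact: diag_cst_ge0|exact: expR_ge0].
Qed.

Variables (u v : freqT R k -> R).
Hypothesis mu_ : measurable_fun setT u.
Hypothesis mv : measurable_fun setT v.
Hypothesis supp : forall z, ~ Q z -> u z = 0 /\ v z = 0.
Hypothesis iuv : mF.-integrable setT (EFin \o (fun z => u z ^+ 2 + v z ^+ 2)).

Local Notation wav := (wave mF (@phase_uncurried R k) u v).
Let G2 := \int[mF]_z (u z ^+ 2 + v z ^+ 2).

Let mphi := @measurable_phase R k.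
Let supp' z : gauss_weight z < expR (- 2) -> u z = 0 /\ v z = 0.
Proof. move=> h; apply: supp; exact: gauss_weight_ball h. Qed.

Lemma wave_sqr_le_far x : wav x ^+ 2 <= 2 * far_cst / expR (- 2) * G2.
Proof.
have G20 : 0 <= G2 by apply: Rintegral_ge0 => z _; rewrite addr_ge0 ?sqr_ge0.
have := wave_sqr_le mphi (@gauss_weight_ge0 R k) (integrable_gauss_weight R k)
  (expR_gt0 _) mu_ mv supp' iuv x.
move=> /le_trans; apply; rewrite mulrC ler_wpM2r// ler_wpM2r ?invr_ge0 ?expR_ge0//.
rewrite ler_pM2l// /far_cst -addrA; apply: ler_wpDl; first by rewrite mulr_ge0 ?sqr_ge0.
by rewrite lerDl.
Qed.

Lemma wave_level_le (c : spaceT R k) (r lam : R) : 0 <= r -> 0 < lam ->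
  (lebesgue_space R k (ball_space c r `&` [set x | (lam < wav x)%R]) <=
   (level_cst * G2 `^ (1 + sigma^-1) / lam `^ (2 + 2 / sigma))%:E)%E.
Proof.
move=> r0 lam0; have G20 : 0 <= G2.
  by apply: Rintegral_ge0 => z _; rewrite addr_ge0 ?sqr_ge0.
set A := (_ `&` _).
have s0 : 0 < sigma by rewrite divr_gt0// ltr0n.
have rhs0 : 0 <= level_cst * G2 `^ (1 + sigma^-1) / lam `^ (2 + 2 / sigma).
  apply: divr_ge0; last exact: powR_ge0.
  by apply: mulr_ge0; [exact: level_cst_ge0|exact: powR_ge0].
(* A level too high for [level_set_le] is above the sup bound, so its level set is empty. *)
have [lamG|lamG] := leP (expR (- 2) * lam ^+ 2) (2 * far_cst * G2); last first.
  rewrite (_ : A = set0) ?measure0 ?lee_fin//.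
  apply/seteqP; split => // x [_ /= lx].
  have := wave_sqr_le_far x; rewrite mulrAC ler_pdivlMr ?expR_gt0// leNgt => /negP; apply.
  apply: (lt_trans lamG); rewrite mulrC ltr_pM2r ?expR_gt0//.
  by rewrite ltrXn2r// ?nnegrE ltW// (lt_trans lam0).
have mW : measurable_fun setT wav by exact: measurable_wave.
have mA : measurable A.
  apply: measurableI; first exact: measurable_ball_space.
  rewrite (_ : [set x | _] = wav @^-1` `]lam, +oo[); last first.
    by apply/seteqP; split => x /=; rewrite in_itv/= andbT.
  by rewrite -[X in measurable X]setTI; exact: mW.
pose I : set (measurableTypeR R) := `[c.2 - r, c.2 + r]%classic.
have mI : measurable I by exact: measurable_itv.
have Ioo : (lebesgue_measure I < +oo)%E.
  by rewrite /I lebesgue_measure_itv/=; case: ifP => _; rewrite ?ltry// -EFinB ltry.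
have Aal y t : \1_A (y, t) <= ball_weight c r y * \1_I t :> R.
  by apply: ball_space_dominated => // x [].
have := level_set_le mphi (@gauss_weight_ge0 R k) (integrable_gauss_weight R k)
  (expR_gt0 _) mu_ mv supp' iuv mA mI Ioo (@ball_weight_ge0 R k c r)
  (integrable_ball_weight c r) Aal s0 far_cst_gt0 (@diag_cst_ge0 R k)
  (fun t y y' => kern_diag_le y y' t) (@integrable_diag_kern R k)
  (@Rintegral_diag_kern R k) _ lam0 _ lamG.
have Aoo := near_far_finite mA mI Ioo
  (integrable_ball_weight c r) Aal.
move=> h; rewrite -[leLHS]fineK ?ge0_fin_numE// lee_fin.
apply: (le_trans (h _ _)).
- move=> y y' t s ts; apply: (le_trans (kern_decay (x := (y, t)) (x' := (y', s)) ts)).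
  by rewrite /far_cst -addrA lerDl addr_ge0.
- by move=> x [_ /ltW].
rewrite le_eqVlt; apply/orP; left; apply/eqP.
have c0 : 0 < expR (- 2) :> R by exact: expR_gt0.
have s1 : 0 < sigma^-1 by rewrite invr_gt0.
have D0 := far_cst_gt0.
rewrite /level_cst (_ : 2 * far_cst * G2 / _ = (2 * far_cst / expR (- 2)) * (G2 / lam ^+ 2)); last first.
  by field; rewrite !gt_eqF.
have e : (G2 / lam ^+ 2) `^ sigma^-1 = G2 `^ sigma^-1 / lam `^ (2 / sigma).
  rewrite powRM ?invr_ge0 ?sqr_ge0//; congr (_ * _).
  by rewrite -(powR_invn 2 (ltW lam0)) -powRrM mulNr powRN.
have d0 : 0 <= 2 * far_cst / expR (- 2).
  by apply: divr_ge0; [apply: mulr_ge0 => //; exact: ltW|exact: ltW].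
have g0 : 0 <= G2 / lam ^+ 2 by rewrite divr_ge0 ?sqr_ge0.
have eG : G2 `^ (1 + sigma^-1) = G2 * G2 `^ sigma^-1.
  by rewrite powRD ?powRr1// gt_eqF// addr_gt0.
have el : lam `^ (2 + 2 / sigma) = lam ^+ 2 * lam `^ (2 / sigma).
  by rewrite powRD ?(powR_mulrn 2 (ltW lam0))// (gt_eqF lam0) implybT.
rewrite (powRM _ d0 g0) e eG el -/G2; field.
by rewrite !gt_eqF ?powR_gt0.
Qed.

End level.

Lemma sqrt_sqrD_le (R : rcfType) (l a b : R) : 0 <= l ->
  a <= l / 2 -> - a <= l / 2 -> b <= l / 2 -> - b <= l / 2 ->
  Num.sqrt (a ^+ 2 + b ^+ 2) <= l.
Proof.
move=> l0 a1 a2 b1 b2; rewrite -[leRHS]ger0_norm// -sqrtr_sqr; apply: ler_wsqrtr.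
have : (l / 2 - a) * (l / 2 + a) >= 0 by rewrite mulr_ge0//; lra.
have : (l / 2 - b) * (l / 2 + b) >= 0 by rewrite mulr_ge0//; lra.
have := sqr_ge0 l; lra.
Qed.

(** * From one-sided real level sets to the modulus in L^p *)

Section Lp_bound.
Context (R : realType) (k : nat).
Hypothesis k_gt0 : (0 < k)%N.
Local Notation Q := (unit_ballRn R k `*` unit_ballRn R k).
Local Notation mF := (lebesgue_freq R k).
Local Notation mX := (lebesgue_space R k).
Local Notation sigma := (k%:R / 2 : R).
Local Notation q := (2 + 2 / sigma).
Local Notation sup_cst := (2 * far_cst R k / expR (- 2)).

(** The 4 and the first 2^q come from the four half-levels in [wave_modulus_level_le], the power of
    2 * [sup_cst] from the top level M, and the rest from the geometric sum. *)
Definition Lp_cst (p : R) : R :=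
  4 * level_cst R k * 2 `^ q * (2 * sup_cst) `^ ((p - q) / 2) * 2 `^ q / (1 - 2^-1 `^ (p - q)).

Variables (u v : freqT R k -> R).
Hypothesis mu_ : measurable_fun setT u.
Hypothesis mv : measurable_fun setT v.
Hypothesis supp : forall z, ~ Q z -> u z = 0 /\ v z = 0.
Hypothesis iuv : mF.-integrable setT (EFin \o (fun z => u z ^+ 2 + v z ^+ 2)).

Local Notation wav := (wave mF (@phase_uncurried R k)).
Let G2 := \int[mF]_z (u z ^+ 2 + v z ^+ 2).
Let G20 : 0 <= G2. Proof. by apply: Rintegral_ge0 => z _; rewrite addr_ge0 ?sqr_ge0. Qed.

Let mN (f : freqT R k -> R) : measurable_fun setT f -> measurable_fun setT (fun z => - f z).
Proof. exact: measurableT_comp. Qed.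
Let mu' := mN mu_.
Let mv' := mN mv.

Let supp1 z : ~ Q z -> u z = 0 /\ - v z = 0.
Proof. by move=> /supp[-> ->]; rewrite oppr0. Qed.
Let supp2 z : ~ Q z -> v z = 0 /\ u z = 0.
Proof. by move=> /supp[-> ->]. Qed.
Let supp3 z : ~ Q z -> - u z = 0 /\ v z = 0.
Proof. by move=> /supp[-> ->]; rewrite oppr0. Qed.
Let supp4 z : ~ Q z -> - v z = 0 /\ - u z = 0.
Proof. by move=> /supp[-> ->]; rewrite oppr0. Qed.

Let e1 z : u z ^+ 2 + (- v z) ^+ 2 = u z ^+ 2 + v z ^+ 2. Proof. by rewrite sqrrN. Qed.
Let e2 z : v z ^+ 2 + u z ^+ 2 = u z ^+ 2 + v z ^+ 2. Proof. by rewrite addrC. Qed.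
Let e3 z : (- u z) ^+ 2 + v z ^+ 2 = u z ^+ 2 + v z ^+ 2. Proof. by rewrite sqrrN. Qed.
Let e4 z : (- v z) ^+ 2 + (- u z) ^+ 2 = u z ^+ 2 + v z ^+ 2. Proof. by rewrite !sqrrN addrC. Qed.

Let ieq (f : freqT R k -> R) : (forall z, f z = u z ^+ 2 + v z ^+ 2) ->
  mF.-integrable setT (EFin \o f).
Proof. by move=> h; apply: eq_integrable iuv => // z _ /=; rewrite h. Qed.

Let Geq (f : freqT R k -> R) : (forall z, f z = u z ^+ 2 + v z ^+ 2) ->
  \int[mF]_z f z = G2.
Proof. by move=> h; apply: eq_Rintegral => z _; rewrite h. Qed.

(** X and Y are the real and imaginary parts of the extension of u + i v. *)
Let X x := wav u (fun z => - v z) x.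
Let Y x := wav v u x.

Definition wave_modulus x : R := Num.sqrt (X x ^+ 2 + Y x ^+ 2).

Let mX_ : measurable_fun setT X.
Proof. exact: (measurable_wave mF (@measurable_phase R k) mu_ mv'). Qed.
Let mY_ : measurable_fun setT Y.
Proof. exact: (measurable_wave mF (@measurable_phase R k) mv mu_). Qed.

Lemma measurable_wave_modulus : measurable_fun setT wave_modulus.
Proof.
apply: (measurableT_comp (continuous_measurable_fun (@sqrt_continuous R))).
by apply: measurable_funD; exact: measurable_funX.
Qed.

Let XN x : wav (fun z => - u z) v x = - X x.
Proof.
rewrite /X /wave -mulN1r -RintegralZl//.
  by apply: eq_Rintegral => z _; ring.
exact: (integrable_wave (@measurable_phase R k) (@gauss_weight_ge0 R k)
  (integrable_gauss_weight R k) (expR_gt0 (- 2)) mu_ mv'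
  (fun z h => supp1 (gauss_weight_ball h)) (ieq e1)).
Qed.

Let YN x : wav (fun z => - v z) (fun z => - u z) x = - Y x.
Proof.
rewrite /Y /wave -mulN1r -RintegralZl//.
  by apply: eq_Rintegral => z _; ring.
exact: (integrable_wave (@measurable_phase R k) (@gauss_weight_ge0 R k)
  (integrable_gauss_weight R k) (expR_gt0 (- 2)) mv mu_
  (fun z h => supp2 (gauss_weight_ball h)) (ieq e2)).
Qed.

Lemma wave_modulus_le x : wave_modulus x <= (2 * sup_cst * G2) `^ 2^-1.
Proof.
have hX := wave_sqr_le_far mu_ mv' supp1 (ieq e1) x.
have hY := wave_sqr_le_far mv mu_ supp2 (ieq e2) x.
rewrite !Geq// in hX hY.
rewrite powR12_sqrt; last by rewrite -mulrA; apply: mulr_ge0 => //; apply: le_trans hY; exact: sqr_ge0.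
apply: ler_wsqrtr; rewrite -/(X x) in hX; rewrite -/(Y x) in hY; lra.
Qed.

(** The weak-type bound is one-sided and real, but where the modulus exceeds l, one of X, Y, - X, -
    Y exceeds l / 2, and each of them is again a wave with the same L^2 norm. *)
Lemma wave_modulus_level_le (c : spaceT R k) r l : 0 <= r -> 0 < l ->
  (mX (ball_space c r `&` [set x | (l < wave_modulus x)%R]) <=
   (4 * level_cst R k * 2 `^ q * G2 `^ (1 + sigma^-1) / l `^ q)%:E)%E.
Proof.
move=> r0 l0; have l20 : 0 < l / 2 by rewrite divr_gt0.
set B := ball_space c r.
pose S w := B `&` [set x | (l / 2 < w x)%R].
have h1 := wave_level_le k_gt0 mu_ mv' supp1 (ieq e1) c r0 l20.
have h2 := wave_level_le k_gt0 mv mu_ supp2 (ieq e2) c r0 l20.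
have h3 := wave_level_le k_gt0 mu' mv supp3 (ieq e3) c r0 l20.
have h4 := wave_level_le k_gt0 mv' mu' supp4 (ieq e4) c r0 l20.
rewrite !Geq// in h1 h2 h3 h4.
have mS w : measurable_fun setT w -> measurable (S w).
  move=> mw; apply: measurableI; first exact: measurable_ball_space.
  rewrite (_ : [set x | _] = w @^-1` `]l / 2, +oo[); last first.
    by apply/seteqP; split => x /=; rewrite in_itv/= andbT.
  by rewrite -[X in measurable X]setTI; exact: mw.
pose S3 := S (wav (fun z => - u z) v).
pose S4 := S (wav (fun z => - v z) (fun z => - u z)).
have m1 := mS _ mX_; have m2 := mS _ mY_.
have m3 : measurable S3.
  by apply: mS; exact: (measurable_wave mF (@measurable_phase R k) mu' mv).
have m4 : measurable S4.
  by apply: mS; exact: (measurable_wave mF (@measurable_phase R k) mv' mu').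
have mN' : measurable (B `&` [set x | (l < wave_modulus x)%R]).
  apply: measurableI; first exact: measurable_ball_space.
  rewrite (_ : [set x | _] = wave_modulus @^-1` `]l, +oo[); last first.
    by apply/seteqP; split => x /=; rewrite in_itv/= andbT.
  by rewrite -[X in measurable X]setTI; exact: measurable_wave_modulus.
apply: (@le_trans _ _ (mX ((S X `|` S Y) `|`
    (S3 `|` S4)))).
  apply: le_measure; rewrite ?inE//; first by do 2 apply: measurableU => //.
  move=> x [Bx /= lx].
  rewrite /S3 /S4 /S /= XN YN.
  have [?|X1] := ltP (l / 2) (X x); first by left; left.
  have [?|Y1] := ltP (l / 2) (Y x); first by left; right.
  have [?|X2] := ltP (l / 2) (- X x); first by right; left.
  have [?|Y2] := ltP (l / 2) (- Y x); first by right; right.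
  exfalso; move: lx; apply/negP; rewrite -leNgt.
  exact: sqrt_sqrD_le (ltW l0) X1 X2 Y1 Y2.
apply: (@le_trans _ _ (mX (S X `|` S Y) +
    mX (S3 `|` S4))%E).
  by apply: measureU2; exact: measurableU.
have hh a b (e : R) : measurable a -> measurable b -> (mX a <= e%:E -> mX b <= e%:E -> mX (a `|` b) <= (e + e)%:E)%E.
  by move=> ma mb ha hb; apply: (@le_trans _ _ (mX a + mX b)%E); [exact: measureU2|rewrite EFinD leeD].
apply: (le_trans (leeD (hh _ _ _ m1 m2 h1 h2) (hh _ _ _ m3 m4 h3 h4))).
rewrite -EFinD lee_fin le_eqVlt; apply/orP; left; apply/eqP.
have half : 2^-1 `^ q = (2 `^ q)^-1 :> R by rewrite -powRN -powR_inv1// -powRrM mulN1r.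
rewrite (powRM _ (ltW l0))// half.
by field; rewrite !gt_eqF// powR_gt0.
Qed.

Lemma wave_modulus_Lp_le (c : spaceT R k) r p : 0 <= r -> q < p ->
  (\int[mX]_(x in ball_space c r) (wave_modulus x `^ p)%:E <=
   (Lp_cst p * G2 `^ (p / 2))%:E)%E.
Proof.
move=> r0 qp.
have N0 x : 0 <= wave_modulus x by exact: sqrtr_ge0.
have q0 : 0 < q by rewrite addr_gt0// divr_gt0// divr_gt0// ltr0n.
have p0 : 0 < p by exact: lt_trans qp.
have B0 : 0 < 2 * sup_cst.
  by apply: mulr_gt0 => //; apply: divr_gt0; [apply: mulr_gt0 => //; exact: far_cst_gt0|exact: expR_gt0].
(* [layer_cake] requires a positive top level M, so the zero function is treated apart. *)
have [G2z|G2n] := eqVneq G2 0.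
  have Nz x : wave_modulus x = 0.
    apply/eqP; rewrite eq_le N0 andbT; apply: (le_trans (wave_modulus_le x)).
    by rewrite G2z mulr0 powR0// gt_eqF.
  under eq_integral do rewrite Nz powR0 ?gt_eqF//.
  by rewrite integral0 lee_fin G2z powR0 ?mulr0// gt_eqF// divr_gt0.
have G2_gt0 : 0 < G2 by rewrite lt_def G2n.
have M0 : 0 < (2 * sup_cst * G2) `^ 2^-1 by rewrite powR_gt0// mulr_gt0.
have K0 : 0 <= 4 * level_cst R k * 2 `^ q * G2 `^ (1 + sigma^-1).
  apply: mulr_ge0; last exact: powR_ge0.
  apply: mulr_ge0; last exact: powR_ge0.
  by apply: mulr_ge0 => //; exact: level_cst_ge0.
have qp' : 0 < q < p by rewrite q0.
apply: (le_trans (layer_cake (measurable_ball_space c r) measurable_wave_modulus M0 K0 qp' N0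
  (fun x _ => wave_modulus_le x) (fun l l0 => wave_modulus_level_le c r0 l0))).
rewrite lee_fin le_eqVlt; apply/orP; left; apply/eqP.
rewrite -powRrM (powRM _ (ltW B0) G20) (mulrC 2^-1) /Lp_cst.
(* The powers of the L^2 norm add up because q / 2 = 1 + 1 / sigma. *)
have -> : G2 `^ (p / 2) = G2 `^ (1 + sigma^-1) * G2 `^ ((p - q) / 2).
  rewrite -powRD; last by rewrite G2n implybT.
  by congr (_ `^ _); field; rewrite pnatr_eq0 -lt0n.
ring.
Qed.

End Lp_bound.

Lemma normcE (R : realType) (z : R[i]) :
  Normc.normc z = Num.sqrt (complex.Re z ^+ 2 + complex.Im z ^+ 2).
Proof. by case: z. Qed.

Lemma cLnormE d (T : measurableType d) (R : realType) (mu : {measure set T -> \bar R})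
    (p : R) (D : set T) (f : T -> R[i]) : 0 < p ->
  cLnorm mu p D f = ((\int[mu]_(x in D) (Normc.normc (f x) `^ p)%:E) `^ p^-1)%E.
Proof.
move=> p0; rewrite /cLnorm unlock; congr (_ `^ _)%E.
rewrite [RHS]integral_mkcond; apply: eq_integral => x _.
rewrite !patchE; case: ifPn => _ /=; last by rewrite normr0 powR0// gt_eqF.
by rewrite ger0_norm// normcE sqrtr_ge0.
Qed.

Lemma Lp_cst_ge0 (R : realType) k (p : R) : 2 + 2 / (k%:R / 2) < p -> 0 <= Lp_cst k p.
Proof.
move=> qp; apply: divr_ge0.
  do 3 (apply: mulr_ge0; last exact: powR_ge0).
  by apply: mulr_ge0 => //; exact: level_cst_ge0.
rewrite subr_ge0; set e := p - _; apply: (@le_trans _ _ (1 `^ e)); last by rewrite powR1.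
by apply: ge0_ler_powR; rewrite ?nnegrE ?subr_ge0 ?(ltW qp)// invf_le1// ler1n.
Qed.

(** * Reduction to Borel data supported in the product of balls *)

Section representative.
Context (R : realType) (k : nat).
Local Notation mF := (lebesgue_freq R k).
Local Notation mX := (lebesgue_space R k).
Local Notation Q := (unit_ballRn R k `*` unit_ballRn R k).

Let mQ : measurable Q.
Proof. by apply: measurableX; exact: measurable_unit_ballRn. Qed.

(** Restrict a Borel representative of g to the product of balls. The null set where it differs from
    g affects neither the L^2 norm nor the integral that defines the extension, so the modulus
    agrees at every x and not merely almost everywhere. *)
Lemma cLfun_representative (g : freqT R k -> R[i]) : cLfun mF 2 Q g ->
  exists u v : freqT R k -> R, [/\ measurable_fun setT u /\ measurable_fun setT v,
    (forall z, ~ Q z -> u z = 0 /\ v z = 0),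
    mF.-integrable setT (EFin \o (fun z => u z ^+ 2 + v z ^+ 2)),
    cLnorm mF 2 Q g = ((\int[mF]_z (u z ^+ 2 + v z ^+ 2)) `^ 2^-1)%:E &
    forall x, Normc.normc (extension_op Q g x) = wave_modulus u v x].
Proof.
move=> [[h [mhr mhi] gh] goo].
pose u := (@complex.Re R \o h) \_ Q; pose v := (@complex.Im R \o h) \_ Q.
have mu_ : measurable_fun setT u by exact/(measurable_restrictT _ mQ).
have mv : measurable_fun setT v by exact/(measurable_restrictT _ mQ).
have uvin z : Q z -> u z = complex.Re (h z) /\ v z = complex.Im (h z).
  by move=> Qz; rewrite /u /v !patchE mem_set.
have uvout z : ~ Q z -> u z = 0 /\ v z = 0.
  by move=> Qz; rewrite /u /v !patchE memNset.
have m2 : measurable_fun setT (fun z => u z ^+ 2 + v z ^+ 2).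
  by apply: measurable_funD; exact: measurable_funX.
have nE : (\int[mF]_(z in Q) (Normc.normc (g z) `^ 2)%:E = \int[mF]_z (u z ^+ 2 + v z ^+ 2)%:E)%E.
  rewrite [LHS](@ae_eq_integral_measurable _ _ _ _ _ (fun z => (u z ^+ 2 + v z ^+ 2)%:E))//.
  - rewrite integral_mkcond; apply: eq_integral => z _; rewrite patchE; case: ifPn => //.
    by move/negP; rewrite inE => /uvout[-> ->]; rewrite expr0n addr0.
  - by apply: measurable_funTS; exact/measurable_EFinP.
  apply: filterS gh => z gz Qz; rewrite gz// normcE (powR_mulrn 2)// sqr_sqrtr ?addr_ge0 ?sqr_ge0//.
  by have [-> ->] := uvin _ Qz.
have uv0 z : 0 <= u z ^+ 2 + v z ^+ 2 by rewrite addr_ge0 ?sqr_ge0.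
have iuv : mF.-integrable setT (EFin \o (fun z => u z ^+ 2 + v z ^+ 2)).
  apply/integrableP; split; first exact/measurable_EFinP.
  under eq_integral do rewrite /= ger0_norm//.
  by move: goo; rewrite cLnormE// nE => /lty_poweRy; apply.
exists u, v; split => //.
  by rewrite cLnormE// nE -EFin_Rintegral// poweR_EFin.
move=> x; rewrite normcE /wave_modulus /extension_op /cintegral /=.
have mphz : measurable_fun setT (fun z : freqT R k => phase x z).
  exact: (measurableT_comp (@measurable_phase R k) (pair1_measurable x)).
have mc : measurable_fun setT (fun z : freqT R k => cos (phase x z)).
  exact: (measurableT_comp (@measurable_cosR R) mphz).
have ms : measurable_fun setT (fun z : freqT R k => sin (phase x z)).
  exact: (measurableT_comp (@measurable_sinR R) mphz).
have key (f F : freqT R k -> R) : measurable_fun setT F ->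
    (forall z, ~ Q z -> F z = 0) -> {ae mF, forall z, Q z -> f z = F z} ->
    \int[mF]_(z in Q) f z = \int[mF]_z F z.
  move=> mFF F0 fF; congr fine.
  rewrite [LHS](@ae_eq_integral_measurable _ _ _ _ _ (EFin \o F))//.
  - rewrite integral_mkcond; apply: eq_integral => z _; rewrite patchE; case: ifPn => //.
    by move/negP; rewrite inE => /F0 /= ->.
  - by apply: measurable_funTS; exact/measurable_EFinP.
  by apply: filterS fF => z fz Qz; rewrite fz.
rewrite (key _ (fun z => u z * cos (phase x z) + - v z * sin (phase x z))).
- rewrite (key _ (fun z => v z * cos (phase x z) + u z * sin (phase x z))) //.
  + by apply: measurable_funD; apply: measurable_funM.
  + by move=> z /uvout[-> ->]; rewrite !mul0r addr0.
  + apply: filterS gh => z gz Qz; rewrite gz//; have [-> ->] := uvin _ Qz.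
    by case: (h z) => a b; rewrite /cexp /= addrC.
- by apply: measurable_funD; apply: measurable_funM => //; exact: measurableT_comp.
- by move=> z /uvout[-> ->]; rewrite oppr0 !mul0r addr0.
- apply: filterS gh => z gz Qz; rewrite gz//; have [-> ->] := uvin _ Qz.
  by case: (h z) => a b; rewrite /cexp /= mulNr.
Qed.

End representative.

Theorem theorem1p3 (R : realType) (k : nat) (hk : (2 <= k)%N) (p : R)
    (hp : (2 * k + 4)%:R / k%:R < p) (eps : R) (heps : 0 < eps) :
  exists2 C : R, 0 < C &
    forall (r : R) (c : spaceT R k) (g : freqT R k -> complex R),
      1 <= r ->
      cLfun (lebesgue_freq R k) 2 (unit_ballRn R k `*` unit_ballRn R k) g ->
      (cLnorm (lebesgue_space R k) p (ball_space c r)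
         (extension_op (unit_ballRn R k `*` unit_ballRn R k) g)
       <= (C * r `^ eps)%:E *
          cLnorm (lebesgue_freq R k) 2 (unit_ballRn R k `*` unit_ballRn R k) g)%E.
Proof.
have k_gt0 : (0 < k)%N by exact: leq_trans hk.
have kR : 0 < k%:R :> R by rewrite ltr0n.
have qp : 2 + 2 / (k%:R / 2) < p.
  rewrite (_ : _ + _ = (2 * k + 4)%:R / k%:R)// natrD natrM; field; by rewrite gt_eqF.
have q0 : 0 < 2 + 2 / (k%:R / 2) :> R by rewrite addr_gt0// divr_gt0// divr_gt0.
have p0 : 0 < p by exact: lt_trans qp.
(* The summand 1 makes the constant positive, as [Lp_cst] is only known to be nonnegative. *)
exists (Lp_cst k p `^ p^-1 + 1); first by rewrite ltr_wpDl// powR_ge0.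
move=> r c g r1 /cLfun_representative[u [v [[mu_ mv] uv0 iuv -> NE]]].
set G2 := \int[_]_z _.
have G20 : 0 <= G2 by apply: Rintegral_ge0 => z _; rewrite addr_ge0 ?sqr_ge0.
have r0 : 0 <= r by exact: le_trans r1.
have := wave_modulus_Lp_le k_gt0 mu_ mv uv0 iuv c r0 qp.
rewrite cLnormE//; under [in X in _ -> X]eq_integral do rewrite NE.
rewrite -/G2; set I := integral _ _ _ => hI.
have I0 : (0 <= I)%E by apply: integral_ge0 => x _; rewrite lee_fin powR_ge0.
have C0 : 0 <= Lp_cst k p * G2 `^ (p / 2) by rewrite -lee_fin (le_trans I0).
have Lp0 := Lp_cst_ge0 qp.
apply: (@le_trans _ _ ((Lp_cst k p * G2 `^ (p / 2))%:E `^ p^-1)%E).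
  by apply: gt0_ler_poweR; rewrite ?invr_ge0 ?in_itv/= ?I0 ?leey ?lee_fin ?C0// ltW.
rewrite poweR_EFin -EFinM lee_fin powRM ?powR_ge0//.
(* Taking the p-th root of G2^(p / 2) leaves G2^(1 / 2), the L^2 norm of g. *)
rewrite -powRrM mulrAC divff ?gt_eqF// mul1r ler_wpM2r ?powR_ge0//.
have rE : 1 <= r `^ eps.
  have <- : 1 `^ eps = 1 :> R by rewrite powR1.
  by apply: ge0_ler_powR; rewrite ?nnegrE // ltW.
rewrite -[leLHS]mulr1; apply: ler_pM => //; first exact: powR_ge0.
by rewrite lerDl.
Qed.
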